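(* Let $K>1$ and suppose $f$ is a spectral density bounded away from zero with $\sum_{r\in\mathbb{Z}}|r^Kc_f(r)|<\infty$, where $f(\omega)=\sigma^2|\phi(\omega;f)|^{-2}$. Let $X_1,\ldots,X_n$ be observations from a zero mean second order stationary time series with spectral density $f$. For $s\ge1$ define the $s$-order predictive DFT $$\widehat{J}_n^{(s)}(\omega;f)=\frac{n^{-1/2}}{\phi(\omega;f)}\sum_{t=1}^nX_t\,\zeta_{t,n}^{(s)}(\omega;f)+e^{i(n+1)\omega}\frac{n^{-1/2}}{\overline{\phi(\omega;f)}}\sum_{t=1}^nX_{n+1-t}\,\overline{\zeta_{t,n}^{(s)}(\omega;f)}.$$ Then $$\widehat{J}_n(\omega;f)=\sum_{s=1}^\infty\widehat{J}_n^{(s)}(\omega;f)$$ and $D_n(f)=\sum_{s=1}^\infty D_n^{(s)}(f)$, where $$(D_n^{(s)}(f))_{k,t}=n^{-1/2}\frac{\zeta_{t,n}^{(s)}(\omega_{k,n};f)}{\phi(\omega_{k,n};f)}+n^{-1/2}e^{i\omega_{k,n}}\frac{\overline{\zeta_{n+1-t,n}^{(s)}(\omega_{k,n};f)}}{\overline{\phi(\omega_{k,n};f)}}.$$ Further, for sufficiently large $n$ and for $m\geq 1$, $$\widehat{J}_n(\omega;f)=\sum_{s=1}^m\widehat{J}_n^{(s)}(\omega;f)+O_p\left(\frac{1}{n^{m(K-1)+1/2}}\right).$$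
   Context: Time series are real-valued. $f(\omega)=\sum_rc_f(r)e^{ir\omega}$ (symmetric about $\pi$ on $[0,2\pi]$), with canonical (causal, minimum phase) factorisation $f=\sigma^2|\phi(\omega;f)|^{-2}$, $\phi(\omega;f)=1-\sum_{j\ge1}\phi_j(f)e^{-ij\omega}$. $\omega_{k,n}=2\pi k/n$. For $\tau\le0$ and $\tau>n$, $\{\phi_{t,n}(\tau;f)\}_{t=1}^n$ are the coefficients of the best (in mean square) linear predictor of $X_\tau$ given $X_1,\ldots,X_n$; $\widehat{X}_{\tau,n}=\sum_{t=1}^n\phi_{t,n}(\tau;f)X_t$; $\widehat{J}_n(\omega;f)=n^{-1/2}\sum_{\tau\le0}\widehat{X}_{\tau,n}e^{i\tau\omega}+n^{-1/2}\sum_{\tau>n}\widehat{X}_{\tau,n}e^{i\tau\omega}$; $$D_{n}(f)_{k,t}= n^{-1/2}\sum_{\tau\leq 0}\left(\phi_{t,n}(\tau;f)e^{i\tau\omega_{k,n}}+\phi_{n+1-t,n}(\tau;f)e^{-i(\tau-1)\omega_{k,n}}\right),\quad 1\le k,t\le n.$$ Let $\phi_t^\infty(\omega;f)=\sum_{s=0}^\infty\phi_{t+s}(f)e^{-is\omega}$ and $$\Phi_n(\lambda_1,\lambda_2)=\sum_{u=0}^\infty\phi_{n+1+u}^\infty(\lambda_1;f)e^{iu\lambda_2}=\sum_{u=0}^\infty\sum_{s=0}^\infty\phi_{n+1+u+s}(f)e^{-is\lambda_1}e^{iu\lambda_2}.$$ Define $\zeta_{t,n}^{(1)}(\omega;f)=\phi_t^\infty(\omega;f)$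 and, for $s\ge2$, with $\lambda_1=\omega$, $$\zeta_{t,n}^{(s)}(\omega;f)=\frac{1}{(2\pi)^{s-1}}\int_{[0,2\pi]^{s-1}}\left(\prod_{a=1}^{s-1}\phi(\lambda_{a+1};f)^{-1}\Phi_n(\lambda_a,\lambda_{a+1})\right)g_{t,n}^{(s)}(\lambda_s)\,d\lambda_2\cdots d\lambda_s,$$ where $g_{t,n}^{(s)}(\lambda)=\phi_t^\infty(\lambda;f)$ if $s$ is odd and $g_{t,n}^{(s)}(\lambda)=\phi_{n+1-t}^\infty(\lambda;f)$ if $s$ is even. *)

(* Defs.v *)
From HB Require Import structures.
From mathcomp Require Import all_boot all_order all_algebra.
From mathcomp Require Import complex.
From mathcomp Require Import all_classical all_reals all_analysis.
Import Order.TTheory GRing.Theory Num.Theory.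
Import numFieldNormedType.Exports.

Set Implicit Arguments.
Unset Strict Implicit.
Unset Printing Implicit Defensive.

Local Open Scope classical_set_scope.
Local Open Scope ring_scope.
Local Open Scope complex_scope.

Section ComplexAnalysis.
Variable R : realType.

(* [R[i]^o] is [R[i]] with the topology given by the modulus. *)
Definition csum (u : nat -> R[i]) : R[i] :=
  limn (series (u : nat -> R[i]^o)).

(* Sum over the integers; all the families it is applied to are absolutely
   summable. *)
Definition zsum (u : int -> R[i]) : R[i] :=
  csum (fun k => u k%:Z) + csum (fun k => u (- k.+1%:Z)).

Definition csum_to (u : nat -> R[i]) (l : R[i]) : Prop :=
  (fun m => \sum_(1 <= s < m.+1) u s : R[i]^o) @ \oo --> (l : R[i]^o).

Definition expi (w : R) : R[i] := cos w +i* sin w.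

Definition cint (F : R -> R[i]) : R[i] :=
  Rintegral lebesgue_measure `[0, 2 * pi] (fun w => complex.Re (F w)) +i*
  Rintegral lebesgue_measure `[0, 2 * pi] (fun w => complex.Im (F w)).

(* Integral over [0, 2 pi]^d, as an iterated integral, of a function of the
   sequence of the d coordinates. *)
Fixpoint cint_cube (d : nat) (F : seq R -> R[i]) : R[i] :=
  if d is d'.+1 then cint (fun l => cint_cube d' (fun ls => F (l :: ls)))
  else F [::].

End ComplexAnalysis.

Section Predictive.
Variable R : realType.

(* [c r] is the r-th Fourier coefficient c_f(r); the time series is real
   valued, so the coefficients are real. *)
Definition fourier_expansion (f : R -> R) (c : int -> R) : Prop :=
  forall w, (f w)%:C = zsum (fun r => (c r)%:C * expi (r%:~R * w)).

Section Factor.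
Variable phi : nat -> R.

(* 1 - sum_(j >= 1) phi_j z^j; the value [phi 0] is never used. *)
Definition ar_series (z : R[i]) : R[i] :=
  1 - csum (fun j => (phi j.+1)%:C * z ^+ j.+1).

Definition phiw (w : R) : R[i] :=
  1 - csum (fun j => (phi j.+1)%:C * expi (- (j.+1%:R * w))).

(* Causal: only nonnegative powers, with absolutely summable coefficients;
   minimum phase: no zero in the closed unit disc.  These conditions determine
   sigma and the phi_j (j >= 1) from f. *)
Definition canonical_factorisation (f : R -> R) (sigma : R) : Prop :=
  [/\ 0 < sigma,
      cvgn (series (fun j => `|phi j.+1|)),
      forall z : R[i], `|z| <= 1 -> ar_series z != 0
    & forall w, (f w)%:C = (sigma ^+ 2)%:C * (`|phiw w| ^+ 2)^-1].

Definition phi_inf (t : nat) (w : R) : R[i] :=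
  csum (fun s => (phi (t + s)%N)%:C * expi (- (s%:R * w))).

Definition Phi_n (n : nat) (l1 l2 : R) : R[i] :=
  csum (fun u => phi_inf (n + 1 + u)%N l1 * expi (u%:R * l2)).

Definition g_zeta (t n s : nat) (l : R) : R[i] :=
  if odd s then phi_inf t l else phi_inf (n + 1 - t)%N l.

(* In the integrand, [nth 0 (w :: ls) (a - 1)] is lambda_a, so lambda_1 = w and
   [ls] lists lambda_2, ..., lambda_s.  For s = 1 the product is empty and the
   value is phi_inf t w. *)
Definition zeta (t n s : nat) (w : R) : R[i] :=
  ((2 * pi) ^+ s.-1)^-1%:C *
  cint_cube s.-1 (fun ls =>
    let lam a := nth 0 (w :: ls) a.-1 in
    (\prod_(1 <= a < s) ((phiw (lam a.+1))^-1 * Phi_n n (lam a) (lam a.+1)))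
    * g_zeta t n s (lam s)).

Definition rsqrtn (n : nat) : R[i] := ((Num.sqrt n%:R)^-1)%:C.

Definition Ds_n (n s : nat) : 'M[R[i]]_n :=
  \matrix_(k < n, t < n)
    let w := 2 * pi * k.+1%:R / n%:R in
    rsqrtn n * (zeta t.+1 n s w / phiw w)
    + rsqrtn n * expi w * ((zeta (n + 1 - t.+1)%N n s w)^* / (phiw w)^*).

Section Dft.
Variables (T : Type) (X : int -> T -> R).

Definition Js_n (n s : nat) (w : R) (x : T) : R[i] :=
  rsqrtn n / phiw w * (\sum_(1 <= t < n.+1) (X t%:Z x)%:C * zeta t n s w)
  + expi (n.+1%:R * w) * (rsqrtn n / (phiw w)^*) *
    (\sum_(1 <= t < n.+1) (X (n + 1 - t)%N%:Z x)%:C * (zeta t n s w)^*).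

End Dft.
End Factor.

(* Below, [b n tau t] stands for phi_{t,n}(tau; f), 1 <= t <= n. *)

Section Predictor.
Variable b : nat -> int -> nat -> R.

Definition D_n (n : nat) : 'M[R[i]]_n :=
  \matrix_(k < n, t < n)
    let w := 2 * pi * k.+1%:R / n%:R in
    rsqrtn n * csum (fun j => let tau : int := - j%:Z in
      (b n tau t.+1)%:C * expi (tau%:~R * w)
      + (b n tau (n + 1 - t.+1)%N)%:C * expi (- ((tau - 1)%:~R * w))).

Variables (T : Type) (X : int -> T -> R).

Definition Xhat (n : nat) (tau : int) (x : T) : R :=
  \sum_(1 <= t < n.+1) b n tau t * X t%:Z x.

Definition J_n (n : nat) (w : R) (x : T) : R[i] :=
  rsqrtn n * csum (fun j => let tau : int := - j%:Z in
    (Xhat n tau x)%:C * expi (tau%:~R * w))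
  + rsqrtn n * csum (fun j => let tau := (n + 1 + j)%N%:Z in
    (Xhat n tau x)%:C * expi (tau%:~R * w)).

End Predictor.

Section Probability.
Context d (T : measurableType d) (P : probability T R).

(* [c] is the autocovariance function. *)
Definition zero_mean_stationary (X : int -> {RV P >-> R}) (c : int -> R) :=
  [/\ forall t, (X t : T -> R) \in Lfun P 2%:E,
      forall t, ('E_P[X t] = 0)%E
    & forall t r, covariance P (X t) (X (t + r)) = (c r)%:E].

(* The coefficients [a 1], ..., [a n] give the best (in mean square) linear
   predictor of X_tau from X_1, ..., X_n. *)
Definition best_linear_predictor (X : int -> {RV P >-> R}) (n : nat)
    (tau : int) (a : nat -> R) : Prop :=
  forall a' : nat -> R,
   ('E_P[fun x => ((X tau x - \sum_(1 <= t < n.+1) a t * X t%:Z x) ^+ 2)%R] <=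
    'E_P[fun x => ((X tau x - \sum_(1 <= t < n.+1) a' t * X t%:Z x) ^+ 2)%R])%E.

Definition is_Op (Z : nat -> T -> R[i]) (a : nat -> R) : Prop :=
  forall e : R, 0 < e -> exists M : R, 0 < M /\
    \forall n \near \oo,
      (P [set x | ((M * a n)%:C < `|Z n x|)%R] <= e%:E)%E.

End Probability.
End Predictive.

(* Main.v *)
(* Write [a] for the coefficients of [phi] and work with functions of [w]. The
   predictor of [X_tau] ([tau <= 0]) satisfies the backward recursion
   [b(tau, t) = sum_(i >= 1) phi_i b(tau + i, t)], with [b(s, t)] the Kronecker
   symbol for [1 <= s <= n], because both sides solve the normal equations (by
   Yule-Walker). Summed against [e^(i tau w)] and combined with time reversal,
   it says that [phi L_t = phi_t^oo + T (phi L_(n+1-t))], where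
   [L_t(w) = sum_(tau <= 0) b(tau, t) e^(i tau w)] and [T] is the integral
   operator with kernel [phi^(-1) Phi_n], for which
   [zeta_t^(s+1) = T zeta_(n+1-t)^(s)]. So the theorem is the convergence of
   the Neumann series of [T].  For every [n], [T] is a strict contraction of the
   L^2 norm on causal functions, and it maps L^2 to the sup norm; for large
   [n] its sup norm is [O(n^(1-K))], because [sum_j j^K |phi_j| < oo].

   That summability is inherited from [c] by commuting the (truncated) weight
   [j^K] past the Toeplitz operator of [f]. It and the causality arguments use
   that [1/phi] is a uniform limit of polynomials in [e^(-iw)]. *)

Require Import Defs.
From HB Require Import structures.
From mathcomp Require Import all_boot all_order all_algebra.
From mathcomp Require Import complex.
From mathcomp Require Import all_classical all_reals all_analysis.
From mathcomp Require Import measurable_realfun.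
From mathcomp Require Import ring lra zify.
Import Order.TTheory GRing.Theory Num.Theory.
Import numFieldNormedType.Exports.

Set Implicit Arguments.
Unset Strict Implicit.
Unset Printing Implicit Defensive.
Local Open Scope classical_set_scope.
Local Open Scope ring_scope.
Local Open Scope complex_scope.

(* In [ring_scope], [^*] would parse as [Num.conj] instead of [conjc]. *)
Local Notation "x ^*" := (conjc x) : ring_scope.

(** * Complex series *)

(** Two norms are needed because neither gives everything. The sup-norm size of the operator falls
    below 1 only for large [n], whereas the series identities hold for every [n >= 1]; the L^2
    contraction factor depends only on the minimum and maximum of [|phi|], so it works for every
    [n], but it does not shrink with [n] and gives no rate.

    No power of [n] is lost by summing over the [n] observations: the coefficient error at [t] is
    bounded by a constant times [tau t + tau (n+1-t)], and the sum of these over [t] is bounded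
    independently of [n]. First absolute moments and Markov's inequality then suffice, and
    [n^(-1/2)] comes only from the normalisation.

    The lower bound [delta] on [f] makes the Toeplitz matrices of [c] coercive. This gives
    uniqueness in the normal equations, on which both the recursion and time reversal rest, and, for
    fixed [n], absolute summability of the predictor coefficients over the targets.

    Causality is encoded as uniform approximability by polynomials, a property stable under products
    and under inversion by small steps, and strong enough to make Fourier coefficients on the wrong
    side vanish. *)

Section ComplexModulus.
Variable R : realType.
Implicit Types z w : R[i].

(** The norm of [R[i]] has values in [R[i]], whose order is partial; this real copy lets estimates
    use the total order of [R]. *)
Definition Nc z : R := complex.Re `|z|.

Lemma NcE z : (Nc z)%:C = `|z|.
Proof. by rewrite /Nc RRe_real // normr_real. Qed.

Lemma Nc_ge0 z : 0 <= Nc z.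
Proof. by rewrite -lecR NcE; exact: normr_ge0. Qed.

Lemma NcM z w : Nc (z * w) = Nc z * Nc w.
Proof. by apply: (@complexI R); rewrite rmorphM !NcE normrM. Qed.

Lemma NcV z : Nc z^-1 = (Nc z)^-1.
Proof. by apply: (@complexI R); rewrite fmorphV !NcE normfV. Qed.

Lemma NcX z n : Nc (z ^+ n) = Nc z ^+ n.
Proof. by apply: (@complexI R); rewrite rmorphXn !NcE normrX. Qed.

Lemma NcD z w : Nc (z + w) <= Nc z + Nc w.
Proof. by rewrite -lecR rmorphD !NcE ler_normD. Qed.

Lemma NcN z : Nc (- z) = Nc z.
Proof. by apply: (@complexI R); rewrite !NcE normrN. Qed.

Lemma NcB z w : Nc (z - w) = Nc (w - z).
Proof. by rewrite -NcN opprB. Qed.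

Lemma Nc0 : Nc 0 = 0.
Proof. by apply: (@complexI R); rewrite NcE normr0. Qed.

Lemma Nc1 : Nc 1 = 1.
Proof. by apply: (@complexI R); rewrite NcE normr1. Qed.

Lemma Nc_real (x : R) : Nc x%:C = `|x|.
Proof. by apply: (@complexI R); rewrite NcE normc_def /= expr0n addr0 sqrtr_sqr. Qed.

Lemma Nc_conj z : Nc z^* = Nc z.
Proof. by apply: (@complexI R); rewrite !NcE normcJ. Qed.

Lemma Num_conjE z : Num.conj z = z^*.
Proof. by []. Qed.

Lemma conjM z w : (z * w)^* = z^* * w^*.
Proof. exact: rmorphM. Qed.

Lemma conjD z w : (z + w)^* = z^* + w^*.
Proof. exact: rmorphD. Qed.

Lemma conjB z w : (z - w)^* = z^* - w^*.
Proof. exact: rmorphB. Qed.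

Lemma conjN z : (- z)^* = - z^*.
Proof. exact: rmorphN. Qed.

Lemma conj_sum (I : Type) (s : seq I) (P : pred I) (F : I -> R[i]) :
  (\sum_(i <- s | P i) F i)^* = \sum_(i <- s | P i) (F i)^*.
Proof. exact: rmorph_sum. Qed.

Lemma Nc_eq0 z : (Nc z == 0) = (z == 0).
Proof. by rewrite -(inj_eq (@complexI R)) NcE normr_eq0. Qed.

Lemma Nc_gt0 z : (0 < Nc z) = (z != 0).
Proof. by rewrite lt_def Nc_eq0 Nc_ge0 andbT. Qed.

Lemma Nc_sqr z : Nc z ^+ 2 = complex.Re z ^+ 2 + complex.Im z ^+ 2.
Proof. by apply: (@complexI R); rewrite add_Re2_Im2 -NcE rmorphXn. Qed.

Lemma mul_conjE z : z * z^* = (Nc z ^+ 2)%:C.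
Proof. by rewrite -sqr_normc -NcE rmorphXn. Qed.

Lemma Nc_Re z : `|complex.Re z| <= Nc z.
Proof. by rewrite -lecR NcE normc_ge_Re. Qed.

Lemma Nc_Im z : `|complex.Im z| <= Nc z.
Proof.
rewrite -(@ler_pXn2r _ 2) ?nnegrE ?Nc_ge0 // Nc_sqr real_normK ?num_real //.
by rewrite lerDr sqr_ge0.
Qed.

Lemma Nc_le_ReIm z : Nc z <= `|complex.Re z| + `|complex.Im z|.
Proof.
rewrite -(@ler_pXn2r _ 2) ?nnegrE ?Nc_ge0 ?addr_ge0 // Nc_sqr.
rewrite sqrrD !real_normK ?num_real // lerD2r lerDl mulrn_wge0 // mulr_ge0.
Qed.

Lemma Nc_sum (I : Type) (s : seq I) (P : pred I) (F : I -> R[i]) :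
  Nc (\sum_(i <- s | P i) F i) <= \sum_(i <- s | P i) Nc (F i).
Proof.
elim/big_rec2: _ => [|i x z _ h]; first by rewrite Nc0.
by rewrite (le_trans (NcD _ _)) // lerD2l.
Qed.

Lemma Nc_lt_triangle z w : Nc z - Nc w <= Nc (z - w).
Proof. by rewrite lerBlDr (le_trans _ (NcD _ _)) // subrK. Qed.

Lemma Nc_eq0_eps z : (forall e : R, 0 < e -> Nc z <= e) -> z = 0.
Proof.
move=> h; apply/eqP; rewrite -Nc_eq0 eq_le Nc_ge0 andbT.
by apply/ler_addgt0Pr => e e0; rewrite add0r h.
Qed.

Lemma Nc_expi (t : R) : Nc (expi t) = 1.
Proof.
by apply/eqP; rewrite -(@eqrXn2 _ 2) ?Nc_ge0 // Nc_sqr /= cos2Dsin2 expr1n.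
Qed.

Lemma expiD (s t : R) : expi (s + t) = expi s * expi t :> R[i].
Proof.
rewrite /expi cosD sinD; apply/eqP; rewrite eq_complex /=.
by apply/andP; split; apply/eqP => //; rewrite addrC.
Qed.

Lemma expi0 : expi 0 = 1 :> R[i].
Proof. by rewrite /expi cos0 sin0. Qed.

Lemma expiN (t : R) : expi (- t) = (expi t)^* :> R[i].
Proof. by rewrite /expi cosN sinN. Qed.

Lemma expiX (t : R) n : expi (n%:R * t) = expi t ^+ n :> R[i].
Proof.
elim: n => [|n IH]; first by rewrite mul0r expi0.
by rewrite -natr1 mulrDl mul1r expiD IH exprSr.
Qed.

Lemma expiNM (t : R) : expi (- t) * expi t = 1 :> R[i].
Proof. by rewrite -expiD addNr expi0. Qed.

Lemma cvgC_epsP (u : nat -> R[i]) (l : R[i]) :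
  ((u : nat -> R[i]^o) @ \oo --> (l : R[i]^o)) <->
  (forall e : R, 0 < e -> exists N0, forall N, (N0 <= N)%N -> Nc (u N - l) <= e).
Proof.
split.
  move=> /cvgrPdist_le h e e0.
  have /h [N0 _ hN] : 0 < e%:C by rewrite ltcR.
  exists N0 => N hNN; have /= := hN N hNN.
  by rewrite -NcE lecR NcB.
(* A positive element of [R[i]] has imaginary part 0, so complex radii are real ones. *)
move=> h; apply/cvgrPdist_le => e; case: e => a b; rewrite ltcE /= => /andP[/eqP -> a0].
have [N0 hN] := h _ a0; exists N0 => // N /= hNN.
by rewrite -NcE NcB; move: (hN N hNN); rewrite -lecR.
Qed.

End ComplexModulus.

Section ComplexSeries.
Variable R : realType.

Definition rsum (M : nat -> R) : R := limn (series M).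

Lemma le_psum_rsum (M : nat -> R) : (forall j, 0 <= M j) -> cvgn (series M) ->
  forall N, \sum_(0 <= j < N) M j <= rsum M.
Proof.
move=> M0 cM N; apply: (@nondecreasing_cvgn_le _ (series M)) => //.
by apply/nondecreasing_seqP => k; rewrite /series /= big_nat_recr //= lerDl.
Qed.

Lemma cvg_series_bound (M : nat -> R) B : (forall j, 0 <= M j) ->
  (forall N, \sum_(0 <= j < N) M j <= B) -> cvgn (series M).
Proof.
move=> M0 h; apply: nondecreasing_is_cvgn.
  by apply/nondecreasing_seqP => k; rewrite /series /= big_nat_recr //= lerDl.
by exists B => _ [n _ <-]; exact: h.
Qed.

Lemma rsum_le (M : nat -> R) B : cvgn (series M) ->
  (forall N, \sum_(0 <= j < N) M j <= B) -> rsum M <= B.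
Proof. by move=> cM h; apply: limr_le => //; near=> n; exact: h. Unshelve. all: by end_near. Qed.

Lemma rsum_ge0 (M : nat -> R) : (forall j, 0 <= M j) -> cvgn (series M) -> 0 <= rsum M.
Proof. by move=> M0 cM; have := le_psum_rsum M0 cM 0; rewrite big_geq. Qed.

Lemma rsum_eps (M : nat -> R) : (forall j, 0 <= M j) -> cvgn (series M) ->
  forall e, 0 < e -> exists N0, forall N, (N0 <= N)%N ->
    rsum M - \sum_(0 <= j < N) M j <= e.
Proof.
move=> M0 cM e e0; move/cvgrPdist_le: (cM) => /(_ e e0) [N0 _ h].
by exists N0 => N hN; rewrite (le_trans (ler_norm _)) //; exact: h.
Qed.

Lemma psum_sub_le (M : nat -> R) : (forall j, 0 <= M j) -> cvgn (series M) ->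
  forall N n, (N <= n)%N -> \sum_(N <= j < n) M j <= rsum M - \sum_(0 <= j < N) M j.
Proof.
move=> M0 cM N n Nn; rewrite lerBrDl -big_cat_nat //=.
exact: le_psum_rsum.
Qed.

Section Dominated.
Variables (u : nat -> R[i]) (M : nat -> R).
Hypotheses (uM : forall j, Nc (u j) <= M j) (cM : cvgn (series M)).

Let M0 j : 0 <= M j. Proof. exact: le_trans (Nc_ge0 _) (uM j). Qed.

Lemma csum_cvg : ((series (u : nat -> R[i]^o)) @ \oo --> (csum u : R[i]^o)).
Proof.
have cRe : cvgn (series (fun j => complex.Re (u j))).
  apply: normed_cvg; apply: (@series_le_cvg _ _ M (fun j => normr_ge0 _) M0 _ cM) => j.
  exact: le_trans (Nc_Re _) (uM j).
have cIm : cvgn (series (fun j => complex.Im (u j))).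
  apply: normed_cvg; apply: (@series_le_cvg _ _ M (fun j => normr_ge0 _) M0 _ cM) => j.
  exact: le_trans (Nc_Im _) (uM j).
have SE n : series u n = series (fun j => complex.Re (u j)) n +i*
                         series (fun j => complex.Im (u j)) n.
  rewrite /series /=; elim: n => [|n IH]; first by rewrite !big_geq.
  by rewrite !big_nat_recr //= IH; case: (u n) => a b.
suff h : (series (u : nat -> R[i]^o)) @ \oo -->
   ((limn (series (fun j => complex.Re (u j))) +i*
     limn (series (fun j => complex.Im (u j)))) : R[i]^o).
  by rewrite /csum (cvg_lim _ h).
apply/cvgC_epsP => e e0.
have e20 : 0 < e / 2 by rewrite divr_gt0.
move/cvgrPdist_le: cRe => /(_ _ e20) [N1 _ h1].
move/cvgrPdist_le: cIm => /(_ _ e20) [N2 _ h2].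
exists (maxn N1 N2) => N; rewrite geq_max => /andP[hN1 hN2].
have := h1 N hN1; have := h2 N hN2; rewrite SE /= => {}h2 {}h1.
rewrite NcB (le_trans (Nc_le_ReIm _)) //= (splitr e) lerD //.
Qed.

Lemma csum_eps (e : R) : 0 < e -> exists N0, forall N, (N0 <= N)%N ->
  Nc (csum u - \sum_(0 <= j < N) u j) <= e.
Proof.
move=> e0; have /cvgC_epsP /(_ e e0) [N0 h] := csum_cvg.
by exists N0 => N hN; rewrite NcB; exact: h.
Qed.

(** The bound involves only the majorant [M], so for series of functions it is uniform in the
    variable: this is the Weierstrass test behind [ccont_csum], [mean_csum] and [CA_csum]. *)
Lemma csum_tail N :
  Nc (csum u - \sum_(0 <= j < N) u j) <= rsum M - \sum_(0 <= j < N) M j.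
Proof.
apply/ler_addgt0Pr => e e0; have [N0 h] := csum_eps e0.
have hm := h _ (leq_maxl N0 N).
rewrite -(subrK (\sum_(0 <= j < maxn N0 N) u j) (csum u)) -addrA.
rewrite (le_trans (NcD _ _)) // [leRHS]addrC lerD //.
rewrite (big_cat_nat (leq0n N) (leq_maxr N0 N)) /= addrAC subrr add0r.
rewrite (le_trans (Nc_sum _ _ _)) //.
by apply: le_trans (psum_sub_le M0 cM (leq_maxr N0 N)); apply: ler_sum.
Qed.

Lemma csum_norm : Nc (csum u) <= rsum M.
Proof. by have := csum_tail 0; rewrite !big_geq // !subr0. Qed.

End Dominated.

Lemma csum_unique (u : nat -> R[i]) l :
  (forall e : R, 0 < e -> exists N0, forall N, (N0 <= N)%N ->
    Nc (l - \sum_(0 <= j < N) u j) <= e) -> csum u = l.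
Proof.
move=> h; rewrite /csum; apply: (@cvg_lim _ (@norm_hausdorff _ R[i]^o)) => //; apply/cvgC_epsP => e e0.
by have [N0 hN] := h e e0; exists N0 => N /hN; rewrite NcB.
Qed.

End ComplexSeries.

(** * Absolutely summable complex series and interchange of double sums *)

Section AbsoluteSums.
Variable R : realType.
Implicit Types u v : nat -> R[i].

Definition asum u := cvgn (series (fun j => Nc (u j))).

Lemma big_shift_nat (V : nmodType) (F : nat -> V) k N :
  \sum_(k <= i < k + N) F i = \sum_(0 <= i < N) F (k + i)%N.
Proof.
rewrite -[X in \sum_(X <= _ < _) _]add0n big_addn addKn.
by apply: eq_bigr => i _; rewrite addnC.
Qed.

Lemma asumP u (M : nat -> R) :
  (forall j, Nc (u j) <= M j) -> cvgn (series M) -> asum u.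
Proof.
move=> uM; apply: (@series_le_cvg _ _ M) => // j; first exact: Nc_ge0.
exact: le_trans (Nc_ge0 _) (uM j).
Qed.

Lemma asum_bound u B : (forall N, \sum_(0 <= j < N) Nc (u j) <= B) -> asum u.
Proof. by apply: cvg_series_bound => j; exact: Nc_ge0. Qed.

Lemma asum_le_csum u : asum u -> forall N,
  \sum_(0 <= j < N) Nc (u j) <= rsum (fun j => Nc (u j)).
Proof. by move=> au N; apply: le_psum_rsum => // j; exact: Nc_ge0. Qed.

Lemma asum_cvg u : asum u ->
  forall e, 0 < e -> exists N0, forall N, (N0 <= N)%N ->
  Nc (csum u - \sum_(0 <= j < N) u j) <= e.
Proof. by move=> au e e0; exact: (csum_eps (fun j => lexx _) au e0). Qed.

Lemma csum_le u B : asum u -> (forall N, \sum_(0 <= j < N) Nc (u j) <= B) ->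
  Nc (csum u) <= B.
Proof.
by move=> au h; apply: le_trans (csum_norm (fun j => lexx _) au) (rsum_le au h).
Qed.

Lemma asumZ k u : asum u -> asum (fun j => k * u j).
Proof.
move=> au; apply: (@asum_bound _ (Nc k * rsum (fun j => Nc (u j)))) => N.
under eq_bigr do rewrite NcM.
by rewrite -mulr_sumr ler_wpM2l ?Nc_ge0 // asum_le_csum.
Qed.

Lemma asumM u v B : asum u -> (forall j, Nc (v j) <= B) -> asum (fun j => u j * v j).
Proof.
move=> au vB; apply: (@asum_bound _ (rsum (fun j => Nc (u j)) * B)) => N.
under eq_bigr do rewrite NcM.
have B0 : 0 <= B by exact: le_trans (Nc_ge0 _) (vB 0%N).
apply: (@le_trans _ _ (\sum_(0 <= j < N) Nc (u j) * B)).
  by apply: ler_sum => j _; rewrite ler_wpM2l ?Nc_ge0.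
by rewrite -mulr_suml ler_wpM2r // asum_le_csum.
Qed.

Lemma asumD u v : asum u -> asum v -> asum (fun j => u j + v j).
Proof.
move=> au av; apply: (@asum_bound _ (rsum (fun j => Nc (u j)) + rsum (fun j => Nc (v j)))) => N.
apply: (@le_trans _ _ (\sum_(0 <= j < N) (Nc (u j) + Nc (v j)))).
  by apply: ler_sum => j _; exact: NcD.
by rewrite big_split /= lerD // asum_le_csum.
Qed.

Lemma asum_sum (I : Type) (s : seq I) (F : I -> nat -> R[i]) :
  (forall i, asum (F i)) -> asum (fun j => \sum_(i <- s) F i j).
Proof.
move=> aF; elim: s => [|i s IH].
  by apply: (@asum_bound _ 0) => N; rewrite big1 // => j _; rewrite big_nil Nc0.
by under eq_fun do rewrite big_cons; exact: asumD.
Qed.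

Lemma asum_shift k u : asum u -> asum (fun j => u (k + j)%N).
Proof.
move=> au; apply: (@asum_bound _ (rsum (fun j => Nc (u j)))) => N.
apply: le_trans (asum_le_csum au (k + N)).
rewrite (big_cat_nat (leq0n k) (leq_addr N k)) /= (big_shift_nat _ k N).
by rewrite lerDr sumr_ge0 // => j _; exact: Nc_ge0.
Qed.

Lemma csumZ k u : asum u -> csum (fun j => k * u j) = k * csum u.
Proof.
move=> au; apply: csum_unique => e e0.
have k0 : 0 < Nc k + 1 by rewrite ltr_wpDl ?Nc_ge0.
have [N0 h] := asum_cvg au (divr_gt0 e0 k0).
exists N0 => N /h hN; rewrite -mulr_sumr -mulrBr NcM.
have := ler_wpM2l (ltW k0) hN; rewrite mulrCA divff ?lt0r_neq0 // mulr1.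
by apply: le_trans; rewrite ler_wpM2r ?Nc_ge0 // lerDl.
Qed.

Lemma csumD u v : asum u -> asum v ->
  csum (fun j => u j + v j) = csum u + csum v.
Proof.
move=> au av; apply: csum_unique => e e0.
have e2 : 0 < e / 2 by rewrite divr_gt0.
have [N1 h1] := asum_cvg au e2; have [N2 h2] := asum_cvg av e2.
exists (maxn N1 N2) => N; rewrite geq_max => /andP[/h1 {}h1 /h2 {}h2].
rewrite big_split /= opprD addrACA (splitr e) (le_trans (NcD _ _)) //.
exact: lerD.
Qed.

Lemma csumN u : asum u -> csum (fun j => - u j) = - csum u.
Proof. by move=> au; rewrite -mulN1r -csumZ //; congr csum; apply: funext => j; rewrite mulN1r. Qed.

Lemma csum_finite u k : (forall j, (k <= j)%N -> u j = 0) ->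
  csum u = \sum_(0 <= j < k) u j.
Proof.
move=> u0; apply: csum_unique => e e0; exists k => N kN.
rewrite (big_cat_nat (leq0n k) kN) /= (_ : \sum_(k <= i < N) u i = 0).
  by rewrite addr0 subrr Nc0 ltW.
by rewrite big_nat_cond big1 // => j /andP[/andP[/u0]].
Qed.

Lemma csum0 : csum (fun=> 0 : R[i]) = 0.
Proof. by rewrite (@csum_finite _ 0) // big_geq. Qed.

Lemma csum_sum (I : Type) (s : seq I) (F : I -> nat -> R[i]) :
  (forall i, asum (F i)) ->
  csum (fun j => \sum_(i <- s) F i j) = \sum_(i <- s) csum (F i).
Proof.
move=> aF; elim: s => [|i s IH].
  by rewrite big_nil; under eq_fun do rewrite big_nil; exact: csum0.
rewrite big_cons -IH -csumD //; last exact: asum_sum.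
by congr csum; apply: funext => j; rewrite big_cons.
Qed.

Lemma csum_split k u : asum u ->
  csum u = \sum_(0 <= j < k) u j + csum (fun j => u (k + j)%N).
Proof.
move=> au; apply: csum_unique => e e0.
have [N1 h1] := asum_cvg (@asum_shift k _ au) e0.
exists (k + N1)%N => N hN; have kN : (k <= N)%N by apply: leq_trans hN; exact: leq_addr.
rewrite (big_cat_nat (leq0n k) kN) /= opprD addrACA subrr add0r.
by rewrite -(subnKC kN) big_shift_nat; apply: h1; rewrite leq_subRL.
Qed.

Lemma csum_conj u : asum u -> (csum u)^* = csum (fun j => (u j)^*).
Proof.
move=> au; apply/esym/csum_unique => e e0.
have [N1 h1] := asum_cvg au e0; exists N1 => N /h1.
by rewrite -Nc_conj rmorphB rmorph_sum.
Qed.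

(** Fubini for series. Rows from [J] on are controlled by the tail of [M], uniformly in the number
    [N] of columns kept; the finitely many rows before [J] are handled by taking [N] large. *)
Lemma csum_swap (x : nat -> nat -> R[i]) (M : nat -> R) :
  (forall j N, \sum_(0 <= k < N) Nc (x j k) <= M j) -> cvgn (series M) ->
  csum (fun j => csum (x j)) = csum (fun k => csum (fun j => x j k)).
Proof.
move=> xM cM.
have M0 j : 0 <= M j by have := xM j 0%N; rewrite big_geq.
have ax j : asum (x j) by exact: asum_bound (xM j).
have xM1 j k : Nc (x j k) <= M j.
  apply: le_trans (xM j k.+1); rewrite big_nat_recr //= lerDr.
  by apply: sumr_ge0 => i _; exact: Nc_ge0.
have axt k : asum (fun j => x j k) by exact: asumP cM.
have cxM j : Nc (csum (x j)) <= M j by exact: csum_le.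
have acx : asum (fun j => csum (x j)) by exact: asumP cM.
apply/esym/csum_unique => e e0.
have e2 : 0 < e / 2 by rewrite divr_gt0.
have e4 : 0 < e / 4 by rewrite divr_gt0.
have [J /(_ J (leqnn _)) hJ] := rsum_eps M0 cM e4.
have [N0 hN0] : exists N0, forall N, (N0 <= N)%N ->
    \sum_(0 <= j < J) Nc (csum (x j) - \sum_(0 <= k < N) x j k) <= e / 2.
  have J0 : 0 < e / 2 / J.+1%:R by rewrite divr_gt0.
  have /boolp.choice[g hg] : forall j, exists g, forall N, (g <= N)%N ->
      Nc (csum (x j) - \sum_(0 <= k < N) x j k) <= e / 2 / J.+1%:R.
    by move=> j; exact: asum_cvg.
  exists (\max_(j < J) g j)%N => N hN.
  apply: (@le_trans _ _ (\sum_(0 <= j < J) e / 2 / J.+1%:R)).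
    rewrite !big_mkord; apply: ler_sum => j _; apply: hg.
    by apply: leq_trans hN; rewrite (leq_bigmax j).
  rewrite sumr_const_nat subn0 -[leLHS]mulr_natr -mulrA ger_pMr // mulrC.
  by rewrite ler_pdivrMr // mul1r ler_nat.
exists N0 => N /hN0 {}hN0.
rewrite -csum_sum // -mulN1r -csumZ; last exact: asum_sum.
rewrite -csumD //; last by apply: asumZ; exact: asum_sum.
(* [r j] is what row [j] loses when cut at [N]. It is at most [2 * M j], which is why the tail of
   [M] was taken below [e / 4]. *)
set r := (fun j => _).
have rE j : r j = csum (x j) - \sum_(0 <= k < N) x j k by rewrite /r mulN1r.
have rM j : Nc (r j) <= 2 * M j.
  rewrite rE (le_trans (NcD _ _)) // NcN mulr2n mulrDl mul1r lerD //.
  exact: le_trans (Nc_sum _ _ _) (xM j N).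
have c2M : cvgn (series (fun j => 2 * M j)) by exact: is_cvg_seriesZ.
have := csum_tail rM c2M J.
rewrite -mulr_sumr.
have -> : rsum (fun j => 2 * M j) = 2 * rsum M by rewrite /rsum lim_seriesZ.
rewrite -mulrBr => ht.
rewrite -(subrK (\sum_(0 <= j < J) r j) (csum r)) (le_trans (NcD _ _)) //.
rewrite (splitr e) lerD //.
  apply: le_trans ht _; rewrite -ler_pdivlMl // (le_trans hJ) //.
  by rewrite le_eqVlt; apply/orP; left; apply/eqP; field.
apply: le_trans (Nc_sum _ _ _) _; under eq_bigr do rewrite rE; exact: hN0.
Qed.

End AbsoluteSums.

(** * Means over the circle *)

Section ComplexContinuity.
Variable R : realType.
Implicit Types F G : R -> R[i].

(** Real and imaginary parts are kept apart because [cint] integrates them separately. *)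
Definition ccont F :=
  continuous (fun w => complex.Re (F w)) /\ continuous (fun w => complex.Im (F w)).

Lemma ccont_cst z : ccont (fun=> z).
Proof. by split; exact: cst_continuous. Qed.

Lemma ccontD F G : ccont F -> ccont G -> ccont (fun w => F w + G w).
Proof.
move=> [F1 F2] [G1 G2]; split.
  rewrite (_ : (fun w => _) = (fun w => complex.Re (F w) + complex.Re (G w))).
    by move=> w; apply: continuousD; [exact: F1|exact: G1].
  by apply: funext => w; case: (F w) => ? ?; case: (G w).
rewrite (_ : (fun w => _) = (fun w => complex.Im (F w) + complex.Im (G w))).
  by move=> w; apply: continuousD; [exact: F2|exact: G2].
by apply: funext => w; case: (F w) => ? ?; case: (G w).
Qed.

Lemma ccontM F G : ccont F -> ccont G -> ccont (fun w => F w * G w).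
Proof.
move=> [F1 F2] [G1 G2]; split.
  rewrite (_ : (fun w => _) = (fun w => complex.Re (F w) * complex.Re (G w) -
                                     complex.Im (F w) * complex.Im (G w))).
    by move=> w; apply: cvgB; apply: cvgM;
      [exact: F1|exact: G1|exact: F2|exact: G2].
  by apply: funext => w; case: (F w) => ? ?; case: (G w).
rewrite (_ : (fun w => _) = (fun w => complex.Re (F w) * complex.Im (G w) +
                                     complex.Im (F w) * complex.Re (G w))).
  by move=> w; apply: cvgD; apply: cvgM;
      [exact: F1|exact: G2|exact: F2|exact: G1].
by apply: funext => w; case: (F w) => ? ?; case: (G w).
Qed.

Lemma ccontZ z F : ccont F -> ccont (fun w => z * F w).
Proof. by apply: ccontM; exact: ccont_cst. Qed.

Lemma ccontN F : ccont F -> ccont (fun w => - F w).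
Proof. by move=> /(@ccontZ (-1)); under eq_fun do rewrite mulN1r. Qed.

Lemma ccontB F G : ccont F -> ccont G -> ccont (fun w => F w - G w).
Proof. by move=> cF /ccontN; exact: ccontD. Qed.

Lemma ccont_conj F : ccont F -> ccont (fun w => (F w)^*).
Proof.
move=> [F1 F2]; split.
  rewrite (_ : (fun w => _) = (fun w => complex.Re (F w))) //.
  by apply: funext => w; case: (F w).
rewrite (_ : (fun w => _) = (fun w => - complex.Im (F w))).
  by move=> w; apply: continuousN; exact: F2.
by apply: funext => w; case: (F w).
Qed.

Lemma ccont_sum (I : Type) (s : seq I) (F : I -> R -> R[i]) :
  (forall i, ccont (F i)) -> ccont (fun w => \sum_(i <- s) F i w).
Proof.
move=> cF; elim: s => [|i s IH].
  by under eq_fun do rewrite big_nil; exact: ccont_cst.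
by under eq_fun do rewrite big_cons; exact: ccontD.
Qed.

Lemma ccont_expi (a : R) : ccont (fun w => expi (a * w)).
Proof.
have ca : continuous (fun w : R => a * w) by move=> w; exact: mulrl_continuous.
split => w /=.
  by apply: continuous_comp; [exact: ca|exact: continuous_cos].
by apply: continuous_comp; [exact: ca|exact: continuous_sin].
Qed.

Lemma continuous_Nc2 F : ccont F -> continuous (fun w => Nc (F w) ^+ 2).
Proof.
move=> [F1 F2]; under eq_fun do rewrite Nc_sqr !expr2.
move=> w; apply: cvgD; apply: cvgM;
  [exact: F1|exact: F1|exact: F2|exact: F2].
Qed.

Lemma ccont_unif F :
  (forall e : R, 0 < e -> exists2 G, ccont G & forall w, Nc (F w - G w) <= e) ->
  ccont F.
Proof.
(* Stated for any additive [p] dominated by the modulus, so that real and imaginary parts share one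
   three-epsilon argument. *)
have key (p : R[i] -> R) : (forall z w, p (z - w) = p z - p w) ->
    (forall z, `|p z| <= Nc z) ->
    (forall e : R, 0 < e -> exists2 G, continuous (fun w => p (G w)) &
       forall w, Nc (F w - G w) <= e) -> continuous (fun w => p (F w)).
  move=> pB pN h w; apply/cvgrPdist_le => e e0.
  have e3 : 0 < e / 3 by rewrite divr_gt0.
  have [G cG FG] := h _ e3.
  have /cvgrPdist_le /(_ _ e3) := cG w.
  apply: filterS => t ht.
  have h1 := le_trans (pN _) (FG w).
  have h2 := le_trans (pN _) (FG t).
  rewrite pB in h1; rewrite pB in h2.
  move: ht h1 h2; rewrite !ler_norml; lra.
move=> h; split.
- apply: (key (@complex.Re R)) => [[? ?] [? ?]//|z|e /h [G [G1 _] FG]]; last by exists G.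
  exact: Nc_Re.
- apply: (key (@complex.Im R)) => [[? ?] [? ?]//|z|e /h [G [_ G1] FG]]; last by exists G.
  exact: Nc_Im.
Qed.

Lemma ccont_csum (u : nat -> R -> R[i]) (M : nat -> R) :
  (forall j, ccont (u j)) -> (forall j w, Nc (u j w) <= M j) ->
  cvgn (series M) -> ccont (fun w => csum (fun j => u j w)).
Proof.
move=> cu uM cM.
have M0 j : 0 <= M j by exact: le_trans (Nc_ge0 _) (uM j 0).
apply: ccont_unif => e e0; have [N /(_ N (leqnn _)) hN] := rsum_eps M0 cM e0.
exists (fun w => \sum_(0 <= j < N) u j w); first exact: ccont_sum.
by move=> w; apply: le_trans (csum_tail (fun j => uM j w) cM N) hN.
Qed.

End ComplexContinuity.

Section Mean.
Variable R : realType.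
Implicit Types (g h : R -> R) (F G : R -> R[i]).

Local Notation mu := (@lebesgue_measure R).
Local Notation I := (`[0, 2 * pi]%classic : set R).

Lemma twopi_gt0 : 0 < 2 * pi :> R.
Proof. by rewrite mulr_gt0 // pi_gt0. Qed.

Definition rmean g : R := (2 * pi)^-1 * Rintegral mu I g.

Definition mean F : R[i] := ((2 * pi)^-1)%:C * cint F.

Lemma meanE F : mean F =
  rmean (fun w => complex.Re (F w)) +i* rmean (fun w => complex.Im (F w)).
Proof. by rewrite /mean /cint /rmean; simpc. Qed.

Lemma continuous_integrable g : continuous g -> mu.-integrable I (EFin \o g).
Proof.
move=> cg; apply: continuous_compact_integrable; first exact: segment_compact.
exact: continuous_subspaceT.
Qed.

Lemma rmeanD g h : continuous g -> continuous h ->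
  rmean (fun w => g w + h w) = rmean g + rmean h.
Proof.
move=> cg ch; rewrite /rmean -mulrDr RintegralD //; first exact: continuous_integrable.
exact: continuous_integrable.
Qed.

Lemma rmeanZ a g : continuous g -> rmean (fun w => a * g w) = a * rmean g.
Proof.
move=> cg; rewrite /rmean RintegralZl; first exact: mulrCA.
  exact: measurable_itv.
exact: continuous_integrable.
Qed.

Lemma rmean_cst a : rmean (fun=> a) = a.
Proof.
rewrite /rmean Rintegral_cst //= lebesgue_measure_itv /= lte_fin twopi_gt0 /=.
by rewrite subr0 mulrCA mulVf ?mulr1 // gt_eqF // twopi_gt0.
Qed.

Lemma rmean_le g h : continuous g -> continuous h -> (forall w, g w <= h w) ->
  rmean g <= rmean h.
Proof.
move=> cg ch gh; rewrite /rmean ler_wpM2l ?invr_ge0 ?(ltW twopi_gt0) //.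
by apply: le_Rintegral => //; exact: continuous_integrable.
Qed.

Lemma rmean_ge0 g : (forall w, 0 <= g w) -> 0 <= rmean g.
Proof.
move=> g0; rewrite mulr_ge0 ?invr_ge0 ?(ltW twopi_gt0) //.
exact: Rintegral_ge0.
Qed.

Lemma rmean_norm g B : continuous g -> (forall w, `|g w| <= B) -> `|rmean g| <= B.
Proof.
move=> cg gB; have cc b : continuous (fun _ : R => b : R) by exact: cst_continuous.
rewrite ler_norml -{1}(rmean_cst (- B)) -{2}(rmean_cst B).
by rewrite !rmean_le //; move=> w; have := gB w; rewrite ler_norml => /andP[].
Qed.

Lemma meanD F G : ccont F -> ccont G -> mean (fun w => F w + G w) = mean F + mean G.
Proof.
move=> [F1 F2] [G1 G2]; rewrite !meanE; simpc; congr (_ +i* _).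
  rewrite -rmeanD //; congr rmean; apply: funext => w.
  by case: (F w) => ? ?; case: (G w).
rewrite -rmeanD //; congr rmean; apply: funext => w.
by case: (F w) => ? ?; case: (G w).
Qed.

Lemma meanZ z F : ccont F -> mean (fun w => z * F w) = z * mean F.
Proof.
move=> [F1 F2]; case: z => a b; rewrite !meanE; simpc.
have cZ k g : continuous g -> continuous (fun w => k * g w).
  by move=> cg w; apply: cvgM; [exact: cst_continuous|exact: cg].
congr (_ +i* _).
  rewrite -rmeanZ // -mulNr -rmeanZ // -rmeanD; [|exact: cZ|exact: cZ].
  by congr rmean; apply: funext => w; case: (F w) => ? ? /=; rewrite mulNr.
rewrite -rmeanZ // -rmeanZ // -rmeanD; [|exact: cZ|exact: cZ].
by congr rmean; apply: funext => w; case: (F w).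
Qed.

Lemma meanN F : ccont F -> mean (fun w => - F w) = - mean F.
Proof. by move=> cF; rewrite -mulN1r -meanZ //; congr mean; apply: funext => w; rewrite mulN1r. Qed.

Lemma meanB F G : ccont F -> ccont G -> mean (fun w => F w - G w) = mean F - mean G.
Proof. by move=> cF cG; rewrite meanD ?meanN //; exact: ccontN. Qed.

Lemma mean_cst z : mean (fun=> z) = z.
Proof. by rewrite meanE !rmean_cst; case: z. Qed.

Lemma mean_sum (J : Type) (s : seq J) (F : J -> R -> R[i]) :
  (forall i, ccont (F i)) ->
  mean (fun w => \sum_(i <- s) F i w) = \sum_(i <- s) mean (F i).
Proof.
move=> cF; elim: s => [|i s IH].
  by rewrite big_nil; under eq_fun do rewrite big_nil; exact: mean_cst.
rewrite big_cons -IH -meanD //; last exact: ccont_sum.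
by congr mean; apply: funext => w; rewrite big_cons.
Qed.

(** The factor 2 is the cost of bounding real and imaginary parts separately; it reappears in the
    ratio [2 / mu * D n] of the geometric remainder. *)
Lemma mean_norm F B : ccont F -> (forall w, Nc (F w) <= B) -> Nc (mean F) <= 2 * B.
Proof.
move=> [F1 F2] FB; rewrite meanE (le_trans (Nc_le_ReIm _)) //=.
rewrite mulr2n mulrDl mul1r lerD // rmean_norm // => w.
  exact: le_trans (Nc_Re _) (FB w).
exact: le_trans (Nc_Im _) (FB w).
Qed.

Lemma mean_conj F : ccont F -> mean (fun w => (F w)^*) = (mean F)^*.
Proof.
move=> [F1 F2]; rewrite !meanE /=; congr (_ +i* _).
  by congr rmean; apply: funext => w; case: (F w).
rewrite -mulN1r -rmeanZ //; congr rmean; apply: funext => w.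
by case: (F w) => ? ? /=; rewrite mulN1r.
Qed.

Lemma mean_real g : mean (fun w => (g w)%:C) = (rmean g)%:C.
Proof. by rewrite meanE /= rmean_cst. Qed.

Lemma mean_csum (u : nat -> R -> R[i]) (M : nat -> R) :
  (forall j, ccont (u j)) -> (forall j w, Nc (u j w) <= M j) ->
  cvgn (series M) ->
  mean (fun w => csum (fun j => u j w)) = csum (fun j => mean (u j)).
Proof.
move=> cu uM cM; have M0 j : 0 <= M j by exact: le_trans (Nc_ge0 _) (uM j 0).
apply/esym/csum_unique => e e0.
have e2 : 0 < e / 2 by rewrite divr_gt0.
have [N0 h] := rsum_eps M0 cM e2; exists N0 => N /h hN.
have cc := ccont_csum cu uM cM.
rewrite -mean_sum // -meanB //; last exact: ccont_sum.
have -> : e = 2 * (e / 2) by rewrite mulrCA divff ?mulr1.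
apply: mean_norm; first by apply: ccontB => //; exact: ccont_sum.
by move=> w; apply: le_trans (csum_tail (fun j => uM j w) cM N) hN.
Qed.

Lemma expi_2pi (k : int) : expi (k%:~R * (2 * pi)) = 1 :> R[i].
Proof.
have h1 : expi (2 * pi) = 1 :> R[i].
  by rewrite /expi mulr_natl cos2pi sin2pi.
case: k => n; first by rewrite expiX h1 expr1n.
by rewrite NegzE mulrNz mulNr expiN expiX h1 expr1n; simpc.
Qed.

Lemma is_derive_scale_sin (k w : R) : k != 0 ->
  is_derive w 1 (fun w : R => k^-1 * sin (k * w) : R) (cos (k * w)).
Proof.
move=> k0; have h1 : is_derive w 1 (fun w : R => k * w : R) k.
  by have := @is_deriveZ R R R id k w 1 1 (is_derive_id _ _); rewrite /= [k *: 1]mulr1.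
have h2 := @is_derive1_comp _ (@sin R) (fun w : R => k * w) w _ _ (is_derive_sin _) h1.
have := @is_deriveZ R R R (@sin R \o (fun w : R => k * w)) k^-1 w 1 _ h2.
by rewrite [_ *: _]mulrCA mulVf // mulr1.
Qed.

Lemma is_derive_scale_cos (k w : R) : k != 0 ->
  is_derive w 1 (fun w : R => - k^-1 * cos (k * w) : R) (sin (k * w)).
Proof.
move=> k0; have h1 : is_derive w 1 (fun w : R => k * w : R) k.
  by have := @is_deriveZ R R R id k w 1 1 (is_derive_id _ _); rewrite /= [k *: 1]mulr1.
have h2 := @is_derive1_comp _ (@cos R) (fun w : R => k * w) w _ _ (is_derive_cos _) h1.
have := @is_deriveZ R R R (@cos R \o (fun w : R => k * w)) (- k^-1) w 1 _ h2.
by rewrite [_ *: _]mulrCA [X in _ * X]mulNr mulVf // mulrN1 opprK.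
Qed.

Lemma Rintegral_derive (g G : R -> R) : continuous g ->
  (forall w : R, is_derive w 1 G (g w)) ->
  Rintegral mu I g = G (2 * pi) - G 0.
Proof.
move=> cg dG; have cG : continuous G.
  by move=> w; apply: differentiable_continuous; apply/derivable1_diffP; case: (dG w).
rewrite /Rintegral (@continuous_FTC2 _ g G) //.
- exact: twopi_gt0.
- exact: continuous_subspaceT.
- split; first by move=> w _; case: (dG w).
    by apply: cvg_at_right_filter; exact: cG.
  by apply: cvg_at_left_filter; exact: cG.
- by move=> w _; rewrite derive1E; case: (dG w).
Qed.

Lemma mean_expi (k : int) : mean (fun w => expi (k%:~R * w)) = (k == 0)%:R.
Proof.
have [->|k0] := eqVneq k 0.
  under eq_fun do rewrite mul0r expi0; exact: mean_cst.
have kR : (k%:~R : R) != 0 by rewrite intr_eq0.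
have := expi_2pi k; rewrite -expi0 => -[/= c2 s2].
have ck : continuous (fun w : R => k%:~R * w) by move=> w; exact: mulrl_continuous.
have [cc cs] : ccont (fun w : R => expi (k%:~R * w)) by exact: ccont_expi.
rewrite meanE /rmean.
rewrite (Rintegral_derive cc (fun w => is_derive_scale_sin w kR)).
rewrite (Rintegral_derive cs (fun w => is_derive_scale_cos w kR)).
by rewrite s2 c2 !mulr0 sin0 cos0 !subrr !mulr0.
Qed.

End Mean.

(** * The disc algebra *)

Section DiscAlgebra.
Variable R : realType.
Implicit Types (F G U : R -> R[i]) (p q : {poly R}).

Definition trigp p (w : R) : R[i] := (map_poly (real_complex R) p).[expi (- w)].

(* Boundary values of the disc algebra with real coefficients, in the variable
   [expi (- w)]: the functions with no positive frequency. *)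
Definition CA F := forall e : R, 0 < e -> exists p, forall w, Nc (F w - trigp p w) <= e.

Lemma trigpE p w :
  trigp p w = \sum_(i < size p) (p`_i)%:C * expi (- (i%:R * w)).
Proof.
rewrite /trigp horner_coef size_map_poly; apply: eq_bigr => i _.
by rewrite coef_map /= -mulrN expiX.
Qed.

Lemma CA_cst (r : R) : CA (fun=> r%:C).
Proof.
move=> e e0; exists r%:P => w.
by rewrite /trigp map_polyC hornerC subrr Nc0 ltW.
Qed.

Lemma CA_mono j : CA (fun w => expi (- (j%:R * w))).
Proof.
move=> e e0; exists 'X^j => w.
by rewrite /trigp map_polyXn hornerXn -mulrN expiX subrr Nc0 ltW.
Qed.

Lemma trigp_bound p : exists2 B : R, 0 < B & forall w, Nc (trigp p w) <= B.
Proof.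
exists (\sum_(i < size p) `|p`_i| + 1).
  by rewrite ltr_wpDl // sumr_ge0.
move=> w; rewrite trigpE (le_trans (Nc_sum _ _ _)) //.
under eq_bigr do rewrite NcM Nc_real Nc_expi mulr1.
by rewrite lerDl.
Qed.

Lemma CA_bound F : CA F -> exists2 B : R, 0 < B & forall w, Nc (F w) <= B.
Proof.
move=> /(_ 1 ltr01)[p Fp]; have [B B0 pB] := trigp_bound p.
exists (1 + B); first by rewrite addr_gt0.
move=> w; rewrite -(subrK (trigp p w) (F w)) (le_trans (NcD _ _)) //.
exact: lerD.
Qed.

Lemma CAD F G : CA F -> CA G -> CA (fun w => F w + G w).
Proof.
move=> cF cG e e0; have e2 : 0 < e / 2 by rewrite divr_gt0.
have [p Fp] := cF _ e2; have [q Gq] := cG _ e2; exists (p + q) => w.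
rewrite /trigp rmorphD hornerD opprD addrACA (splitr e) (le_trans (NcD _ _)) //.
exact: lerD.
Qed.

Lemma CAM F G : CA F -> CA G -> CA (fun w => F w * G w).
Proof.
move=> cF cG e e0.
have [B B0 FB] := CA_bound cF.
(* [q] is chosen before [p]: the tolerance for [p] depends on a bound of [q]. *)
have [q Gq] := cG (e / 2 / B) (divr_gt0 (divr_gt0 e0 (ltr0n _ 2)) B0).
have [D D0 qD] := trigp_bound q.
have [p Fp] := cF (e / 2 / D) (divr_gt0 (divr_gt0 e0 (ltr0n _ 2)) D0).
exists (p * q) => w; rewrite /trigp rmorphM hornerM -!/(trigp _ w).
have -> : F w * G w - trigp p w * trigp q w =
  F w * (G w - trigp q w) + (F w - trigp p w) * trigp q w by ring.
rewrite (splitr e) (le_trans (NcD _ _)) // !NcM lerD //.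
  apply: (@le_trans _ _ (B * (e / 2 / B))); first by rewrite ler_pM ?Nc_ge0.
  by rewrite mulrCA divff ?mulr1 ?gt_eqF.
apply: (@le_trans _ _ (e / 2 / D * D)); first by rewrite ler_pM ?Nc_ge0.
by rewrite divfK ?gt_eqF.
Qed.

Lemma CAZ (r : R) F : CA F -> CA (fun w => r%:C * F w).
Proof. by apply: CAM; exact: CA_cst. Qed.

Lemma CAN F : CA F -> CA (fun w => - F w).
Proof.
move=> /(CAZ (-1)); congr CA; apply: funext => w.
by rewrite rmorphN mulN1r.
Qed.

Lemma CAB F G : CA F -> CA G -> CA (fun w => F w - G w).
Proof. by move=> cF /CAN; exact: CAD. Qed.

Lemma CA_sum (I : Type) (s : seq I) (F : I -> R -> R[i]) :
  (forall i, CA (F i)) -> CA (fun w => \sum_(i <- s) F i w).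
Proof.
move=> cF; elim: s => [|i s IH].
  by under eq_fun do rewrite big_nil; exact: (CA_cst 0).
by under eq_fun do rewrite big_cons; exact: CAD.
Qed.

Lemma CAX F n : CA F -> CA (fun w => F w ^+ n).
Proof.
move=> cF; elim: n => [|n IH].
  by under eq_fun do rewrite expr0; exact: (CA_cst 1).
by under eq_fun do rewrite exprS; exact: CAM.
Qed.

Lemma CA_unif F :
  (forall e : R, 0 < e -> exists2 G, CA G & forall w, Nc (F w - G w) <= e) -> CA F.
Proof.
move=> h e e0; have e2 : 0 < e / 2 by rewrite divr_gt0.
have [G /(_ _ e2) [p Gp] FG] := h _ e2; exists p => w.
rewrite -(subrK (G w) (F w)) -addrA (splitr e) (le_trans (NcD _ _)) //.
exact: lerD.
Qed.

Lemma CA_csum (u : nat -> R -> R[i]) (M : nat -> R) :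
  (forall j, CA (u j)) -> (forall j w, Nc (u j w) <= M j) ->
  cvgn (series M) -> CA (fun w => csum (fun j => u j w)).
Proof.
move=> cu uM cM.
have M0 j : 0 <= M j by exact: le_trans (Nc_ge0 _) (uM j 0).
apply: CA_unif => e e0; have [N /(_ N (leqnn _)) hN] := rsum_eps M0 cM e0.
exists (fun w => \sum_(0 <= j < N) u j w); first exact: CA_sum.
by move=> w; apply: le_trans (csum_tail (fun j => uM j w) cM N) hN.
Qed.

Lemma ccont_trigp p : ccont (trigp p).
Proof.
rewrite (_ : trigp p = (fun w => \sum_(i < size p) (p`_i)%:C * expi (- i%:R * w))).
  by apply: ccont_sum => i; apply: ccontZ; exact: ccont_expi.
by apply: funext => w; rewrite trigpE; under eq_bigr do rewrite -mulNr.
Qed.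

Lemma CA_ccont F : CA F -> ccont F.
Proof.
by move=> cF; apply: ccont_unif => e /cF [p Fp]; exists (trigp p) => //; exact: ccont_trigp.
Qed.

(** Used to extend a minimum over one period to the whole line. *)
Lemma CA_periodic F w (k : int) : CA F -> F (w + k%:~R * (2 * pi)) = F w.
Proof.
move=> cF; apply/eqP; rewrite -subr_eq0; apply/eqP/Nc_eq0_eps => e e0.
have e2 : 0 < e / 2 by rewrite divr_gt0.
have [p Fp] := cF _ e2.
have pE : trigp p (w + k%:~R * (2 * pi)) = trigp p w.
  by rewrite /trigp opprD expiD -mulNr -mulrNz expi_2pi mulr1.
rewrite -(subrK (trigp p w) (F _)) -addrA -{1}pE (splitr e) (le_trans (NcD _ _)) //.
by apply: lerD => //; rewrite NcB.
Qed.

Lemma mean_eps F G e : ccont F -> ccont G -> (forall w, Nc (F w - G w) <= e) ->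
  Nc (mean F - mean G) <= 2 * e.
Proof. by move=> cF cG h; rewrite -meanB // mean_norm //; exact: ccontB. Qed.

Lemma mean_mono_trigp (m : int) p :
  mean (fun w => expi (m%:~R * w) * trigp p w) =
  \sum_(i < size p) (p`_i)%:C * (m == i%:Z)%:R.
Proof.
rewrite (_ : (fun w => _) = (fun w => \sum_(i < size p) (p`_i)%:C * expi ((m - i%:Z)%:~R * w))).
  rewrite mean_sum; last by move=> i; apply: ccontZ; exact: ccont_expi.
  apply: eq_bigr => i _; rewrite meanZ ?mean_expi ?subr_eq0 //.
  exact: ccont_expi.
apply: funext => w; rewrite trigpE mulr_sumr; apply: eq_bigr => i _.
by rewrite mulrCA -expiD intrB mulrBl.
Qed.

Lemma CA_mean_approx (m : int) F : CA F -> forall e : R, 0 < e ->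
  exists p, Nc (mean (fun w => expi (m%:~R * w) * F w) -
                mean (fun w => expi (m%:~R * w) * trigp p w)) <= e.
Proof.
move=> cF e e0; have e2 : 0 < e / 2 by rewrite divr_gt0.
have [p Fp] := cF _ e2; exists p.
have -> : e = 2 * (e / 2) by rewrite mulrCA divff ?mulr1.
apply: mean_eps => [||w].
- by apply: ccontM; [exact: ccont_expi|exact: CA_ccont].
- by apply: ccontM; [exact: ccont_expi|exact: ccont_trigp].
- by rewrite -mulrBr NcM Nc_expi mul1r.
Qed.

(** A negative [m] tests the positive frequency [- m], absent from every approximating polynomial.
    All later uses of causality go through this vanishing or through [CA_orth]. *)
Lemma CA_coef_neg (m : int) F : CA F -> m < 0 ->
  mean (fun w => expi (m%:~R * w) * F w) = 0.
Proof.
move=> cF m0; apply: Nc_eq0_eps => e e0.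
have [p] := CA_mean_approx m cF e0; rewrite mean_mono_trigp big1 ?subr0 //.
by move=> i _; rewrite lt_eqF ?mulr0 //; apply: lt_le_trans m0 _.
Qed.

(** The approximating polynomials have real coefficients. Reality is what lets a conjugated,
    time-reversed series carry the same coefficients as the original one. *)
Lemma CA_coef_real (m : int) F : CA F ->
  (mean (fun w => expi (m%:~R * w) * F w))^* = mean (fun w => expi (m%:~R * w) * F w).
Proof.
move=> cF; apply/eqP; rewrite -subr_eq0; apply/eqP/Nc_eq0_eps => e e0.
have e2 : 0 < e / 2 by rewrite divr_gt0.
have [p] := CA_mean_approx m cF e2.
set x := mean _; set y := mean _ => xy.
have yE : y^* = y.
  rewrite /y mean_mono_trigp conj_sum; apply: eq_bigr => i _.
  by rewrite conjM conjc_real conjc_nat.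
rewrite -(subrK y x^*) -addrA (splitr e) (le_trans (NcD _ _)) //.
by rewrite -{1}yE -rmorphB Nc_conj lerD // NcB.
Qed.

(** The last hypothesis says that [U] has no frequency [<= 0], so [U] is orthogonal to every
    approximating polynomial of [F]; boundedness of [U] carries this to the limit. *)
Lemma CA_orth F U B : CA F -> ccont U -> (forall w, Nc (U w) <= B) ->
  (forall i : nat, mean (fun w => expi (i%:Z%:~R * w) * U w) = 0) ->
  mean (fun w => (F w)^* * U w) = 0.
Proof.
move=> cF cU UB h; apply: Nc_eq0_eps => e e0.
have B0 : 0 <= B by exact: le_trans (Nc_ge0 _) (UB 0).
have B1 : 0 < 2 * (B + 1) by rewrite mulr_gt0 // ltr_wpDl.
have [p Fp] := cF _ (divr_gt0 e0 B1).
have := @mean_eps (fun w => (F w)^* * U w) (fun w => (trigp p w)^* * U w) (e / (2 * (B + 1)) * (B + 1)).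
have -> : mean (fun w => (trigp p w)^* * U w) = 0.
  rewrite (_ : (fun w => _) = (fun w => \sum_(i < size p) (p`_i)%:C * (expi ((i : nat)%:Z%:~R * w) * U w))).
    rewrite mean_sum => [|i].
      rewrite big1 // => i _; rewrite meanZ ?h ?mulr0 //.
      by apply: ccontM => //; exact: ccont_expi.
    by apply: ccontZ; apply: ccontM => //; exact: ccont_expi.
  apply: funext => w; rewrite trigpE conj_sum mulr_suml; apply: eq_bigr => i _.
  by rewrite conjM conjc_real -expiN opprK mulrA.
rewrite subr0; have -> : 2 * (e / (2 * (B + 1)) * (B + 1)) = e.
  by field; rewrite gt_eqF // ltr_wpDl.
apply.
- by apply: ccontM => //; apply: ccont_conj; exact: CA_ccont.
- by apply: ccontM => //; apply: ccont_conj; exact: ccont_trigp.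
move=> w; rewrite -mulrBl -rmorphB NcM Nc_conj ler_pM ?Nc_ge0 //.
by rewrite (le_trans (UB w)) // lerDl.
Qed.

(** Write [G = F (1 - q)] with [q = (F - G) / F] of modulus at most 1/2, and expand the inverse as a
    geometric series; its partial sums stay in the disc algebra because [F^-1] does. *)
Lemma CA_inv_step F G (m : R) : 0 < m -> CA F -> CA (fun w => (F w)^-1) -> CA G ->
  (forall w, m <= Nc (F w)) -> (forall w, Nc (G w - F w) <= m / 2) ->
  CA (fun w => (G w)^-1).
Proof.
move=> m0 cF cFV cG mF GF.
have F0 w : F w != 0 by rewrite -Nc_gt0 (lt_le_trans m0).
have mG w : m / 2 <= Nc (G w).
  have := Nc_lt_triangle (F w) (F w - G w); rewrite subKr.
  by move: (mF w) (GF w); rewrite (NcB (G w)); lra.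
have G0 w : G w != 0 by rewrite -Nc_gt0 (lt_le_trans _ (mG w)) // divr_gt0.
pose q w := (F w - G w) * (F w)^-1.
have cq : CA q by apply: CAM => //; exact: CAB.
have q1 w : Nc (q w) <= 2^-1.
  rewrite NcM NcV ler_pdivrMr; last by rewrite Nc_gt0.
  by rewrite NcB (le_trans (GF w)) // mulrC ler_wpM2l // invr_ge0.
apply: CA_unif => e e0.
have [n hn] : exists n, (2^-1 : R) ^+ n <= e * (m / 2).
  have em : 0 < e * (m / 2) by rewrite mulr_gt0 // divr_gt0.
  have /cvgrPdist_le /(_ _ em) [N _ /(_ N (leqnn _))] : (2^-1 : R) ^+ n @[n --> \oo] --> 0.
    by apply: cvg_expr; rewrite ger0_norm ?invr_ge0 // invf_lt1 ?ltr1n.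
  by rewrite sub0r normrN ger0_norm ?exprn_ge0 ?invr_ge0 // => h; exists N.
exists (fun w => (F w)^-1 * \sum_(0 <= k < n) q w ^+ k).
  by apply: CAM => //; apply: CA_sum => k; exact: CAX.
move=> w.
have -> : (G w)^-1 - (F w)^-1 * (\sum_(0 <= k < n) q w ^+ k) = (G w)^-1 * q w ^+ n.
  have FE : (F w)^-1 = (G w)^-1 * (1 - q w).
    by rewrite /q; field; rewrite F0 G0.
  have qE : (1 - q w) * (\sum_(0 <= k < n) q w ^+ k) = 1 - q w ^+ n.
    by rewrite big_mkord -opprB -[RHS]opprB subrX1 mulNr.
  by rewrite FE -mulrA qE mulrBr mulr1 opprB addrC subrK.
rewrite NcM NcV NcX ler_pdivrMl ?Nc_gt0 //.
apply: (@le_trans _ _ ((2^-1) ^+ n)).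
  by rewrite lerXn2r ?nnegrE ?Nc_ge0 ?invr_ge0.
by apply: le_trans hn _; rewrite mulrC ler_wpM2r // ltW.
Qed.

End DiscAlgebra.

(** * Inversion of [phi] in the disc algebra *)

Section InverseFactor.
Variables (R : realType) (phi : nat -> R).
Hypothesis cphi : cvgn (series (fun j => `|phi j.+1|)).

Lemma phiw_ar w : phiw phi w = ar_series phi (expi (- w)).
Proof.
by rewrite /phiw /ar_series; congr (_ - csum _); apply: funext => j; rewrite -mulrN expiX.
Qed.

Lemma ar_term_le (z : R[i]) j : Nc z <= 1 -> Nc ((phi j.+1)%:C * z ^+ j.+1) <= `|phi j.+1|.
Proof.
move=> z1; rewrite NcM Nc_real ler_piMr // NcX exprn_ile1 ?Nc_ge0 //.
Qed.

Lemma NcXB (z z' : R[i]) j : Nc z <= 1 -> Nc z' <= 1 ->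
  Nc (z' ^+ j - z ^+ j) <= j%:R * Nc (z' - z).
Proof.
move=> z1 z1'; elim: j => [|j IH]; first by rewrite !expr0 subrr Nc0 mul0r.
have -> : z' ^+ j.+1 - z ^+ j.+1 = z' * (z' ^+ j - z ^+ j) + (z' - z) * z ^+ j.
  by rewrite !exprS; ring.
rewrite (le_trans (NcD _ _)) // !NcM -natr1 mulrDl mul1r lerD //.
  by apply: le_trans IH; rewrite ler_piMl ?Nc_ge0.
by rewrite ler_piMr ?Nc_ge0 // NcX exprn_ile1 ?Nc_ge0.
Qed.

Lemma ar_unif (e : R) : 0 < e -> exists2 d : R, 0 < d &
  forall z z', Nc z <= 1 -> Nc z' <= 1 -> Nc (z' - z) <= d ->
    Nc (ar_series phi z' - ar_series phi z) <= e.
Proof.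
move=> e0; have e4 : 0 < e / 4 by rewrite divr_gt0.
have [N /(_ N (leqnn _)) hN] := rsum_eps (fun j => normr_ge0 (phi j.+1)) cphi e4.
(* Up to the added 1, a Lipschitz constant on the closed disc of the polynomial kept; each of the
   two discarded tails costs [e / 4]. *)
pose D := \sum_(0 <= j < N) `|phi j.+1| * j.+1%:R + 1.
have D0 : 0 < D by rewrite ltr_wpDl // sumr_ge0 // => j _; rewrite mulr_ge0.
exists (e / 2 / D); first by rewrite !divr_gt0.
move=> z z' z1 z1' zz.
set u := fun z j => (phi j.+1)%:C * z ^+ j.+1.
have t x : Nc x <= 1 -> Nc (csum (u x) - \sum_(0 <= j < N) u x j) <= e / 4.
  move=> x1; apply: le_trans hN.
  exact: (csum_tail (fun j => ar_term_le j x1) cphi).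
have fin : Nc (\sum_(0 <= j < N) u z j - \sum_(0 <= j < N) u z' j) <= e / 2.
  rewrite -sumrB (le_trans (Nc_sum _ _ _)) //.
  apply: (@le_trans _ _ (\sum_(0 <= j < N) `|phi j.+1| * j.+1%:R * (e / 2 / D))).
    apply: ler_sum => j _; rewrite /u -mulrBr NcM Nc_real -mulrA ler_wpM2l //.
    rewrite NcB (le_trans (NcXB _ z1 z1')) // ler_wpM2l //.
  rewrite -mulr_suml mulrA ler_pdivrMr // mulrC ler_wpM2l ?lerDl //.
  by rewrite ltW // divr_gt0.
have -> : ar_series phi z' - ar_series phi z =
  (csum (u z) - \sum_(0 <= j < N) u z j) - (csum (u z') - \sum_(0 <= j < N) u z' j)
  + (\sum_(0 <= j < N) u z j - \sum_(0 <= j < N) u z' j).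
  by rewrite /ar_series; ring.
rewrite (le_trans (NcD _ _)) // (le_trans (lerD (NcD _ _) fin)) // NcN.
by move: (t _ z1) (t _ z1'); lra.
Qed.

Definition Fr (r w : R) : R[i] := ar_series phi (r%:C * expi (- w)).

Lemma Fr_disc (r w : R) : 0 <= r <= 1 -> Nc (r%:C * expi (- w)) <= 1.
Proof. by move=> /andP[r0 r1]; rewrite NcM Nc_real Nc_expi mulr1 ger0_norm. Qed.

Lemma CA_Fr (r : R) : 0 <= r <= 1 -> CA (Fr r).
Proof.
move=> r01; apply: CAB; first exact: (CA_cst 1).
apply: (@CA_csum _ _ (fun j => `|phi j.+1|)) => // j.
  rewrite (_ : (fun w => _) = (fun w => (phi j.+1 * r ^+ j.+1)%:C * expi (- (j.+1%:R * w)))).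
    by apply: CAZ; exact: CA_mono.
  by apply: funext => w; rewrite exprMn rmorphM rmorphXn -mulrN expiX mulrA.
by move=> w; apply: ar_term_le; exact: Fr_disc.
Qed.

Lemma CA_phiw : CA (phiw phi).
Proof.
have := @CA_Fr 1; rewrite ler01 lexx => /(_ isT); congr CA; apply: funext => w.
by rewrite /Fr mul1r phiw_ar.
Qed.

Lemma reduce_2pi (w : R) : exists k : int, (w + k%:~R * (2 * pi)) \in `[0, 2 * pi].
Proof.
have t0 := @twopi_gt0 R.
exists (- Num.floor (w / (2 * pi))); rewrite in_itv /= mulrNz mulNr subr_ge0.
rewrite lerBlDr -ler_pdivlMr // floor_le_tmp /=.
have := floorD1_gt (w / (2 * pi)); rewrite intrD1 ltr_pdivrMr // mulrDl mul1r addrC => /ltW.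
by [].
Qed.

Hypothesis nz : forall z : R[i], `|z| <= 1 -> ar_series phi z != 0.

Lemma Fr_neq0 (r w : R) : 0 <= r <= 1 -> Fr r w != 0.
Proof. by move=> r01; apply: nz; rewrite -NcE -[1]/(1%:C) lecR Fr_disc. Qed.

(** The bound must be uniform over all dilations, since it fixes the step length of the continuation
    to [r = 1]. The minimum is taken first in [w] for fixed [r], then in [r]. *)
Lemma Fr_lower : exists2 m : R, 0 < m & forall r w, 0 <= r <= 1 -> m <= Nc (Fr r w).
Proof.
have t0 := @twopi_gt0 R.
(* A 1-Lipschitz retraction of the line onto [[0, 1]], so that the minimum [m r] is defined and
   continuous for all real [r]. *)
have [cl [cl01 clr clL]] : exists cl : R -> R, [/\ forall r, 0 <= cl r <= 1,
    forall r, 0 <= r <= 1 -> cl r = r & forall r r', `|cl r - cl r'| <= `|r - r'|].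
  exists (fun r => (1 + `|r| - `|1 - r|) / 2); split => [r|r /andP[r0 r1]|r r'].
  - have := ler_normD 1 (- r); have := ler_normD 1 (r - 1).
    by rewrite addrC subrK normr1 normrN (distrC r) => h1 h2; lra.
  - by rewrite ger0_norm // ger0_norm ?subr_ge0 //; field.
  have := lerB_dist r r'; have := lerB_dist r' r.
  have := lerB_dist (1 - r) (1 - r'); have := lerB_dist (1 - r') (1 - r).
  have E a b : (1 - a) - (1 - b) = b - a :> R by ring.
  by rewrite !E (distrC r' r) ler_norml => h1 h2 h3 h4; lra.
have /boolp.choice [wm hwm] : forall r, exists w0, forall w, Nc (Fr (cl r) w0) <= Nc (Fr (cl r) w).
  move=> r; have cF := CA_Fr (cl01 r).
  have [w0 _ h] : exists2 c, c \in `[0, 2 * pi] &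
      forall t, t \in `[0, 2 * pi] -> Nc (Fr (cl r) c) ^+ 2 <= Nc (Fr (cl r) t) ^+ 2.
    apply: (@EVT_min _ (fun t => Nc (Fr (cl r) t) ^+ 2)); first exact: ltW.
    by apply: continuous_subspaceT; apply: continuous_Nc2; exact: CA_ccont.
  exists w0 => w; have [k hk] := reduce_2pi w.
  by have := h _ hk; rewrite (@CA_periodic _ _ w k cF) ler_pXn2r ?nnegrE ?Nc_ge0.
pose m r := Nc (Fr (cl r) (wm r)).
(* A minimum inherits the modulus of continuity: the minimiser for one [r] is a competitor for the
   other. *)
have cm : continuous m.
  move=> r; apply/cvgrPdist_le => e /ar_unif [d d0 hd].
  near=> r'.
  have rr : `|r - r'| <= d by near: r'; apply: cvgr_dist_le => //; exact: cvg_id.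
  have key a b : `|a - b| <= d -> m a <= m b + e.
    move=> ab; apply: le_trans (hwm a (wm b)) _.
    rewrite -lerBlDl (le_trans (Nc_lt_triangle _ _)) //; apply: hd; try exact: Fr_disc.
    by rewrite -mulrBl NcM Nc_expi mulr1 -rmorphB Nc_real (le_trans (clL _ _)).
  have h1 := key _ _ rr; rewrite distrC in rr; have h2 := key _ _ rr.
  by move: h1 h2; rewrite ler_norml; move: (m r) (m r') => x y; lra.
have [r0 _ h] := @EVT_min _ m 0 1 ler01 (continuous_subspaceT cm).
exists (m r0); first by rewrite /m Nc_gt0 Fr_neq0.
move=> r w r01; have := h r; rewrite in_itv /= => /(_ r01) /le_trans; apply.
by rewrite /m; apply: le_trans (hwm r w) _; rewrite clr.
Unshelve. all: by end_near. Qed.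

Lemma phiw_lower : exists2 m : R, 0 < m & forall w, m <= Nc (phiw phi w).
Proof.
have [m m0 h] := Fr_lower; exists m => // w.
by have := h 1 w; rewrite /Fr mul1r phiw_ar ler01 lexx => ->.
Qed.

Lemma phiw_neq0 w : phiw phi w != 0.
Proof. by have [m m0 h] := phiw_lower; rewrite -Nc_gt0 (lt_le_trans m0). Qed.

(* Neumann series along [r |-> ar_series (r z)], from the constant 1 at r = 0. *)
Lemma CA_phiw_inv : CA (fun w => (phiw phi w)^-1).
Proof.
have [m m0 hm] := Fr_lower.
have [d d0 hd] := ar_unif (divr_gt0 m0 (ltr0n _ 2)).
have [N hN] : exists N : nat, N.+1%:R^-1 <= d.
  exists (Num.truncn d^-1); rewrite invf_ple ?posrE //.
  by have := truncnS_gt d^-1 => /ltW.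
have kN k : (k <= N.+1)%N -> 0 <= (k%:R / N.+1%:R : R) <= 1.
  by move=> kn; rewrite divr_ge0 //= ler_pdivrMr // mul1r ler_nat.
have key k : (k <= N.+1)%N -> CA (fun w => (Fr (k%:R / N.+1%:R) w)^-1).
  elim: k => [_|k IH kn].
    have -> : (fun w => (Fr (0%:R / N.+1%:R) w)^-1) = fun=> 1.
      apply: funext => w; rewrite /Fr mul0r mul0r /ar_series.
      rewrite (_ : (fun j => _) = fun=> 0) ?csum0 ?subr0 ?invr1 //.
      by apply: funext => j; rewrite expr0n mulr0.
    exact: (CA_cst 1).
  have kn' := ltnW kn.
  apply: (CA_inv_step m0 (CA_Fr (kN _ kn')) (IH kn') (CA_Fr (kN _ kn))) => w.
    exact: hm (kN _ kn').
  apply: hd; [exact: Fr_disc (kN _ kn')|exact: Fr_disc (kN _ kn)|].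
  rewrite -mulrBl NcM Nc_expi mulr1 -rmorphB Nc_real -mulrBl.
  by rewrite -natrB // subSnn mul1r ger0_norm ?invr_ge0.
have := key N.+1 (leqnn _); congr CA; apply: funext => w.
by rewrite divff // /Fr mul1r phiw_ar.
Qed.

End InverseFactor.

(** * Yule-Walker equations *)

Section OneSidedSeries.
Variable R : realType.
Implicit Types (x : nat -> R) (G : R -> R[i]).

Definition hser x (w : R) : R[i] := csum (fun j => (x j)%:C * expi (- (j%:R * w))).

Lemma asum_real x : cvgn (series (fun j => `|x j|)) -> asum (fun j => (x j)%:C).
Proof. by move=> cx; apply: (@asumP _ _ (fun j => `|x j|)) => // j; rewrite Nc_real. Qed.

Lemma asum_hser x w : cvgn (series (fun j => `|x j|)) ->
  asum (fun j => (x j)%:C * expi (- (j%:R * w))).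
Proof. by move=> cx; apply: (asumM (asum_real cx)) => j; rewrite Nc_expi. Qed.

Lemma CA_hser x : cvgn (series (fun j => `|x j|)) -> CA (hser x).
Proof.
move=> cx; apply: (@CA_csum _ _ (fun j => `|x j|)) => // j.
  by apply: CAZ; exact: CA_mono.
by move=> w; rewrite NcM Nc_real Nc_expi mulr1.
Qed.

Lemma hser_le x w : cvgn (series (fun j => `|x j|)) -> Nc (hser x w) <= rsum (fun j => `|x j|).
Proof.
by move=> cx; apply: csum_norm cx => j; rewrite NcM Nc_real Nc_expi mulr1.
Qed.

Lemma csum_delta (y : nat -> R[i]) (n : nat) :
  csum (fun j => y j * (j == n)%:R) = y n.
Proof.
rewrite (@csum_finite _ _ n.+1) => [|j nj]; last by rewrite gtn_eqF ?mulr0.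
rewrite big_nat_recr //= eqxx mulr1 big_nat_cond big1 ?add0r // => j /andP[/andP[_ jn] _].
by rewrite ltn_eqF ?mulr0.
Qed.

(** The convolution rule for Fourier coefficients, with one absolutely summable causal factor:
    multiplication by [hser x] acts as a Toeplitz sum. *)
Lemma mean_hser x G B (k : int) : cvgn (series (fun j => `|x j|)) ->
  ccont G -> (forall w, Nc (G w) <= B) ->
  mean (fun w => expi (k%:~R * w) * (hser x w * G w)) =
  csum (fun j : nat => (x j)%:C * mean (fun w => expi ((k - j%:Z)%:~R * w) * G w)).
Proof.
move=> cx cG GB.
pose u (j : nat) (w : R) := (x j)%:C * (expi ((k - j%:Z)%:~R * w) * G w).
have cu j : ccont (u j) by apply: ccontZ; apply: ccontM => //; exact: ccont_expi.
have ub j w : Nc (u j w) <= `|x j| * B.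
  by rewrite !NcM Nc_real Nc_expi mul1r ler_wpM2l.
have cb : cvgn (series (fun j => `|x j| * B)).
  by under eq_fun do rewrite mulrC; apply: is_cvg_seriesZ.
transitivity (mean (fun w => csum (fun j => u j w))); last first.
  rewrite (mean_csum cu ub cb); congr csum; apply: funext => j; rewrite meanZ //.
  by apply: ccontM => //; exact: ccont_expi.
congr mean; apply: funext => w; rewrite mulrCA mulrC -csumZ; last exact: asum_hser.
congr csum; apply: funext => j; rewrite /u intrB mulrBl expiD.
by rewrite -[j%:Z%:~R]/(j%:R); ring.
Qed.

(** The adjoint rule, in which indices are raised instead of lowered; it is [mean_hser] at [- k] for
    the conjugate of [G], conjugated. *)
Lemma mean_hser_conj x G B (k : int) : cvgn (series (fun j => `|x j|)) ->
  ccont G -> (forall w, Nc (G w) <= B) ->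
  mean (fun w => expi (k%:~R * w) * ((hser x w)^* * G w)) =
  csum (fun j : nat => (x j)%:C * mean (fun w => expi ((k + j%:Z)%:~R * w) * G w)).
Proof.
move=> cx cG GB; have cGc := ccont_conj cG.
have GBc w : Nc (G w)^* <= B by rewrite Nc_conj.
have e0 (m : int) w : expi ((- m)%:~R * w) = (expi (m%:~R * w))^* :> R[i].
  by rewrite -expiN mulrNz mulNr.
have := mean_hser (- k) cx cGc GBc => /(congr1 conjc).
rewrite csum_conj; last first.
  apply: (asumM (B := 2 * B) (asum_real cx)) => j; apply: mean_norm.
    by apply: ccontM => //; exact: ccont_expi.
  by move=> w; rewrite NcM Nc_expi mul1r.
rewrite -mean_conj; last first.
  by apply: ccontM (ccontM (CA_ccont (CA_hser cx)) cGc); exact: ccont_expi.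
move=> h; transitivity (mean (fun w => (expi ((- k)%:~R * w) * (hser x w * (G w)^*))^*)).
  by congr mean; apply: funext => w; rewrite !conjM e0 !conjcK.
rewrite h; congr csum; apply: funext => j.
rewrite conjM conjc_real -mean_conj; last by apply: ccontM => //; exact: ccont_expi.
by congr (_ * mean _); apply: funext => w; rewrite conjM -opprD e0 !conjcK.
Qed.

Lemma mean_mono_hser x (k : int) : cvgn (series (fun j => `|x j|)) ->
  mean (fun w => expi (k%:~R * w) * hser x w) = csum (fun j : nat => (x j)%:C * (k == j%:Z)%:R).
Proof.
move=> cx; have := @mean_hser x (fun=> 1) 1 k cx (@ccont_cst _ _).
under eq_fun do rewrite mulr1.
move=> -> => [|w]; last by rewrite Nc1.
congr csum; apply: funext => j; under eq_fun do rewrite mulr1.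
by rewrite mean_expi subr_eq0.
Qed.

Lemma hser_coef x (k : nat) : cvgn (series (fun j => `|x j|)) ->
  mean (fun w => expi (k%:Z%:~R * w) * hser x w) = (x k)%:C.
Proof.
move=> cx; rewrite mean_mono_hser // -[RHS](csum_delta (fun j => (x j)%:C)).
by congr csum; apply: funext => j; rewrite eqz_nat eq_sym.
Qed.

End OneSidedSeries.

Section FactorCoefficients.
Variables (R : realType) (phi : nat -> R).
Hypothesis cphi : cvgn (series (fun j => `|phi j.+1|)).

(** The coefficients of [phi] itself as a power series in [expi (- w)]: constant term and signs are
    included, so that one convolution rule covers them all. *)
Definition acoef (j : nat) : R := if j is j'.+1 then - phi j'.+1 else 1.

Lemma cvg_acoef : cvgn (series (fun j => `|acoef j|)).
Proof.
apply: (@cvg_series_bound _ _ (1 + rsum (fun j => `|phi j.+1|))) => // -[|N].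
  by rewrite big_geq // addr_ge0 // rsum_ge0.
rewrite big_nat_recl //= normr1 lerD2l.
by under eq_bigr do rewrite normrN; exact: le_psum_rsum.
Qed.

Lemma phiw_acoef : phiw phi = hser acoef.
Proof.
apply: funext => w; have aa := @asum_hser _ _ w cvg_acoef.
rewrite /hser (csum_split 1 aa) big_nat1 mul0r oppr0 expi0 mulr1.
rewrite /phiw -csumN; last first.
  apply: (@asumM _ _ _ 1) => [|j]; last by rewrite Nc_expi.
  exact: (@asum_real _ (fun j => phi j.+1)).
congr (_ + csum _); apply: funext => j.
by rewrite add1n /= rmorphN mulNr.
Qed.

End FactorCoefficients.

Section SpectralDensity.
Variables (R : realType) (f : R -> R) (c : int -> R) (phi : nat -> R) (sigma : R).
Hypothesis fE : fourier_expansion f c.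
Hypothesis cfac : canonical_factorisation phi f sigma.
Hypothesis ceven : forall r, c (- r) = c r.
Hypothesis cc : cvgn (series (fun k : nat => `|c k%:Z|)).

Let cphi : cvgn (series (fun j => `|phi j.+1|)). Proof. by case: cfac. Qed.
Let nz : forall z : R[i], `|z| <= 1 -> ar_series phi z != 0. Proof. by case: cfac. Qed.
Let phi0 w : phiw phi w != 0. Proof. exact: phiw_neq0. Qed.

Lemma cvg_cneg : cvgn (series (fun k : nat => `|c (- k.+1%:Z)|)).
Proof.
apply: (@cvg_series_bound _ _ (rsum (fun k : nat => `|c k%:Z|))) => // N.
apply: le_trans (le_psum_rsum _ cc N.+1) => //.
by under eq_bigr do rewrite ceven; rewrite big_nat_recl // lerDr.
Qed.

Lemma ccont_f : ccont (fun w => (f w)%:C).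
Proof.
under eq_fun do rewrite fE; apply: ccontD.
  apply: (ccont_csum (M := fun k : nat => `|c k%:Z|)) => // j.
    by apply: ccontZ; exact: ccont_expi.
  by move=> w; rewrite NcM Nc_real Nc_expi mulr1.
apply: (ccont_csum (M := fun k : nat => `|c (- k.+1%:Z)|)) => [j|j w|].
- by apply: ccontZ; exact: ccont_expi.
- by rewrite NcM Nc_real Nc_expi mulr1.
- exact: cvg_cneg.
Qed.

Lemma f_bound : exists2 B : R, 0 < B & forall w, Nc (f w)%:C <= B.
Proof.
have [m m0 hm] := phiw_lower cphi nz.
have s0 : 0 < sigma by case: cfac.
exists (sigma ^+ 2 / m ^+ 2); first by rewrite divr_gt0 ?exprn_gt0.
case: cfac => _ _ _ h w; rewrite h -NcE NcM NcV NcX !Nc_real.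
rewrite ger0_norm ?sqr_ge0 // ger0_norm ?Nc_ge0 //.
apply: ler_wpM2l; first exact: sqr_ge0.
by rewrite lef_pV2 ?posrE ?exprn_gt0 ?Nc_gt0 // lerXn2r ?nnegrE ?Nc_ge0 // ltW.
Qed.

Lemma mean_expi_mul (a : R[i]) (k l : int) :
  mean (fun w => expi (k%:~R * w) * (a * expi (l%:~R * w))) = a * (k + l == 0)%:R.
Proof.
rewrite -mean_expi -meanZ; last exact: ccont_expi.
by congr mean; apply: funext => w; rewrite mulrCA -expiD -mulrDl intrD.
Qed.

(** Testing against frequency [k] picks the coefficient of index [- k]; evenness of [c] brings it
    back to [k]. *)
Lemma f_coef (k : int) : mean (fun w => expi (k%:~R * w) * (f w)%:C) = (c k)%:C.
Proof.
pose u1 (j : nat) (w : R) := expi (k%:~R * w) * ((c j%:Z)%:C * expi (j%:Z%:~R * w)).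
pose u2 (j : nat) (w : R) := expi (k%:~R * w) * ((c (- j.+1%:Z))%:C * expi ((- j.+1%:Z)%:~R * w)).
have b1 j w : Nc (u1 j w) <= `|c j%:Z| by rewrite !NcM Nc_real !Nc_expi mul1r mulr1.
have b2 j w : Nc (u2 j w) <= `|c (- j.+1%:Z)| by rewrite !NcM Nc_real !Nc_expi mul1r mulr1.
have c1 j : ccont (u1 j).
  by apply: ccontM; [exact: ccont_expi|apply: ccontZ; exact: ccont_expi].
have c2 j : ccont (u2 j).
  by apply: ccontM; [exact: ccont_expi|apply: ccontZ; exact: ccont_expi].
have -> : mean (fun w => expi (k%:~R * w) * (f w)%:C) =
   mean (fun w => csum (fun j => u1 j w) + csum (fun j => u2 j w)).
  congr mean; apply: funext => w; rewrite fE /zsum mulrDr -!csumZ //.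
    by apply: (asumP _ cvg_cneg) => j; rewrite NcM Nc_real Nc_expi mulr1.
  by apply: (asumP _ cc) => j; rewrite NcM Nc_real Nc_expi mulr1.
rewrite meanD; [|exact: ccont_csum b1 cc|exact: ccont_csum b2 cvg_cneg].
rewrite (mean_csum c1 b1 cc) (mean_csum c2 b2 cvg_cneg).
under [X in csum X + _]eq_fun do rewrite mean_expi_mul.
under [X in _ + csum X]eq_fun do rewrite mean_expi_mul.
clear u1 u2 b1 b2 c1 c2; case: k => [[|n]|n].
- rewrite (_ : csum (fun j => _ * (0%N%:Z - j.+1%:Z == 0)%:R) = 0); last first.
    by rewrite (_ : (fun j => _) = fun=> 0) ?csum0 //; apply: funext => j; rewrite /= mulr0.
  rewrite addr0 -[RHS](csum_delta (fun j : nat => (c j%:Z)%:C) 0).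
  by congr csum; apply: funext => j; rewrite add0r.
- rewrite (_ : csum (fun j => _ * (n.+1%:Z + j%:Z == 0)%:R) = 0); last first.
    by rewrite (_ : (fun j => _) = fun=> 0) ?csum0 //; apply: funext => j; rewrite /= mulr0.
  rewrite add0r -[RHS]/((fun j : nat => (c j.+1%:Z)%:C) n) -csum_delta.
  congr csum; apply: funext => j; rewrite ceven subr_eq0 eqz_nat eqSS eq_sym.
  by [].
- rewrite [X in _ + X](_ : _ = 0); last first.
    rewrite (_ : (fun j => _) = fun=> 0) ?csum0 //; apply: funext => j.
    by rewrite NegzE -opprD oppr_eq0 /= mulr0.
  rewrite addr0 NegzE ceven -[RHS](csum_delta (fun j : nat => (c j%:Z)%:C)).
  congr csum; apply: funext => j; rewrite addrC subr_eq0 eqz_nat.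
  by [].
Qed.

(** The right side is the conjugate of a causal function, so [f * phi] has no negative frequency.
    The vanishing of its coefficients there is exactly the Yule-Walker system. *)
Lemma f_phiw w : (f w)%:C * phiw phi w = (sigma ^+ 2)%:C * ((phiw phi w)^-1)^*.
Proof.
case: cfac => _ _ _ ->; rewrite -mulrA; congr (_ * _).
rewrite sqr_normc fmorphV invfM mulrAC mulVf ?mul1r //.
Qed.

Lemma yule_walker (k : nat) : (0 < k)%N ->
  csum (fun j : nat => (acoef phi j)%:C * (c (k%:Z - j%:Z))%:C) = 0.
Proof.
move=> k0; have [B B0 fB] := f_bound.
under eq_fun do rewrite -f_coef.
rewrite -(mean_hser k (cvg_acoef cphi) ccont_f fB) -(phiw_acoef cphi).
have cVc := CA_ccont (CA_phiw_inv cphi nz).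
transitivity ((sigma ^+ 2)%:C * mean (fun w => (expi ((- k%:Z)%:~R * w) * (phiw phi w)^-1)^*)).
  rewrite -meanZ; last by apply: ccont_conj; apply: ccontM => //; exact: ccont_expi.
  congr mean; apply: funext => w.
  by rewrite [phiw phi w * _]mulrC f_phiw mulrCA conjM -expiN -mulNr -mulrNz opprK.
rewrite mean_conj; last by apply: ccontM => //; exact: ccont_expi.
rewrite CA_coef_neg ?conjc0 ?mulr0 //; last by rewrite oppr_lt0.
exact: CA_phiw_inv.
Qed.

End SpectralDensity.

(** * Polynomial decay of the autoregressive coefficients *)

Section PowerWeights.
Variable R : realType.

(** Two regimes: if [|x - y| < h y], the ratio [x / y] lies between the [K]-th roots [l] and [u] of
    [1 - e] and [1 + e]; otherwise [y <= |x - y| / h], and both powers are at most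
    [((1 + 1/h) |x - y|)^K]. Taking [e] small is what permits absorption in the weighted
    estimate. *)
Lemma powR_dist (K e : R) : 0 < K -> 0 < e -> e < 1 -> exists2 C : R, 0 <= C &
  forall x y : R, 0 <= x -> 0 <= y ->
    `|x `^ K - y `^ K| <= e * y `^ K + C * `|x - y| `^ K.
Proof.
move=> K0 e0 e1.
have KV : 0 < K^-1 by rewrite invr_gt0.
have pK (z : R) : 0 <= z -> (z `^ K^-1) `^ K = z.
  by move=> z0; rewrite -powRrM mulVf ?gt_eqF // powRr1.
have pm (x y : R) : 0 <= x -> x <= y -> x `^ K <= y `^ K.
  by move=> x0 xy; apply: (ge0_ler_powR (ltW K0)); rewrite ?nnegrE // (le_trans x0).
have one : 1 `^ K^-1 = 1 :> R by rewrite powR1.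
pose u := (1 + e) `^ K^-1; pose l := (1 - e) `^ K^-1.
have u1 : 1 < u.
  by rewrite -{1}one; apply: gt0_ltr_powR; rewrite ?nnegrE; lra.
have l1 : l < 1.
  by rewrite -{1}one; apply: gt0_ltr_powR; rewrite ?nnegrE; lra.
have l0 : 0 <= l by exact: powR_ge0.
pose h := Num.min (u - 1) (1 - l).
have h0 : 0 < h by rewrite /h lt_min !subr_gt0 u1.
have hu : h <= u - 1 by rewrite /h ge_min lexx.
have hl : h <= 1 - l by rewrite /h ge_min lexx orbT.
have uK : u `^ K = 1 + e by apply: pK; lra.
have lK : l `^ K = 1 - e by apply: pK; lra.
clearbody u l h; exists ((1 + h^-1) `^ K); first exact: powR_ge0.
move=> x y x0 y0; set d := `|x - y|.
have d0 : 0 <= d by exact: normr_ge0.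
have xd : x <= y + d by have := ler_norm (x - y); rewrite -/d; lra.
have dx : y <= x + d by have := ler_norm (y - x); rewrite distrC -/d; lra.
have xK := powR_ge0 x K; have yK := powR_ge0 y K.
have hV : 0 < h^-1 by rewrite invr_gt0.
have [hy|hy] := lerP (h * y) d.
  have yh : y <= h^-1 * d by rewrite mulrC ler_pdivlMr // mulrC.
  have hd : (1 + h^-1) * d = d + h^-1 * d by ring.
  rewrite -powRM //; last by lra.
  have x1 : x `^ K <= ((1 + h^-1) * d) `^ K by apply: pm => //; lra.
  have y1 : y `^ K <= ((1 + h^-1) * d) `^ K by apply: pm => //; lra.
  have ey : 0 <= e * y `^ K by rewrite mulr_ge0 // ltW.
  by rewrite ler_norml; lra.
have C0 : 0 <= (1 + h^-1) `^ K * d `^ K by rewrite mulr_ge0 ?powR_ge0.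
have hyu : h * y <= (u - 1) * y by rewrite ler_wpM2r.
have hyl : h * y <= (1 - l) * y by rewrite ler_wpM2r.
have x1 : x `^ K <= (u * y) `^ K by apply: pm => //; lra.
have x2 : (l * y) `^ K <= x `^ K by apply: pm => //; [rewrite mulr_ge0|lra].
move: x1 x2; rewrite !powRM //; last by lra.
by rewrite uK lK ler_norml => x1 x2; lra.
Qed.

Lemma rsum_sum (I : nat) (M : nat -> nat -> R) : (forall i, cvgn (series (M i))) ->
  cvgn (series (fun j => \sum_(0 <= i < I) M i j)) /\
  rsum (fun j => \sum_(0 <= i < I) M i j) = \sum_(0 <= i < I) rsum (M i).
Proof.
move=> cM; elim: I => [|I [IH1 IH2]].
  have E : series (fun j => \sum_(0 <= i < 0) M i j) = fun=> 0.
    by apply: funext => N; rewrite /series /= big1 // => j _; rewrite big_geq.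
  rewrite /rsum E big_geq //; split; first exact: is_cvg_cst.
  by rewrite lim_cst.
have E : (fun j => \sum_(0 <= i < I.+1) M i j) = (fun j => \sum_(0 <= i < I) M i j) + M I.
  by apply: funext => j; rewrite big_nat_recr.
rewrite E big_nat_recr //= -IH2; split; first exact: is_cvg_seriesD.
by rewrite /rsum lim_seriesD.
Qed.

Lemma sum_csum_le (I : nat) (u : nat -> nat -> R[i]) B :
  (forall i, asum (u i)) ->
  (forall J, \sum_(0 <= j < J) \sum_(0 <= i < I) Nc (u i j) <= B) ->
  \sum_(0 <= i < I) Nc (csum (u i)) <= B.
Proof.
move=> au uB; have [h1 h2] := @rsum_sum I (fun i j => Nc (u i j)) au.
apply: (@le_trans _ _ (\sum_(0 <= i < I) rsum (fun j => Nc (u i j)))).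
  by apply: ler_sum => i _; exact: (csum_norm (fun j => lexx _) (au i)).
by rewrite -h2; exact: rsum_le.
Qed.

(** Each distance to [j] is attained at most twice, once on either side. *)
Lemma sum_dist_le (g : nat -> R) B (j I : nat) : (forall k, 0 <= g k) ->
  (forall N, \sum_(0 <= k < N) g k <= B) ->
  \sum_(0 <= i < I) g `|i%:Z - j%:Z|%N <= 2 * B.
Proof.
move=> g0 gB.
apply: (@le_trans _ _ (\sum_(0 <= i < j + I) g `|i%:Z - j%:Z|%N)).
  rewrite [leRHS](big_cat_nat (leq0n I) (leq_addl j I)) /= lerDl.
  by apply: sumr_ge0.
rewrite (big_cat_nat (leq0n j) (leq_addr I j)) /= (big_shift_nat _ j I).
rewrite mulr2n mulrDl mul1r lerD //.
  rewrite big_nat_rev /= add0n; apply: le_trans (gB j.+1).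
  rewrite big_nat_recl //= -[leLHS]add0r lerD //.
  rewrite big_nat_cond [leRHS]big_nat_cond le_eqVlt; apply/orP; left; apply/eqP.
  apply: eq_bigr => i /andP[/andP[_ ij] _]; congr g; lia.
apply: le_trans (gB I); rewrite le_eqVlt; apply/orP; left; apply/eqP.
by apply: eq_bigr => i _; congr g; lia.
Qed.

End PowerWeights.

(** * Weighted summability by a truncated bootstrap *)

Section WeightedDecay.
Variables (R : realType) (f : R -> R) (c : int -> R) (phi : nat -> R) (sigma K : R).
Hypothesis fE : fourier_expansion f c.
Hypothesis cfac : canonical_factorisation phi f sigma.
Hypothesis ceven : forall r, c (- r) = c r.
Hypothesis K1 : 1 < K.
Variables (C0 CK : R).
Hypothesis cC0 : forall N, \sum_(0 <= k < N) `|c k%:Z| <= C0.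
Hypothesis cCK : forall N, \sum_(0 <= k < N) (k%:R `^ K) * `|c k%:Z| <= CK.

Let cc : cvgn (series (fun k : nat => `|c k%:Z|)).
Proof. exact: (cvg_series_bound _ cC0). Qed.
Let cphi : cvgn (series (fun j => `|phi j.+1|)). Proof. by case: cfac. Qed.
Let nz : forall z : R[i], `|z| <= 1 -> ar_series phi z != 0. Proof. by case: cfac. Qed.
Let phi0 w : phiw phi w != 0. Proof. exact: phiw_neq0. Qed.
Let Kge0 : 0 <= K. Proof. exact: ltW (lt_trans ltr01 K1). Qed.
Let s0 : 0 < sigma. Proof. by case: cfac. Qed.
Let a := acoef phi.
Let pE : phiw phi = hser a. Proof. exact: phiw_acoef cphi. Qed.
Let ca : cvgn (series (fun j => `|a j|)). Proof. exact: cvg_acoef cphi. Qed.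
Let A1 := rsum (fun j => `|a j|).
Let A10 : 0 <= A1. Proof. exact: rsum_ge0. Qed.

Let cabs (k : int) : `|c k| = `|c `|k|%N%:Z|.
Proof. by case: k => n //; rewrite NegzE ceven. Qed.

Section Truncated.
Variables (N : nat) (e C : R).
Hypotheses (e0 : 0 < e) (C_ge0 : 0 <= C).
Hypothesis eC : forall x y : R, 0 <= x -> 0 <= y ->
    `|x `^ K - y `^ K| <= e * y `^ K + C * `|x - y| `^ K.

(* The truncation keeps the weight bounded while [j |-> minn j N] stays 1-Lipschitz. *)
Let v (j : nat) : R := (minn j N)%:R `^ K.
Let v_ge0 j : 0 <= v j. Proof. exact: powR_ge0. Qed.
Let v0 : v 0 = 0. Proof. by rewrite /v min0n powR0 // gt_eqF // (lt_trans ltr01). Qed.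

Let vdist i j : `|v j - v i| <= e * v j + C * `|i%:Z - j%:Z|%N%:R `^ K.
Proof.
rewrite distrC; apply: le_trans (eC _ _) _; rewrite ?ler0n //.
rewrite lerD2l ler_wpM2l //; apply: (ge0_ler_powR Kge0); rewrite ?nnegrE //.
have E (m : int) : `|m%:~R| = `|m|%N%:R :> R by rewrite -intr_norm -abszE.
rewrite -[(minn i N)%:R]/((minn i N)%:Z%:~R) -[(minn j N)%:R]/((minn j N)%:Z%:~R) -intrB.
by rewrite E ler_nat; lia.
Qed.

Let va j := v j * a j.

Let vN j : v j <= N%:R `^ K.
Proof.
by apply: (ge0_ler_powR Kge0); rewrite ?nnegrE // ler_nat geq_minr.
Qed.

Let cva : cvgn (series (fun j => `|va j|)).
Proof.
have h : cvgn (series (fun j => N%:R `^ K * `|a j|)) by apply: is_cvg_seriesZ.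
apply: (series_le_cvg _ _ _ h) => [j|j|j]; first exact: normr_ge0.
  by rewrite mulr_ge0 // powR_ge0.
by rewrite normrM ger0_norm // ler_wpM2r.
Qed.

Let S := rsum (fun j => `|va j|).
Let S0 : 0 <= S. Proof. exact: rsum_ge0. Qed.

Let G w := (f w)%:C * hser va w.
Let cG : ccont G.
Proof. by apply: ccontM; [exact: ccont_f fE ceven cc|apply: CA_ccont; exact: CA_hser]. Qed.
Let GB : exists2 B : R, 0 < B & forall w, Nc (G w) <= B.
Proof.
have [B B0 h] := f_bound cfac.
exists (B * (S + 1)); first by rewrite mulr_gt0 // ltr_wpDl.
move=> w; rewrite NcM ler_pM ?Nc_ge0 // (le_trans (hser_le _ cva)) //.
by rewrite lerDl.
Qed.

Let dc (i : nat) := mean (fun w => expi (i%:Z%:~R * w) * G w).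

(** Row [i] of the Toeplitz system applied to [va], minus [v i] times the same row applied to [a],
    which vanishes; only the commutator with the weight remains. *)
Let dcE i : dc i = csum (fun j : nat => ((v j - v i) * a j * c (i%:Z - j%:Z))%:C).
Proof.
have [B B0 fB] := f_bound cfac.
have h1 : dc i = csum (fun j : nat => (va j)%:C * (c (i%:Z - j%:Z))%:C).
  rewrite /dc; under eq_fun do rewrite /G [(f _)%:C * _]mulrC.
  rewrite (mean_hser i cva (ccont_f fE ceven cc) fB).
  by congr csum; apply: funext => j; rewrite (f_coef fE ceven cc).
have cB (k : int) : Nc (c k)%:C <= C0.
  rewrite Nc_real cabs; apply: le_trans (cC0 `|k|%N.+1).
  by rewrite big_nat_recr //= lerDr sumr_ge0.
(* Yule-Walker gives this for [i > 0]; it says nothing at [i = 0], where [v 0 = 0] takes over. *)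
have h2 : csum (fun j : nat => (- v i)%:C * ((a j)%:C * (c (i%:Z - j%:Z))%:C)) = 0.
  rewrite csumZ; last by apply: (asumM (asum_real ca)).
  case: i {h1} => [|i]; first by rewrite v0 oppr0 mul0r.
  by rewrite (yule_walker fE cfac ceven cc) // mulr0.
rewrite -[LHS]addr0 -h2 h1 -csumD; last first.
- by apply: asumZ; apply: (asumM (asum_real ca)).
- by apply: (asumM (asum_real cva)).
congr csum; apply: funext => j; rewrite /va !rmorphM rmorphB rmorphN.
by rewrite /=; ring.
Qed.

Let BD := 2 * C0 * e * S + 2 * C * CK * A1.
Let C00 : 0 <= C0. Proof. by have := cC0 0; rewrite big_geq. Qed.
Let CK0 : 0 <= CK. Proof. by have := cCK 0; rewrite big_geq. Qed.

Let dc_sum I : \sum_(0 <= i < I) Nc (dc i) <= BD.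
Proof.
under eq_bigr do rewrite dcE.
apply: sum_csum_le => [i|J].
  have cB (k : int) : Nc (c k)%:C <= C0.
    rewrite Nc_real cabs; apply: le_trans (cC0 `|k|%N.+1).
    by rewrite big_nat_recr //= lerDr sumr_ge0.
  under eq_fun do rewrite rmorphM.
  apply: (@asumM _ _ _ C0); last by move=> j; exact: cB.
  apply: asum_real.
  have h : cvgn (series (fun j => 2 * N%:R `^ K * `|a j|)) by apply: is_cvg_seriesZ.
  apply: (series_le_cvg _ _ _ h) => [j|j|j]; first exact: normr_ge0.
    by rewrite mulr_ge0 // mulr_ge0 // powR_ge0.
  rewrite normrM ler_wpM2r // (le_trans (ler_normB _ _)) //.
  by rewrite !ger0_norm // mulr2n mulrDl mul1r lerD.
apply: (@le_trans _ _ (\sum_(0 <= j < J) (2 * C0 * e * `|va j| + 2 * C * CK * `|a j|))).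
  apply: ler_sum => j _.
  apply: (@le_trans _ _ (\sum_(0 <= i < I) (e * `|va j| * `|c `|i%:Z - j%:Z|%N%:Z| +
     C * `|a j| * (`|i%:Z - j%:Z|%N%:R `^ K * `|c `|i%:Z - j%:Z|%N%:Z|)))).
    apply: ler_sum => i _; rewrite Nc_real !normrM (cabs (_ - _)).
    have := ler_wpM2r (mulr_ge0 (normr_ge0 (a j)) (normr_ge0 (c `|i%:Z - j%:Z|%N%:Z))) (vdist i j).
    rewrite mulrA => /le_trans; apply.
    rewrite le_eqVlt; apply/orP; left; apply/eqP; rewrite ger0_norm //.
    by ring.
  rewrite big_split /= -!mulr_sumr; apply: lerD.
    have h := @sum_dist_le _ (fun k => `|c k%:Z|) C0 j I (fun=> normr_ge0 _) cC0.
    have := ler_wpM2l (mulr_ge0 (ltW e0) (normr_ge0 (va j))) h.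
    by move/le_trans; apply; rewrite le_eqVlt; apply/orP; left; apply/eqP; ring.
  have := @sum_dist_le _ (fun k => k%:R `^ K * `|c k%:Z|) CK j I _ cCK.
  move=> /(_ (fun=> mulr_ge0 (powR_ge0 _ _) (normr_ge0 _))) h.
  have := ler_wpM2l (mulr_ge0 C_ge0 (normr_ge0 (a j))) h.
  by move/le_trans; apply; rewrite le_eqVlt; apply/orP; left; apply/eqP; ring.
rewrite big_split /= -!mulr_sumr; apply: lerD; apply: ler_wpM2l.
- by rewrite !mulr_ge0 // ltW.
- exact: le_psum_rsum.
- by rewrite !mulr_ge0.
- exact: le_psum_rsum.
Qed.

Let BD0 : 0 <= BD. Proof. by have := dc_sum 0; rewrite big_geq. Qed.

Let Y w := (phiw phi w)^-1 * hser va w.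
Let CAY : CA Y. Proof. by apply: CAM; [exact: CA_phiw_inv|exact: CA_hser]. Qed.

Let ec (k : nat) := mean (fun w => expi (k%:Z%:~R * w) * Y w).

(** Since [1 / phi = sigma^-2 f conj(phi)], the function [Y] equals [sigma^-2 conj(phi) G]. The
    conjugate factor only raises indices, so coefficients of [G] enter only at the indices [i >= 0]
    controlled by [dcE]. *)
Let ecE k : ec k = (sigma ^+ 2)^-1%:C * csum (fun j : nat => (a j)%:C * dc (k + j)).
Proof.
have [B B0 hB] := GB.
rewrite -(mean_hser_conj k ca cG hB) -meanZ; last first.
  apply: ccontM; first exact: ccont_expi.
  by apply: ccontM => //; apply: ccont_conj; apply: CA_ccont; exact: CA_hser.
congr mean; apply: funext => w; rewrite [RHS]mulrCA; congr (_ * _).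
transitivity ((sigma ^+ 2)^-1%:C * ((phiw phi w)^* * G w)); last by rewrite pE.
rewrite /G /Y [(phiw _ _)^* * _]mulrA [(phiw _ _)^* * _]mulrC.
have -> : (phiw phi w)^-1 = (sigma ^+ 2)^-1%:C * ((f w)%:C * (phiw phi w)^*).
  have := f_phiw cfac w => /(congr1 conjc).
  rewrite !conjM conjcK !conjc_real => ->.
  by rewrite mulrA -rmorphM mulVf ?mul1r // gt_eqF // exprn_gt0.
by rewrite !mulrA.
Qed.

Let ec_sum I : \sum_(0 <= k < I) Nc (ec k) <= (sigma ^+ 2)^-1 * (A1 * BD).
Proof.
have s20 : 0 <= (sigma ^+ 2)^-1 by rewrite invr_ge0 sqr_ge0.
under eq_bigr do rewrite ecE NcM Nc_real ger0_norm //.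
rewrite -mulr_sumr ler_wpM2l //.
have dB k : Nc (dc k) <= BD.
  by apply: le_trans (dc_sum k.+1); rewrite big_nat_recr //= lerDr sumr_ge0 // => i _; exact: Nc_ge0.
apply: sum_csum_le => [k|J].
  by apply: (asumM (asum_real ca)) => j; exact: dB.
apply: (@le_trans _ _ (\sum_(0 <= j < J) `|a j| * BD)).
  apply: ler_sum => j _; under eq_bigr do rewrite NcM Nc_real.
  rewrite -mulr_sumr ler_wpM2l //; apply: le_trans (dc_sum (j + I)).
  rewrite (big_cat_nat (leq0n j) (leq_addr I j)) /= (big_shift_nat _ j I).
  under [X in X <= _]eq_bigr do rewrite addnC.
  by rewrite lerDr sumr_ge0 // => i _; exact: Nc_ge0.
by rewrite -mulr_suml ler_wpM2r // le_psum_rsum.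
Qed.

Let BE := (sigma ^+ 2)^-1 * (A1 * BD).
Let BE0 : 0 <= BE. Proof. by have := ec_sum 0; rewrite big_geq. Qed.

Let vaE (k : nat) : (va k)%:C =
  csum (fun j : nat => (a j)%:C * mean (fun w => expi ((k%:Z - j%:Z)%:~R * w) * Y w)).
Proof.
have [B B0 hB] := CA_bound CAY.
rewrite -(mean_hser k ca (CA_ccont CAY) hB) -(hser_coef k cva).
congr mean; apply: funext => w.
by rewrite -pE /Y [phiw _ _ * _]mulrA divff // mul1r.
Qed.

Let va_sum I : \sum_(0 <= k < I) `|va k| <= A1 * BE.
Proof.
have [B B0 hB] := CA_bound CAY.
have cY (m : int) : ccont (fun w => expi (m%:~R * w) * Y w).
  by apply: ccontM; [exact: ccont_expi|exact: CA_ccont].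
under eq_bigr do rewrite -Nc_real vaE.
apply: sum_csum_le => [k|J].
  apply: (asumM (B := 2 * B) (asum_real ca)) => j; apply: mean_norm => // w.
  by rewrite NcM Nc_expi mul1r.
apply: (@le_trans _ _ (\sum_(0 <= j < J) `|a j| * BE)).
  apply: ler_sum => j _; under eq_bigr do rewrite NcM Nc_real.
  rewrite -mulr_sumr ler_wpM2l //; apply: le_trans (ec_sum I).
  apply: (@le_trans _ _ (\sum_(0 <= k < j + I)
      Nc (mean (fun w => expi ((k%:Z - j%:Z)%:~R * w) * Y w)))).
    rewrite [leRHS](big_cat_nat (leq0n I) (leq_addl j I)) /= lerDl.
    by apply: sumr_ge0 => i _; exact: Nc_ge0.
  rewrite (big_cat_nat (leq0n j) (leq_addr I j)) /= (big_shift_nat _ j I).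
  (* Causality of [Y] removes the terms with [k < j]; the others are the [ec] already summed. *)
  rewrite big_nat_cond big1 ?add0r => [|i /andP[/andP[_ ij] _]]; last first.
    by rewrite CA_coef_neg ?Nc0 // subr_lt0 ltz_nat.
  apply: ler_sum => i _; rewrite /ec.
  by rewrite PoszD addrAC subrr add0r.
by rewrite -mulr_suml ler_wpM2r // le_psum_rsum.
Qed.

(* The Toeplitz operator of [f], compressed to nonpositive frequencies, kills
   [a] up to its 0-th entry and has the bounded inverse
   [sigma^-2 T_phi T_(conj phi)]; commuting the weight [v] past it costs only
   the factors [v j - v i], whose leading part [e * v j] is absorbed. *)
Lemma weighted_bootstrap : rsum (fun j => `|va j|) <=
  A1 * ((sigma ^+ 2)^-1 * (A1 * (2 * C0 * e * rsum (fun j => `|va j|) + 2 * C * CK * A1))).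
Proof. by apply: rsum_le va_sum. Qed.

Lemma weighted_psum_le : \sum_(0 <= j < N.+1) j%:R `^ K * `|a j| <= rsum (fun j => `|va j|).
Proof.
apply: le_trans (le_psum_rsum _ cva N.+1) => //.
rewrite big_nat_cond [leRHS]big_nat_cond; apply: ler_sum => j /andP[/andP[_ jN] _].
by rewrite normrM ger0_norm // /v (minn_idPl _).
Qed.

End Truncated.

Lemma weighted_acoef : exists B, forall N, \sum_(0 <= j < N) j%:R `^ K * `|a j| <= B.
Proof.
have C00 : 0 <= C0 by have := cC0 0; rewrite big_geq.
have s20 : 0 <= (sigma ^+ 2)^-1 by rewrite invr_ge0 sqr_ge0.
pose L := A1 * ((sigma ^+ 2)^-1 * (A1 * (2 * C0))).
have L0 : 0 <= L by rewrite !mulr_ge0.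
(* With this value of [e], [L * e <= 1/2], so the bootstrap reads [S <= S / 2 + T], whence
   [S <= 2 T]. Subtracting [S / 2] is meaningful because the truncated weighted series converges,
   and [T] does not depend on the truncation level. *)
have eL : 0 < (2 + 2 * L)^-1 by rewrite invr_gt0; lra.
have [C C0' hC] : exists2 C : R, 0 <= C & forall x y : R, 0 <= x -> 0 <= y ->
    `|x `^ K - y `^ K| <= (2 + 2 * L)^-1 * y `^ K + C * `|x - y| `^ K.
  apply: powR_dist => //; first by rewrite (lt_trans ltr01).
  by rewrite invf_lt1; lra.
exists (2 * (A1 * ((sigma ^+ 2)^-1 * (A1 * (2 * C * CK * A1))))) => -[|N].
  rewrite big_geq //; have CK0 : 0 <= CK by have := cCK 0; rewrite big_geq.
  by rewrite !mulr_ge0.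
apply: le_trans (weighted_psum_le N) _.
have := @weighted_bootstrap N _ C eL C0' hC; set S := rsum _.
set T := A1 * (_ * (A1 * (2 * C * CK * A1))).
have S0 : 0 <= S.
  apply: le_trans (weighted_psum_le N); apply: sumr_ge0 => j _.
  by rewrite mulr_ge0 ?powR_ge0.
have -> : A1 * ((sigma ^+ 2)^-1 * (A1 * (2 * C0 * (2 + 2 * L)^-1 * S + 2 * C * CK * A1))) =
   L * (2 + 2 * L)^-1 * S + T by rewrite /L /T; ring.
have : L * (2 + 2 * L)^-1 <= 2^-1.
  by rewrite ler_pdivrMr; lra.
by move/(ler_wpM2r S0) => h1 h2; lra.
Qed.

End WeightedDecay.

(** * The prediction operator *)

Section SquareMean.
Variable R : realType.
Implicit Types F G : R -> R[i].

Definition n2 F : R := rmean (fun w => Nc (F w) ^+ 2).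

Lemma n2_ge0 F : 0 <= n2 F.
Proof. by apply: rmean_ge0 => w; exact: sqr_ge0. Qed.

Lemma n2_le F G a : ccont F -> ccont G -> (forall w, Nc (F w) ^+ 2 <= a * Nc (G w) ^+ 2) ->
  n2 F <= a * n2 G.
Proof.
move=> cF cG h; rewrite /n2 -rmeanZ; last exact: continuous_Nc2.
apply: rmean_le => //; first exact: continuous_Nc2.
by move=> w; apply: cvgM; [exact: cvg_cst|exact: (continuous_Nc2 cG)].
Qed.

Lemma eq_n2 F G : (forall w, Nc (F w) = Nc (G w)) -> n2 F = n2 G.
Proof. by move=> h; congr rmean; apply: funext => w; rewrite h. Qed.

Lemma n2N F : n2 (fun w => - F w) = n2 F.
Proof. by apply: eq_n2 => w; rewrite NcN. Qed.

Lemma n2E F : (n2 F)%:C = mean (fun w => F w * (F w)^*).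
Proof. by rewrite -mean_real; congr mean; apply: funext => w; rewrite mul_conjE. Qed.

Lemma n2D F G : ccont F -> ccont G -> mean (fun w => (F w)^* * G w) = 0 ->
  n2 (fun w => F w + G w) = n2 F + n2 G.
Proof.
move=> cF cG h; apply: (@complexI R).
have e : (n2 F + n2 G)%:C = (n2 F)%:C + (n2 G)%:C :> R[i] by rewrite rmorphD.
rewrite e !n2E.
have cFc := ccont_conj cF; have cGc := ccont_conj cG.
have h' : mean (fun w => ((F w)^* * G w)^*) = 0.
  by rewrite mean_conj ?h ?conjc0 //; exact: ccontM.
transitivity (mean (fun w => (F w * (F w)^* + G w * (G w)^*) +
                             ((F w)^* * G w + ((F w)^* * G w)^*))).
  by congr mean; apply: funext => w; rewrite conjD conjM conjcK; ring.
rewrite meanD; [|exact: ccontD (ccontM cF cFc) (ccontM cG cGc)|].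
  rewrite meanD; [|exact: ccontM|exact: ccontM].
  rewrite (meanD (ccontM cFc cG)); last by apply: ccont_conj; exact: ccontM.
  by rewrite h h' !addr0.
by apply: ccontD; [exact: ccontM|apply: ccont_conj; exact: ccontM].
Qed.

(** [F] is the sum of its component along [expi (- k w)] and an orthogonal remainder. This is the
    passage from L^2 control to control of each coefficient, used in [y_sqr]. *)
Lemma bessel F (k : int) : ccont F ->
  Nc (mean (fun w => expi (k%:~R * w) * F w)) ^+ 2 <= n2 F.
Proof.
move=> cF; set z := mean _.
pose G w := z * expi ((- k)%:~R * w).
have cG : ccont G by apply: ccontZ; exact: ccont_expi.
have ce : ccont (fun w : R => expi (k%:~R * w)) by exact: ccont_expi.
have ek w : expi ((- k)%:~R * w) = (expi (k%:~R * w))^* :> R[i].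
  by rewrite -expiN mulrNz mulNr.
have orth : mean (fun w => (G w)^* * (F w - G w)) = 0.
  transitivity (mean (fun w => z^* * (expi (k%:~R * w) * F w - z))).
    congr mean; apply: funext => w; rewrite /G conjM ek conjcK mulrBr mulrBr -mulrA.
    congr (_ - _); rewrite mulrACA -[RHS]mulr1; congr (_ * _).
    by rewrite -ek mulrNz mulNr mulrC expiNM.
  rewrite meanZ; last by apply: ccontB; [exact: ccontM|exact: ccont_cst].
  rewrite meanB; [|exact: ccontM|exact: ccont_cst].
  by rewrite mean_cst subrr mulr0.
have := n2D cG (ccontB cF cG) orth.
rewrite (_ : (fun w => G w + (F w - G w)) = F); last first.
  by apply: funext => w; rewrite addrC subrK.
move=> ->; rewrite (_ : n2 G = Nc z ^+ 2); first by rewrite lerDl n2_ge0.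
rewrite /n2; under eq_fun do rewrite /G NcM Nc_expi mulr1.
exact: rmean_cst.
Qed.

End SquareMean.

Section PredictionOperator.
Variables (R : realType) (phi : nat -> R).
Hypothesis cphi : cvgn (series (fun j => `|phi j.+1|)).
Hypothesis nz : forall z : R[i], `|z| <= 1 -> ar_series phi z != 0.
Variable (D : nat -> R).
Hypothesis hD : forall n N, \sum_(0 <= u < N) u.+1%:R * `|phi (n.+1 + u)%N| <= D n.

Let phi0 w : phiw phi w != 0. Proof. exact: phiw_neq0. Qed.
Let CAphi : CA (phiw phi). Proof. exact: CA_phiw. Qed.
Let CAphiV : CA (fun w => (phiw phi w)^-1). Proof. exact: CA_phiw_inv. Qed.

Definition tau (t : nat) : R := rsum (fun s => `|phi (t + s)%N|).

Lemma cvg_tail t : (0 < t)%N -> cvgn (series (fun s => `|phi (t + s)%N|)).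
Proof.
case: t => // t _.
apply: (@cvg_series_bound _ _ (rsum (fun j => `|phi j.+1|))) => // N.
apply: le_trans (le_psum_rsum _ cphi (t + N)) => //.
rewrite (big_cat_nat (leq0n t) (leq_addr N t)) /= (big_shift_nat _ t N).
by rewrite lerDr sumr_ge0.
Qed.

Lemma tau_ge0 t : (0 < t)%N -> 0 <= tau t.
Proof. by move=> t0; apply: rsum_ge0 => //; exact: cvg_tail. Qed.

Lemma phi_inf_hser t : phi_inf phi t = hser (fun s => phi (t + s)%N).
Proof. by []. Qed.

Lemma CA_phi_inf t : (0 < t)%N -> CA (phi_inf phi t).
Proof. by move=> t0; rewrite phi_inf_hser; apply: CA_hser; exact: cvg_tail. Qed.

Lemma phi_inf_le t w : (0 < t)%N -> Nc (phi_inf phi t w) <= tau t.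
Proof. by move=> t0; rewrite phi_inf_hser; apply: hser_le; exact: cvg_tail. Qed.

Lemma phi_inf_coef t (k : nat) : (0 < t)%N ->
  mean (fun w => expi (k%:Z%:~R * w) * phi_inf phi t w) = (phi (t + k)%N)%:C.
Proof. by move=> t0; rewrite phi_inf_hser hser_coef //; exact: cvg_tail. Qed.

Lemma tauS t : (0 < t)%N -> tau t = `|phi t| + tau t.+1.
Proof.
move=> t0; apply/eqP; rewrite eq_le; apply/andP; split.
  apply: rsum_le => [|[|N]]; first exact: cvg_tail.
    by rewrite big_geq // addr_ge0 // tau_ge0.
  rewrite big_nat_recl //= addn0 lerD2l.
  under eq_bigr do rewrite addnS -addSn.
  by apply: le_psum_rsum => //; exact: cvg_tail.
rewrite addrC -lerBrDr; apply: rsum_le => [|N]; first exact: cvg_tail.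
rewrite lerBrDr addrC.
have := le_psum_rsum (fun s => normr_ge0 (phi (t + s)%N)) (cvg_tail t0) N.+1.
rewrite big_nat_recl //= addn0.
by under eq_bigr do rewrite addnS -addSn.
Qed.

(** In the double sum defining [Phi_n], the coefficient [phi (n+1+k)] occurs [k + 1] times; hence
    [D n] bounds the total absolute mass of the kernel. *)
Lemma sum_tau_le n N : \sum_(0 <= u < N) tau (n.+1 + u) <= D n.
Proof.
(* Summation by parts. The boundary term [N * tau (n+1+N)] fits into the rest of the weighted sum,
   whose weights all exceed [N]. *)
have E : \sum_(0 <= u < N) tau (n.+1 + u) =
    \sum_(0 <= u < N) u.+1%:R * `|phi (n.+1 + u)%N| + N%:R * tau (n.+1 + N).
  elim: N => [|N IH]; first by rewrite !big_geq // mul0r addr0.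
  rewrite !big_nat_recr //= IH addnS tauS // -natr1; ring.
rewrite E -lerBrDl; have c := @cvg_tail (n.+1 + N) isT.
have cN : cvgn (series (fun s => N%:R * `|phi (n.+1 + N + s)%N|)) by exact: is_cvg_seriesZ.
have -> : N%:R * tau (n.+1 + N) = rsum (fun s => N%:R * `|phi (n.+1 + N + s)%N|).
  by rewrite /rsum lim_seriesZ.
apply: rsum_le => // J; rewrite lerBrDl; apply: le_trans (hD n (N + J)).
rewrite (big_cat_nat (leq0n N) (leq_addr J N)) /= lerD2l (big_shift_nat _ N J).
by apply: ler_sum => j _; rewrite addnA ler_wpM2r // ler_nat ltnW // ltnS leq_addr.
Qed.

Lemma cvg_tau n : cvgn (series (fun u => tau (n.+1 + u))).
Proof.
by apply: (cvg_series_bound _ (sum_tau_le n)) => j; exact: tau_ge0.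
Qed.

Lemma D_ge0 n : 0 <= D n.
Proof. by have := hD n 0; rewrite big_geq. Qed.

Lemma Phi_nE n w l : Phi_n phi n w l =
  csum (fun u => phi_inf phi (n.+1 + u) w * expi (u%:R * l)).
Proof. by rewrite /Phi_n addn1. Qed.

Lemma ccont_Phi_n n w : ccont (Phi_n phi n w).
Proof.
rewrite (_ : Phi_n _ _ _ = (fun l => csum (fun u => phi_inf phi (n.+1 + u) w * expi (u%:R * l)))).
  apply: (ccont_csum (M := fun u => tau (n.+1 + u))) => [j|j l|].
  - by apply: ccontZ; exact: ccont_expi.
  - by rewrite NcM Nc_expi mulr1; exact: phi_inf_le.
  - exact: cvg_tau.
by apply: funext => l; rewrite Phi_nE.
Qed.

(* The operator taking [zeta (n+1-t) n s] to [zeta t n s.+1]. *)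
Definition TT n (E : R -> R[i]) (w : R) : R[i] :=
  mean (fun l => (phiw phi l)^-1 * Phi_n phi n w l * E l).

Section OneStep.
Variables (n : nat) (E : R -> R[i]).
Hypothesis cE : CA E.

Let Y w := (phiw phi w)^-1 * E w.
Let CAY : CA Y. Proof. exact: CAM. Qed.
Let y (u : nat) := mean (fun l => expi (u%:Z%:~R * l) * Y l).

Let cY (m : int) : ccont (fun w => expi (m%:~R * w) * Y w).
Proof. by apply: ccontM; [exact: ccont_expi|exact: CA_ccont]. Qed.

Let y_real u : (y u)^* = y u. Proof. exact: CA_coef_real. Qed.
Let y_Re u : y u = (complex.Re (y u))%:C.
Proof. by have := y_real u; case: (y u) => a b [/eqP]; rewrite eqNr => /eqP ->. Qed.

(** The kernel is a series of separated products, so the operator sees [E] only through the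
    coefficients [y u] of [E / phi]. On coefficients it is the Hankel matrix [phi (n+1+i+u)], as
    [TT_coef] records. *)
Lemma TT_series w : TT n E w = csum (fun u => phi_inf phi (n.+1 + u) w * y u).
Proof.
have [B B0 YB] := CA_bound CAY.
pose v (u : nat) l := phi_inf phi (n.+1 + u) w * (expi (u%:Z%:~R * l) * Y l).
have vM u l : Nc (v u l) <= B * tau (n.+1 + u).
  rewrite /v NcM [Nc (_ * Y l)]NcM Nc_expi mul1r mulrC.
  by apply: ler_pM; [exact: Nc_ge0|exact: Nc_ge0|exact: YB|exact: phi_inf_le].
have cM : cvgn (series (fun u => B * tau (n.+1 + u))).
  by apply: is_cvg_seriesZ; exact: cvg_tau.
have cv u : ccont (v u) by apply: ccontZ.
transitivity (mean (fun l => csum (fun u => v u l))).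
  congr mean; apply: funext => l.
  rewrite mulrAC mulrC Phi_nE mulrC -csumZ; last first.
    apply: (asumP _ (@cvg_tau n)) => u; rewrite NcM Nc_expi mulr1.
    exact: phi_inf_le.
  by congr csum; apply: funext => u; rewrite /v /Y mulrC -mulrA.
rewrite (mean_csum cv vM cM); congr csum; apply: funext => u.
by rewrite /v meanZ.
Qed.

Lemma y_sqr u (s : R) : 0 <= s -> n2 Y <= s ^+ 2 -> Nc (y u) <= s.
Proof.
move=> s0 hs; rewrite -(@ler_pXn2r _ 2) ?nnegrE ?Nc_ge0 //.
exact: le_trans (bessel _ (CA_ccont CAY)) hs.
Qed.

Lemma asum_TT B w : (forall u, Nc (y u) <= B) ->
  asum (fun u => phi_inf phi (n.+1 + u) w * y u).
Proof.
move=> yB; have cM : cvgn (series (fun u => B * tau (n.+1 + u))).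
  by apply: is_cvg_seriesZ; exact: cvg_tau.
by apply: (asumP _ cM) => u; rewrite NcM mulrC ler_pM ?Nc_ge0 // phi_inf_le.
Qed.

Lemma TT_le B w : (forall u, Nc (y u) <= B) -> Nc (TT n E w) <= B * D n.
Proof.
move=> yB; rewrite TT_series; apply: csum_le => [|N]; first exact: asum_TT yB.
have B0 : 0 <= B by exact: le_trans (Nc_ge0 _) (yB 0).
apply: (@le_trans _ _ (\sum_(0 <= u < N) B * tau (n.+1 + u))).
  by apply: ler_sum => u _; rewrite NcM mulrC ler_pM ?Nc_ge0 // phi_inf_le.
by rewrite -mulr_sumr ler_wpM2l // sum_tau_le.
Qed.

Let y_bound : exists2 B : R, 0 < B & forall u, Nc (y u) <= B.
Proof.
have [B B0 YB] := CA_bound CAY; exists (2 * B); first by rewrite mulr_gt0.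
by move=> u; apply: mean_norm => // w; rewrite NcM Nc_expi mul1r.
Qed.

Lemma CA_TT : CA (TT n E).
Proof.
have [B B0 yB] := y_bound.
rewrite (_ : TT n E = (fun w => csum (fun u => phi_inf phi (n.+1 + u) w * (complex.Re (y u))%:C))).
  apply: (CA_csum (M := fun u => B * tau (n.+1 + u))) => [u|u w|].
  - by apply: CAM; [exact: CA_phi_inf|exact: CA_cst].
  - by rewrite NcM -y_Re mulrC ler_pM ?Nc_ge0 // phi_inf_le.
  - by apply: is_cvg_seriesZ; exact: cvg_tau.
apply: funext => w; rewrite TT_series; congr csum; apply: funext => u.
by rewrite -y_Re.
Qed.

Lemma TT_coef (i : nat) :
  mean (fun w => expi (i%:Z%:~R * w) * TT n E w) =
  csum (fun u => (phi (n.+1 + i + u)%N)%:C * y u).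
Proof.
have [B B0 yB] := y_bound.
pose v u (w : R) := y u * (expi (i%:Z%:~R * w) * phi_inf phi (n.+1 + u) w).
have vM u w : Nc (v u w) <= B * tau (n.+1 + u).
  rewrite /v NcM [Nc (_ * phi_inf _ _ _)]NcM Nc_expi mul1r.
  by apply: ler_pM; [exact: Nc_ge0|exact: Nc_ge0|exact: yB|exact: phi_inf_le].
have cM : cvgn (series (fun u => B * tau (n.+1 + u))).
  by apply: is_cvg_seriesZ; exact: cvg_tau.
have cp u : ccont (fun w => expi (i%:Z%:~R * w) * phi_inf phi (n.+1 + u) w).
  by apply: ccontM; [exact: ccont_expi|apply: CA_ccont; exact: CA_phi_inf].
have cv u : ccont (v u) by apply: ccontZ.
transitivity (mean (fun w => csum (fun u => v u w))).
  congr mean; apply: funext => w; rewrite TT_series -csumZ; last exact: asum_TT yB.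
  by congr csum; apply: funext => u; rewrite /v; ring.
rewrite (mean_csum cv vM cM); congr csum; apply: funext => u.
by rewrite /v meanZ // phi_inf_coef // mulrC addnAC.
Qed.

Let Z w := expi (n.+1%:Z%:~R * w) * (Y w)^*.
Let cZ : ccont Z.
Proof. by apply: ccontM; [exact: ccont_expi|apply: ccont_conj; exact: CA_ccont]. Qed.
Let U w := phiw phi w * Z w + TT n E w.
Let cU : ccont U.
Proof.
by apply: ccontD; [apply: ccontM => //; exact: CA_ccont|apply: CA_ccont; exact: CA_TT].
Qed.
Let cvga := cvg_acoef cphi.

(** At frequency [- i], multiplication of [Z] by [phi] yields the sum of [acoef (n+1+i+u) * y u],
    where [acoef] is [- phi]; this is the opposite of the Hankel sum of [TT_coef]. *)
Lemma U_coef (i : nat) : mean (fun w => expi (i%:Z%:~R * w) * U w) = 0.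
Proof.
have [B B0 YB] := CA_bound CAY.
have [B' B0' yB] := y_bound.
have ZB w : Nc (Z w) <= B by rewrite NcM Nc_expi mul1r Nc_conj.
have cTT := CA_ccont CA_TT.
have ce : ccont (fun w : R => expi (i%:Z%:~R * w)) by exact: ccont_expi.
have cpZ : ccont (fun w => phiw phi w * Z w) by apply: ccontM => //; exact: CA_ccont.
transitivity (mean (fun w => expi (i%:Z%:~R * w) * (hser (acoef phi) w * Z w) +
                             expi (i%:Z%:~R * w) * TT n E w)).
  congr mean; apply: funext => w; rewrite /U mulrDr.
  by rewrite (phiw_acoef cphi).
rewrite meanD; [|apply: ccontM => //|exact: ccontM]; last first.
  by move: cpZ; under eq_fun do rewrite (phiw_acoef cphi).
rewrite TT_coef (mean_hser i cvga cZ ZB).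
have zE (m : nat) : mean (fun w => expi ((i%:Z - m%:Z)%:~R * w) * Z w) =
    (mean (fun w => expi ((m%:Z - (n.+1 + i)%N%:Z)%:~R * w) * Y w))^*.
  rewrite -mean_conj //; congr mean; apply: funext => w.
  rewrite conjM -expiN /Z mulrA -expiD; congr (expi _ * _).
  by rewrite -mulrDl -mulNr -intrD -mulrNz; congr (_%:~R * w); rewrite PoszD; ring.
(* Below [n+1+i] the terms involve coefficients of [Y] at negative indices, which vanish. *)
rewrite (csum_split (n.+1 + i)); last first.
  apply: (asumM (B := 2 * B) (asum_real cvga)) => m; apply: mean_norm => [|w].
    by apply: ccontM => //; exact: ccont_expi.
  by rewrite NcM Nc_expi mul1r.
rewrite big_nat_cond big1 ?add0r => [|m /andP[/andP[_ mi] _]]; last first.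
  by rewrite zE CA_coef_neg ?conjc0 ?mulr0 // subr_lt0 ltz_nat.
rewrite -csumD.
- rewrite -[RHS](@csum0 R); congr csum; apply: funext => u.
  rewrite zE PoszD addrAC subrr add0r -/(y u) y_real.
  by rewrite addSn /= rmorphN mulNr addNr.
- apply: (asumM (B := 2 * B) (u := fun u => (acoef phi (n.+1 + i + u))%:C)) => [|m].
    exact: asum_shift (asum_real cvga).
  apply: mean_norm => [|w].
    by apply: ccontM => //; exact: ccont_expi.
  by rewrite NcM Nc_expi mul1r.
- apply: (asumM (B := B') (u := fun u => (phi (n.+1 + i + u))%:C)) => //.
  by apply: asum_real; exact: cvg_tail.
Qed.

(* With [V = Y^- + X], [Y^-] the reversal of [Y] placed at frequencies [> n] and
   [X = TT E / phi], the product [phi V = U] has only positive frequencies, so that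
   [|E|^2 = |phi Y^-|^2 = |U|^2 + |TT E|^2] while [|U|^2 >= m^2 |V|^2 >= m^2 |Y|^2]. *)
Lemma TT_contract (m M : R) : 0 < m -> (forall w, m <= Nc (phiw phi w)) ->
  0 < M -> (forall w, Nc (phiw phi w) <= M) ->
  n2 (TT n E) <= (1 - m ^+ 2 / M ^+ 2) * n2 E.
Proof.
move=> m0 hm M0 hM.
have [B B0 YB] := CA_bound CAY.
have [BW BW0 WB] := CA_bound CA_TT.
have cTT := CA_ccont CA_TT.
have cYY := CA_ccont CAY.
have UB w : Nc (U w) <= M * B + BW.
  rewrite (le_trans (NcD _ _)) // lerD // NcM; apply: ler_pM; rewrite ?Nc_ge0 //.
  by rewrite NcM Nc_expi mul1r Nc_conj.
have eq1 : n2 E = n2 U + n2 (TT n E).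
  have h : mean (fun w => (TT n E w)^* * U w) = 0 by exact: CA_orth CA_TT cU UB U_coef.
  have h' : mean (fun w => (- TT n E w)^* * U w) = 0.
    transitivity (mean (fun w => -1 * ((TT n E w)^* * U w))).
      by congr mean; apply: funext => w; rewrite mulN1r conjN mulNr.
    by rewrite meanZ ?h ?mulr0 //; apply: ccontM => //; exact: ccont_conj.
  rewrite addrC -(n2N (TT n E)) -(n2D (ccontN cTT) cU h').
  apply: eq_n2 => w; rewrite addrC /U addrK NcM NcM Nc_expi mul1r Nc_conj.
  by rewrite -NcM /Y mulrA divff ?mul1r.
have cX : CA (fun w => (phiw phi w)^-1 * TT n E w) by exact: CAM CAphiV CA_TT.
pose V w := (phiw phi w)^-1 * TT n E w + Z w.
have cV : ccont V by apply: ccontD => //; exact: CA_ccont.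
have eqV : n2 V = n2 (fun w => (phiw phi w)^-1 * TT n E w) + n2 Z.
  apply: n2D => //; first exact: CA_ccont.
  (* With [X = TT E / phi], the integrand [conj(X) Z] is the conjugate of [expi (- (n+1) w)] times
     the causal product [X Y], so its mean is a coefficient at a negative index. *)
  transitivity (mean (fun w => (expi ((- n.+1%:Z)%:~R * w) *
      (((phiw phi w)^-1 * TT n E w) * Y w))^*)).
    congr mean; apply: funext => w.
    rewrite [in RHS]conjM -expiN -mulNr -mulrNz opprK [in RHS]conjM /Z.
    by rewrite mulrCA.
  have cXY := CAM cX CAY.
  rewrite mean_conj; last by apply: ccontM; [exact: ccont_expi|exact: CA_ccont].
  by rewrite CA_coef_neg ?conjc0 // oppr_lt0.
have h1 : n2 V <= m ^- 2 * n2 U.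
  apply: n2_le => // w; rewrite mulrC ler_pdivlMr ?exprn_gt0 //.
  have -> : U w = phiw phi w * V w by rewrite /U /V mulrDr [phiw _ _ * (_^-1 * _)]mulrA divff // mul1r addrC.
  by rewrite NcM exprMn mulrC ler_wpM2r ?sqr_ge0 // lerXn2r ?nnegrE ?Nc_ge0 // ltW.
have h2 : n2 Z = n2 Y by apply: eq_n2 => w; rewrite NcM Nc_expi mul1r Nc_conj.
have h3 : n2 E <= M ^+ 2 * n2 Y.
  apply: n2_le => [||w]; [exact: CA_ccont|exact: CA_ccont|].
  have -> : E w = phiw phi w * Y w by rewrite /Y mulrA divff // mul1r.
  by rewrite NcM exprMn ler_wpM2r ?sqr_ge0 // lerXn2r ?nnegrE ?Nc_ge0 // ltW.
have h4 : n2 Y <= m ^- 2 * n2 U.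
  by apply: le_trans h1; rewrite eqV h2 lerDr n2_ge0.
have h5 : m ^+ 2 / M ^+ 2 * n2 E <= n2 U.
  apply: (@le_trans _ _ (m ^+ 2 * n2 Y)).
    rewrite -mulrA ler_wpM2l ?sqr_ge0 // mulrC ler_pdivrMr ?exprn_gt0 //.
    by rewrite mulrC.
  by rewrite -ler_pdivlMl ?exprn_gt0.
by rewrite mulrBl mul1r; move: eq1 h5; move: (_ * n2 E) => x; lra.
Qed.

(** Bessel bounds every [y u] by the L^2 norm of [E / phi], and the absolute mass [D n] of the
    kernel does the rest. *)
Lemma TT_sup (m s : R) w : 0 < m -> (forall w, m <= Nc (phiw phi w)) -> 0 <= s ->
  n2 E <= s ^+ 2 -> Nc (TT n E w) <= s / m * D n.
Proof.
move=> m0 hm s0 hs; apply: TT_le => u; apply: y_sqr; first by rewrite divr_ge0 // ltW.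
apply: (@le_trans _ _ (m ^- 2 * n2 E)); last first.
  by rewrite expr_div_n mulrC ler_wpM2r // invr_ge0 sqr_ge0.
apply: n2_le => [||w']; [exact: CA_ccont|exact: CA_ccont|].
rewrite NcM exprMn NcV exprVn ler_wpM2r ?sqr_ge0 //.
rewrite lef_pV2 ?posrE ?exprn_gt0 ?Nc_gt0 // lerXn2r ?nnegrE ?Nc_ge0 //.
exact: ltW.
Qed.

End OneStep.

End PredictionOperator.

(** * The Neumann series and zeta *)

Section PredictionSeries.
Variables (R : realType) (phi : nat -> R).
Hypothesis cphi : cvgn (series (fun j => `|phi j.+1|)).
Hypothesis nz : forall z : R[i], `|z| <= 1 -> ar_series phi z != 0.
Variable (D : nat -> R).
Hypothesis hD : forall n N, \sum_(0 <= u < N) u.+1%:R * `|phi (n.+1 + u)%N| <= D n.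

Let phi0 w : phiw phi w != 0. Proof. exact: phiw_neq0. Qed.
Let CAphi : CA (phiw phi). Proof. exact: CA_phiw. Qed.
Let CAphiV : CA (fun w => (phiw phi w)^-1). Proof. exact: CA_phiw_inv. Qed.

Lemma ccont_TT_integrand n w (E : R -> R[i]) : CA E ->
  ccont (fun l => (phiw phi l)^-1 * Phi_n phi n w l * E l).
Proof.
move=> cE; apply: ccontM (CA_ccont cE); apply: ccontM (CA_ccont CAphiV) _.
exact: ccont_Phi_n hD _ _.
Qed.

Lemma TTB n (E F : R -> R[i]) w : CA E -> CA F ->
  TT phi n (fun w => E w - F w) w = TT phi n E w - TT phi n F w.
Proof.
move=> cE cF; rewrite /TT -meanB; [|exact: ccont_TT_integrand|exact: ccont_TT_integrand].
by congr mean; apply: funext => l; rewrite mulrBr.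
Qed.

Lemma TT_sum n (I : Type) (s : seq I) (E : I -> R -> R[i]) w : (forall i, CA (E i)) ->
  TT phi n (fun w => \sum_(i <- s) E i w) w = \sum_(i <- s) TT phi n (E i) w.
Proof.
move=> cE; rewrite /TT -mean_sum; last by move=> i; exact: ccont_TT_integrand.
by congr mean; apply: funext => l; rewrite mulr_sumr.
Qed.

Lemma TT_lip n (E : R -> R[i]) (m B : R) w : CA E -> 0 < m ->
  (forall w, m <= Nc (phiw phi w)) -> (forall w, Nc (E w) <= B) ->
  Nc (TT phi n E w) <= 2 / m * D n * B.
Proof.
move=> cE m0 hm EB; have -> : 2 / m * D n * B = 2 * (B / m) * D n by ring.
apply: (TT_le cphi nz hD n cE) => u; apply: mean_norm => [|l].
  by apply: ccontM; [exact: ccont_expi|apply: CA_ccont; exact: CAM].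
rewrite NcM Nc_expi mul1r NcM NcV mulrC ler_pM ?Nc_ge0 ?invr_ge0 ?Nc_ge0 //.
by rewrite lef_pV2 ?posrE ?Nc_gt0.
Qed.

(** The predictive functions as operator iterates, with order counted from 0: [Zs n s t] is [zeta]
    of order [s + 1]. *)
Fixpoint Zs (n s t : nat) : R -> R[i] :=
  if s is s'.+1 then TT phi n (Zs n s' (n.+1 - t)) else phi_inf phi t.

Lemma rev_range n t : (0 < t <= n)%N -> (0 < n.+1 - t <= n)%N.
Proof. by lia. Qed.

Lemma CA_Zs n s t : (0 < t <= n)%N -> CA (Zs n s t).
Proof.
elim: s t => [|s IH] t ht /=; first by apply: CA_phi_inf => //; case/andP: ht.
by apply: (CA_TT cphi nz hD); apply: IH; exact: rev_range.
Qed.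

Lemma cintE (F : R -> R[i]) : cint F = (2 * pi)%:C * mean F.
Proof.
rewrite /mean mulrA -rmorphM divff ?mul1r //.
by rewrite gt_eqF // twopi_gt0.
Qed.

(** The parity alternation in [g_zeta] is one reversal [t -> n+1-t] per order; the range of [t]
    makes the truncated subtraction an involution. *)
Lemma g_zeta_rev t n s (l : R) : (0 < t <= n)%N ->
  g_zeta phi t n s.+1 l = g_zeta phi (n.+1 - t) n s l.
Proof.
move=> ht; rewrite /g_zeta /= addn1; case: (odd s) => //=.
by congr (phi_inf phi _ l); lia.
Qed.

Lemma prod_chain (A : R -> R -> R[i]) w l ls s :
  \prod_(1 <= a < s.+2) A (nth 0 (w :: l :: ls) a.-1) (nth 0 (w :: l :: ls) a.+1.-1) =
  A w l * \prod_(1 <= a < s.+1) A (nth 0 (l :: ls) a.-1) (nth 0 (l :: ls) a.+1.-1).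
Proof.
rewrite big_ltn // big_add1 /=; congr (_ * _).
by rewrite big_nat_cond [RHS]big_nat_cond; apply: eq_bigr => -[|a].
Qed.

Definition zeta_integrand (t n s : nat) (w : R) (ls : seq R) : R[i] :=
  (\prod_(1 <= a < s.+1) (fun x y => (phiw phi y)^-1 * Phi_n phi n x y)
     (nth 0 (w :: ls) a.-1) (nth 0 (w :: ls) a.+1.-1))
  * g_zeta phi t n s.+1 (nth 0 (w :: ls) s.+1.-1).

Lemma zeta_integrandS t n s w l ls : (0 < t <= n)%N ->
  zeta_integrand t n s.+1 w (l :: ls) =
  (phiw phi l)^-1 * Phi_n phi n w l * zeta_integrand (n.+1 - t) n s l ls.
Proof.
move=> ht; rewrite /zeta_integrand (g_zeta_rev _ _ ht) mulrA; congr (_ * _).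
exact: (prod_chain (fun x y => (phiw phi y)^-1 * Phi_n phi n x y)).
Qed.

(** The constant [k] is there for the induction: it absorbs the kernel at the outermost variable,
    which is constant for the inner integrals. *)
Lemma cint_cube_zeta t n s (k : R[i]) w : (0 < t <= n)%N ->
  cint_cube s (fun ls => k * zeta_integrand t n s w ls) =
  k * ((2 * pi) ^+ s)%:C * Zs n s t w.
Proof.
elim: s t k w => [|s IH] t k w ht.
  by rewrite /= /zeta_integrand big_geq //= mul1r expr0 mulr1.
rewrite [LHS]/=.
under eq_fun do under eq_fun do rewrite zeta_integrandS // mulrA.
have ht' := rev_range ht.
under eq_fun do rewrite (IH _ _ _ ht').
rewrite cintE.
transitivity ((2 * pi)%:C * mean (fun l => (k * ((2 * pi) ^+ s)%:C) *
   ((phiw phi l)^-1 * Phi_n phi n w l * Zs n s (n.+1 - t) l))).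
  by congr (_ * mean _); apply: funext => l; rewrite -!mulrA; congr (_ * _); rewrite !mulrA; congr (_ * _); rewrite mulrC mulrA.
rewrite meanZ; last by apply: ccont_TT_integrand; exact: CA_Zs.
rewrite exprS rmorphM /= /TT; set x := mean _; ring.
Qed.

Lemma zeta_Zs t n s w : (0 < t <= n)%N -> zeta phi t n s.+1 w = Zs n s t w.
Proof.
move=> ht; rewrite /zeta /=.
have := cint_cube_zeta s 1 w ht.
under [X in cint_cube s X]eq_fun do rewrite mul1r.
rewrite mul1r => ->; rewrite mulrA -rmorphM mulVf ?mul1r //.
by rewrite expf_neq0 // gt_eqF // twopi_gt0.
Qed.

(** The bound is symmetrised in [t] and [n+1-t] so that the reversal at each order leaves it
    unchanged. *)
Lemma Zs_le n s t w (m : R) : (0 < t <= n)%N -> 0 < m ->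
  (forall w, m <= Nc (phiw phi w)) ->
  Nc (Zs n s t w) <= (2 / m * D n) ^+ s * (tau phi t + tau phi (n.+1 - t)).
Proof.
move=> ht m0 hm; elim: s t w ht => [|s IH] t w ht /=.
  have /andP[t0 _] := ht; have /andP[t0' _] := rev_range ht.
  rewrite expr0 mul1r (le_trans (phi_inf_le cphi _ t0)) // lerDl.
  exact: tau_ge0.
have ht' := rev_range ht.
rewrite exprS -mulrA; apply: TT_lip => // [|w']; first exact: CA_Zs.
have -> : tau phi t + tau phi (n.+1 - t) = tau phi (n.+1 - t) + tau phi (n.+1 - (n.+1 - t)).
  by rewrite addrC; congr (_ + tau phi _); lia.
exact: IH.
Qed.

(** Squared L^2 norms decay geometrically at a rate fixed by the bounds [m] and [M] of [|phi|],
    whatever the size of [D n]. One further application of the operator converts L^2 smallness into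
    pointwise smallness. *)
Lemma TT_iter_cvg0 n (E : nat -> nat -> R -> R[i]) :
  (forall m t, (0 < t <= n)%N -> CA (E m t)) ->
  (forall m t w, (0 < t <= n)%N -> E m.+1 t w = TT phi n (E m (n.+1 - t)%N) w) ->
  forall t w (e : R), (0 < t <= n)%N -> 0 < e ->
  exists m0, forall m, (m0 <= m)%N -> Nc (E m t w) <= e.
Proof.
move=> cE ES t w e ht e0.
have [m m0 hm] := phiw_lower cphi nz.
have [M M0 hM] := CA_bound CAphi.
pose q := 1 - m ^+ 2 / M ^+ 2.
have q1 : q < 1 by rewrite /q ltrBlDr ltrDl divr_gt0 ?exprn_gt0.
have q0 : 0 <= q.
  rewrite subr_ge0 ler_pdivrMr ?exprn_gt0 // mul1r lerXn2r ?nnegrE ?(ltW m0) ?(ltW M0) //.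
  exact: le_trans (hm 0) (hM 0).
have decay k t' : (0 < t' <= n)%N ->
    n2 (E k t') <= q ^+ k * (n2 (E 0 t') + n2 (E 0 (n.+1 - t')%N)).
  elim: k t' => [|k IH] t' ht'; first by rewrite expr0 mul1r lerDl n2_ge0.
  have hr := rev_range ht'.
  rewrite (_ : E k.+1 t' = TT phi n (E k (n.+1 - t')%N)); last first.
    by apply: funext => w'; exact: ES.
  apply: le_trans (TT_contract cphi nz hD n (cE k _ hr) m0 hm M0 hM) _.
  rewrite -/q (exprS q k) -mulrA ler_wpM2l //; apply: le_trans (IH _ hr) _.
  by rewrite addrC; have -> : (n.+1 - (n.+1 - t') = t')%N by lia.
have hr := rev_range ht.
set c := n2 (E 0 t) + n2 (E 0 (n.+1 - t)%N).
have c0 : 0 <= c by rewrite addr_ge0 // n2_ge0.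
have D0 : 0 <= D n by exact: D_ge0 hD n.
(* Chosen so that the bound [s / m * D n] of [TT_sup] is at most [e]; the added 1 covers
   [D n = 0]. *)
pose s := e * m / (D n + 1).
have s0 : 0 < s by rewrite divr_gt0 ?mulr_gt0 // ltr_wpDl.
have [k0 hk] : exists k0, forall k, (k0 <= k)%N -> q ^+ k * c <= s ^+ 2.
  have sc : 0 < s ^+ 2 / (c + 1) by rewrite divr_gt0 ?exprn_gt0 // ltr_wpDl.
  have /cvgrPdist_le /(_ _ sc) [N _ hN] : q ^+ n @[n --> \oo] --> (0 : R).
    by apply: cvg_expr; rewrite ger0_norm.
  exists N => k /hN /=; rewrite sub0r normrN ger0_norm ?exprn_ge0 // => h.
  apply: (@le_trans _ _ (q ^+ k * (c + 1))); first by rewrite ler_wpM2l ?exprn_ge0 // lerDl.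
  by rewrite -ler_pdivlMr // ltr_wpDl.
exists k0.+1 => -[//|k] kk; rewrite ES //.
have hs : n2 (E k (n.+1 - t)%N) <= s ^+ 2.
  apply: le_trans (decay _ _ hr) _; have -> : (n.+1 - (n.+1 - t) = t)%N by lia.
  by rewrite addrC; exact: hk.
apply: le_trans (TT_sup cphi nz hD n (cE _ _ hr) w m0 hm (ltW s0) hs) _.
have -> : s / m * D n = e * (D n / (D n + 1)).
  by rewrite /s; field; rewrite (gt_eqF m0) gt_eqF // ltr_wpDl.
by rewrite ler_piMr ?(ltW e0) // ler_pdivrMr ?mul1r ?lerDl // ltr_wpDl.
Qed.

Section FixedPoint.
Variables (n : nat) (L : nat -> R -> R[i]).
Hypothesis cL : forall t, (0 < t <= n)%N -> CA (L t).
Hypothesis LE : forall t w, (0 < t <= n)%N ->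
  L t w = phi_inf phi t w + TT phi n (L (n.+1 - t)%N) w.

Lemma zeta_series t w (e : R) : (0 < t <= n)%N -> 0 < e ->
  exists m0, forall m, (m0 <= m)%N ->
    Nc (L t w - \sum_(1 <= s < m.+1) zeta phi t n s w) <= e.
Proof.
move=> ht e0.
(* By the fixed point equation, each remainder is the operator applied to the preceding remainder at
   the reversed index. *)
pose E m t w := L t w - \sum_(0 <= s < m) Zs n s t w.
have [||m0 hm0] := @TT_iter_cvg0 n E _ _ t w e ht e0.
- by move=> m t' ht'; apply: CAB; [exact: cL|apply: CA_sum => s; exact: CA_Zs].
- move=> m t' w' ht'; have hr := rev_range ht'.
  rewrite /E TTB; [|exact: cL|by apply: CA_sum => s; exact: CA_Zs].
  rewrite TT_sum; last by move=> s; exact: CA_Zs.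
  by rewrite big_nat_recl // LE //= opprD addrACA subrr add0r.
exists m0 => m /hm0; rewrite /E big_add1 /=.
by under [X in _ -> Nc (_ - X) <= _]eq_bigr do rewrite zeta_Zs //.
Qed.

Lemma zeta_remainder t w (mu : R) m : (0 < t <= n)%N -> 0 < mu ->
  (forall w, mu <= Nc (phiw phi w)) -> 2 / mu * D n <= 2^-1 ->
  Nc (L t w - \sum_(1 <= s < m.+1) zeta phi t n s w) <=
  2 * (2 / mu * D n) ^+ m * (tau phi t + tau phi (n.+1 - t)).
Proof.
move=> ht mu0 hmu; set q := 2 / mu * D n; set c := tau phi t + _ => q12.
have q0 : 0 <= q by rewrite mulr_ge0 ?(D_ge0 hD) // divr_ge0 // ltW.
have /andP[t0 _] := ht; have /andP[t0' _] := rev_range ht.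
have c0 : 0 <= c by rewrite addr_ge0 // tau_ge0.
apply/ler_addgt0Pr => e e0; have [m0 h] := zeta_series w ht e0.
(* The series is cut again at an order where the error is below [e]; the [m0] terms between the two
   cuts are bounded geometrically. *)
pose N := (m + m0)%N.
have := h N (leq_addl _ _).
have split : \sum_(1 <= s < N.+1) zeta phi t n s w =
   \sum_(1 <= s < m.+1) zeta phi t n s w + \sum_(0 <= s < m0) Zs n (m + s) t w.
  have mN : (m.+1 <= N.+1)%N by rewrite ltnS leq_addr.
  rewrite (big_cat_nat (ltn0Sn m) mN) /=; congr (_ + _).
  rewrite big_add1 /= (big_shift_nat _ m m0).
  by apply: eq_bigr => s _; rewrite zeta_Zs.
rewrite split opprD addrA => hN.
set x := L t w - _ in hN *; set y := \sum_(0 <= s < m0) _ in hN.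
have hy : Nc y <= 2 * q ^+ m * c.
  rewrite (le_trans (Nc_sum _ _ _)) //.
  apply: (@le_trans _ _ (\sum_(0 <= s < m0) q ^+ m * c * q ^+ s)).
    apply: ler_sum => s _; rewrite (le_trans (Zs_le _ w ht mu0 hmu)) // exprD.
    by rewrite -/q -/c mulrAC.
  rewrite -mulr_sumr mulrC -!mulrA ler_wpM2r ?mulr_ge0 ?exprn_ge0 //.
  (* With [q <= 1/2] this gives a geometric sum of at most 2, the leading factor of the bound. *)
  have : (1 - q) * (\sum_(0 <= s < m0) q ^+ s) <= 1.
    rewrite big_mkord -opprB mulNr -subrX1 opprB gerBl exprn_ge0 //.
  have S0 : 0 <= \sum_(0 <= s < m0) q ^+ s by apply: sumr_ge0 => s _; rewrite exprn_ge0.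
  have := ler_wpM2r S0 q12; move: (\sum_(0 <= s < m0) _) => S h1 h2.
  by rewrite mulrBl mul1r in h2; lra.
have := NcD (x - y) y; rewrite subrK => hx.
by apply: le_trans hx _; rewrite addrC lerD.
Qed.

End FixedPoint.

End PredictionSeries.

(** * Normal equations *)

Section SecondOrder.
Context d (T : measurableType d) (R : realType) (P : probability T R).
Implicit Types Y Z : T -> R.

Definition ip Y Z : R := fine ('E_P[fun x => (Y x * Z x)%R])%E.

Lemma L2D Y Z : Y \in Lfun P 2%:E -> Z \in Lfun P 2%:E ->
  (fun x => Y x + Z x) \in Lfun P 2%:E.
Proof. by move=> hY hZ; rewrite -[X in X \in _]/(Y + Z) rpredD ?lee1n. Qed.

Lemma L2Z (a : R) Y : Y \in Lfun P 2%:E -> (fun x => a * Y x) \in Lfun P 2%:E.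
Proof.
move=> hY; under eq_fun do rewrite mulrC.
by apply: (@Lfun_scale _ _ _ _ Y a 2) => //; rewrite ler1n.
Qed.

Lemma L2_sum (I : Type) (s : seq I) (Y : I -> T -> R) :
  (forall i, Y i \in Lfun P 2%:E) -> (fun x => \sum_(i <- s) Y i x) \in Lfun P 2%:E.
Proof.
move=> hY; elim: s => [|i s IH].
  by under eq_fun do rewrite big_nil; exact: Lfun_cst.
by under eq_fun do rewrite big_cons; exact: L2D.
Qed.

Lemma L2M Y Z : Y \in Lfun P 2%:E -> Z \in Lfun P 2%:E ->
  (fun x => Y x * Z x) \in Lfun P 1.
Proof. exact: Lfun2_mul_Lfun1. Qed.

Lemma L2_L1 Y : Y \in Lfun P 2%:E -> Y \in Lfun P 1.
Proof. by apply: Lfun_subset12; exact: fin_num_measure. Qed.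

Lemma ipE Y Z : Y \in Lfun P 2%:E -> Z \in Lfun P 2%:E ->
  ('E_P[fun x => (Y x * Z x)%R] = (ip Y Z)%:E)%E.
Proof. by move=> hY hZ; rewrite /ip fineK // expectation_fin_num // L2M. Qed.

Lemma ipC Y Z : ip Y Z = ip Z Y.
Proof. by rewrite /ip; congr (fine (expectation P _)); apply: funext => x; rewrite mulrC. Qed.

Lemma ipDl Y Z V : Y \in Lfun P 2%:E -> Z \in Lfun P 2%:E -> V \in Lfun P 2%:E ->
  ip (fun x => Y x + Z x) V = ip Y V + ip Z V.
Proof.
move=> hY hZ hV; rewrite /ip -fineD ?expectation_fin_num ?L2M //.
rewrite -expectationD ?L2M //.
by congr (fine (expectation P _)); apply: funext => x; rewrite /= mulrDl.
Qed.

Lemma ipZl a Y Z : Y \in Lfun P 2%:E -> Z \in Lfun P 2%:E ->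
  ip (fun x => a * Y x) Z = a * ip Y Z.
Proof.
move=> hY hZ; rewrite /ip -[a * fine _]/(fine (a%:E) * fine _) -fineM ?expectation_fin_num ?L2M //.
rewrite -expectationZl ?L2M //.
by congr (fine (expectation P _)); apply: funext => x; rewrite /= -mulrA mulrC.
Qed.

Lemma ip_suml (I : Type) (s : seq I) (Y : I -> T -> R) Z :
  (forall i, Y i \in Lfun P 2%:E) -> Z \in Lfun P 2%:E ->
  ip (fun x => \sum_(i <- s) Y i x) Z = \sum_(i <- s) ip (Y i) Z.
Proof.
move=> hY hZ; elim: s => [|i s IH].
  rewrite big_nil /ip (_ : (fun x => _) = cst 0) ?expectation_cst //.
  by apply: funext => x; rewrite big_nil mul0r.
rewrite big_cons -IH -ipDl //; last exact: L2_sum.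
by congr ip; apply: funext => x; rewrite big_cons.
Qed.

Lemma ip_ge0 Y : 0 <= ip Y Y.
Proof. by rewrite /ip fine_ge0 // expectation_ge0 // => x; rewrite -expr2 sqr_ge0. Qed.

Lemma ip_orth_min Y Z : Y \in Lfun P 2%:E -> Z \in Lfun P 2%:E ->
  (forall e : R, ip Y Y <= ip (fun x => Y x + e * Z x) (fun x => Y x + e * Z x)) ->
  ip Y Z = 0.
Proof.
move=> hY hZ h; set p := ip Y Z; set q := ip Z Z.
have q0 : 0 <= q by exact: ip_ge0.
have E e : ip (fun x => Y x + e * Z x) (fun x => Y x + e * Z x) =
    ip Y Y + 2 * e * p + e ^+ 2 * q.
  have hZe := L2Z e hZ; have hs := L2D hY hZe.
  rewrite ipDl // ipZl // (ipC Y) (ipC Z) ipDl // ipZl // ipDl // ipZl //.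
  by rewrite (ipC Z Y) -/p -/q; ring.
have q1 : 0 < q + 1 by rewrite ltr_wpDl.
(* Using [q + 1] instead of [q] avoids division by zero when [Z] vanishes almost surely; the
   increment is still a strictly negative multiple of [p ^+ 2]. *)
have := h (- (p / (q + 1))); rewrite E -addrA lerDl.
have -> : 2 * - (p / (q + 1)) * p + (- (p / (q + 1))) ^+ 2 * q =
   - ((q + 2) * (q + 1) ^- 2) * p ^+ 2 by field; rewrite gt_eqF.
rewrite mulNr oppr_ge0 pmulr_rle0; last by rewrite mulr_gt0 ?invr_gt0 ?exprn_gt0 // ltr_wpDl.
by move=> hp; apply/eqP; rewrite -sqrf_eq0 eq_le hp sqr_ge0.
Qed.

Variables (X : int -> {RV P >-> R}) (c : int -> R).
Hypothesis st : zero_mean_stationary X c.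

Let XL2 t : (X t : T -> R) \in Lfun P 2%:E. Proof. by case: st. Qed.

Lemma ip_stationary t u : ip (X t) (X u) = c (u - t).
Proof.
case: st => _ E0 h.
have := h t (u - t); rewrite (addrC t) subrK covarianceE ?Lfun2_mul_Lfun1 ?L2_L1 //.
rewrite !E0 mule0 sube0 => hE.
by rewrite -[RHS]/(fine (c (u - t))%:E) -hE.
Qed.

Lemma stationary_even r : c (- r) = c r.
Proof.
rewrite -[- r]add0r -ip_stationary ipC ip_stationary; congr c.
by rewrite subr0.
Qed.

Lemma normal_equations n tau (a : nat -> R) u : best_linear_predictor X n tau a ->
  (0 < u <= n)%N ->
  \sum_(1 <= t < n.+1) a t * c (t%:Z - u%:Z) = c (tau - u%:Z).
Proof.
move=> best hu.
pose S (a : nat -> R) x := \sum_(1 <= t < n.+1) a t * X t%:Z x.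
have S2 a' : S a' \in Lfun P 2%:E by apply: L2_sum => t; exact: L2Z.
pose Y x := X tau x + -1 * S a x.
have Y2 : Y \in Lfun P 2%:E by apply: L2D => //; exact: L2Z.
have E0 : ip Y (X u%:Z) = 0.
  apply: ip_orth_min => // e.
  (* Perturbing only the coefficient of [X_u] adds [e * X_u] to the prediction error. *)
  pose a' t := a t + (- e) * (t == u)%:R.
  have SE x : S a' x = S a x + - e * X u%:Z x.
    rewrite /S /a'; under eq_bigr do rewrite mulrDl.
    rewrite big_split /=; congr (_ + _).
    rewrite (bigD1_seq u) /= ?mem_index_iota ?iota_uniq ?ltnS //.
    by rewrite eqxx mulr1 big1 ?addr0 // => t /negPf ->; rewrite mulr0 mul0r.
  have L2b := L2D Y2 (L2Z e (XL2 u%:Z)).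
  have := best a'.
  rewrite -lee_fin -!ipE //.
  rewrite (_ : (fun x => (_ - \sum_(1 <= t < n.+1) a t * _) ^+ 2) = (fun x => Y x * Y x)); last first.
    by apply: funext => x; rewrite -expr2 /Y mulN1r.
  rewrite (_ : (fun x => (_ - \sum_(1 <= t < n.+1) a' t * _) ^+ 2) =
    (fun x => (Y x + e * X u%:Z x) * (Y x + e * X u%:Z x))) //.
  by apply: funext => x; rewrite -expr2 -/(S a' x) SE /Y; congr (_ ^+ 2); ring.
move: E0; rewrite /Y ipDl ?ipZl //; last exact: L2Z.
rewrite ip_suml => [||//]; last by move=> t; exact: L2Z.
rewrite ip_stationary mulN1r => /eqP; rewrite subr_eq0 => /eqP h.
rewrite -stationary_even opprB h; apply: eq_bigr => t _.
by rewrite ipZl // ip_stationary -stationary_even opprB.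
Qed.

(** From [2 |x| <= 1 + x^2]; a first moment bound independent of [t] is all that the Markov step
    requires. *)
Lemma mean_abs_le t : ('E_P[fun x => `|X t x|%R] <= ((1 + c 0) / 2)%:E)%E.
Proof.
have c0 : ip (X t) (X t) = c 0 by rewrite ip_stationary subrr.
have hL : (fun x => 2^-1 * (1 + X t x * X t x)) \in Lfun P 1.
  have : (fun x => 1 + X t x * X t x) \in Lfun P 1.
    by rewrite -[X in X \in _]/(cst 1 + (fun x => X t x * X t x)) rpredD ?Lfun_cst ?L2M.
  move=> h; under eq_fun do rewrite mulrC.
  by apply: (@Lfun_scale _ _ _ _ _ 2^-1 1).
apply: (@le_trans _ _ ('E_P[fun x => (2^-1 * (1 + X t x * X t x))%R])%E).
  apply: expectation_le.
  - by apply: measurableT_comp => //.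
  - by case/andP: hL => /[!inE].
  - by move=> x; exact: normr_ge0.
  - by move=> x; rewrite mulr_ge0 ?invr_ge0 // addr_ge0 // -expr2 sqr_ge0.
  - apply/aeW => x /=; have := sqr_ge0 (`|X t x| - 1).
    by rewrite -expr2 -(real_normK (num_real (X t x))); move: (`|X t x|) => z; nra.
rewrite (_ : (fun x => _) = 2^-1 \o* (cst 1 \+ (fun x => X t x * X t x))); last first.
  by apply: funext => x; rewrite /= mulrC.
rewrite expectationZl; last first.
  by rewrite -[X in X \in _]/(cst 1 + (fun x => X t x * X t x)) rpredD ?Lfun_cst ?L2M.
rewrite expectationD ?Lfun_cst ?L2M // expectation_cst ipE // c0 -EFinD -EFinM lee_fin.
by rewrite mulrC.
Qed.

End SecondOrder.

(** * Backward recursion for the predictors *)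

Section ComplexEmbedding.
Variable R : realType.
Implicit Types x y : R.

Lemma rcM x y : (x * y)%:C = x%:C * y%:C :> R[i].
Proof. exact: rmorphM. Qed.

Lemma rcD x y : (x + y)%:C = x%:C + y%:C :> R[i].
Proof. exact: rmorphD. Qed.

Lemma rc_sum (I : Type) (s : seq I) (F : I -> R) :
  (\sum_(i <- s) F i)%:C = \sum_(i <- s) (F i)%:C :> R[i].
Proof. exact: rmorph_sum. Qed.

Lemma csum_sum_in (I : eqType) (s : seq I) (F : I -> nat -> R[i]) :
  {in s, forall i, asum (F i)} ->
  csum (fun j => \sum_(i <- s) F i j) = \sum_(i <- s) csum (F i).
Proof.
move=> aF; pose G i j := if i \in s then F i j else 0.
have aG i : asum (G i).
  rewrite /G; case: (boolP (i \in s)) => [/aF //|_].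
  by apply: (@asum_bound _ _ 0) => N; rewrite big1 // => j _; rewrite Nc0.
transitivity (csum (fun j => \sum_(i <- s) G i j)).
  congr csum; apply: funext => j; rewrite big_seq [RHS]big_seq.
  by apply: eq_bigr => i si; rewrite /G si.
rewrite csum_sum // big_seq [RHS]big_seq; apply: eq_bigr => i si.
by congr csum; apply: funext => j; rewrite /G si.
Qed.

End ComplexEmbedding.

Section NormalEquations.
Variables (R : realType) (f : R -> R) (c : int -> R) (phi : nat -> R) (sigma : R).
Hypothesis fE : fourier_expansion f c.
Hypothesis cfac : canonical_factorisation phi f sigma.
Hypothesis ceven : forall r, c (- r) = c r.
Variable C0 : R.
Hypothesis cC0 : forall N, \sum_(0 <= k < N) `|c k%:Z| <= C0.
Variable delta : R.
Hypothesis delta0 : 0 < delta.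
Hypothesis f_ge : forall w, delta <= f w.

Let cc : cvgn (series (fun k : nat => `|c k%:Z|)).
Proof. exact: (cvg_series_bound _ cC0). Qed.
Let cphi : cvgn (series (fun j => `|phi j.+1|)). Proof. by case: cfac. Qed.
Let nz : forall z : R[i], `|z| <= 1 -> ar_series phi z != 0. Proof. by case: cfac. Qed.
Let phi0 w : phiw phi w != 0. Proof. exact: phiw_neq0. Qed.

Definition normal_eqs (n : nat) (tau : int) (a : nat -> R) := forall u, (0 < u <= n)%N ->
  \sum_(1 <= t < n.+1) a t * c (t%:Z - u%:Z) = c (tau - u%:Z).

Lemma mean_quadratic (H : R -> R[i]) (s : seq nat) (x : nat -> R) : ccont H ->
  mean (fun w => H w * (Nc (\sum_(t <- s) (x t)%:C * expi (t%:Z%:~R * w)) ^+ 2)%:C) =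
  \sum_(t <- s) \sum_(u <- s)
     (x t * x u)%:C * mean (fun w => expi ((t%:Z - u%:Z)%:~R * w) * H w).
Proof.
move=> cH.
have ce (t u : nat) : ccont (fun w => (x t * x u)%:C * (expi ((t%:Z - u%:Z)%:~R * w) * H w)).
  by apply: ccontZ; apply: ccontM => //; exact: ccont_expi.
transitivity (mean (fun w => \sum_(t <- s) \sum_(u <- s)
    (x t * x u)%:C * (expi ((t%:Z - u%:Z)%:~R * w) * H w))).
  congr mean; apply: funext => w; rewrite -mul_conjE conj_sum mulrC mulr_suml mulr_suml.
  apply: eq_bigr => t _; rewrite mulr_sumr mulr_suml; apply: eq_bigr => u _.
  by rewrite conjM conjc_real -expiN intrB mulrBl expiD rmorphM; ring.
rewrite mean_sum; last by move=> t; apply: ccont_sum.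
apply: eq_bigr => t _; rewrite mean_sum //; apply: eq_bigr => u _.
by rewrite meanZ //; apply: ccontM => //; exact: ccont_expi.
Qed.

(** Both sides are means over the circle of [|V|^2], weighted by [delta] and by [f], for the
    trigonometric polynomial [V] with coefficients [x]. *)
Lemma quadratic_ge (n : nat) (x : nat -> R) :
  delta * (\sum_(1 <= t < n.+1) x t ^+ 2) <=
  \sum_(1 <= t < n.+1) \sum_(1 <= u < n.+1) x t * x u * c (t%:Z - u%:Z).
Proof.
set s := index_iota 1 n.+1.
pose V w : R[i] := \sum_(t <- s) (x t)%:C * expi (t%:Z%:~R * w).
have cV : ccont V by apply: ccont_sum => t; apply: ccontZ; exact: ccont_expi.
have cV2 := continuous_Nc2 cV.
have cf := ccont_f fE ceven cc.
have e1 : \sum_(t <- s) \sum_(u <- s) x t * x u * c (t%:Z - u%:Z) =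
    rmean (fun w => f w * Nc (V w) ^+ 2).
  apply: (@complexI R); rewrite -mean_real.
  transitivity (mean (fun w => (f w)%:C * (Nc (V w) ^+ 2)%:C)); last first.
    by congr mean; apply: funext => w; exact/esym/rmorphM.
  rewrite (mean_quadratic s x cf) rmorph_sum; apply: eq_bigr => t _.
  rewrite rmorph_sum; apply: eq_bigr => u _.
  by rewrite (f_coef fE ceven cc) rmorphM.
have e2 : \sum_(t <- s) x t ^+ 2 = rmean (fun w => Nc (V w) ^+ 2).
  apply: (@complexI R); rewrite -mean_real.
  transitivity (mean (fun w => 1 * (Nc (V w) ^+ 2)%:C)); last first.
    by congr mean; apply: funext => w; rewrite mul1r.
  rewrite (@mean_quadratic (fun=> 1) s x); last exact: ccont_cst.
  rewrite rmorph_sum big_seq_cond [RHS]big_seq_cond; apply: eq_bigr => t /andP[ts _].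
  rewrite (bigD1_seq t) //=; last exact: iota_uniq.
  rewrite big1 ?addr0.
    under eq_fun do rewrite mulr1; rewrite mean_expi subrr eqxx mulr1.
    by rewrite expr2.
  move=> u /negPf ut; under eq_fun do rewrite mulr1.
  by rewrite mean_expi subr_eq0 eqz_nat eq_sym ut mulr0.
rewrite e1 e2 -rmeanZ //; apply: rmean_le.
- by move=> w; apply: cvgM; [exact: cvg_cst|exact: cV2].
- by move=> w; apply: cvgM; [case: cf => + _; apply|exact: cV2].
- by move=> w; rewrite ler_wpM2r ?sqr_ge0.
Qed.

Lemma normal_eqs_quadratic n tau a : normal_eqs n tau a ->
  \sum_(1 <= t < n.+1) \sum_(1 <= u < n.+1) a t * a u * c (t%:Z - u%:Z) =
  \sum_(1 <= u < n.+1) a u * c (tau - u%:Z).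
Proof.
move=> h; rewrite exchange_big /= big_nat_cond [RHS]big_nat_cond.
apply: eq_bigr => u /andP[hu _]; rewrite -h // mulr_sumr.
by apply: eq_bigr => t _; ring.
Qed.

Lemma normal_eqs_uniq n tau a a' : normal_eqs n tau a -> normal_eqs n tau a' ->
  forall t, (0 < t <= n)%N -> a t = a' t.
Proof.
move=> h h' t ht; pose x t := a t - a' t.
have hx u : (0 < u <= n)%N -> \sum_(1 <= t < n.+1) x t * c (t%:Z - u%:Z) = 0.
  move=> hu; under eq_bigr do rewrite mulrBl.
  by rewrite sumrB h // h' // subrr.
have := quadratic_ge n x.
rewrite exchange_big /= [X in _ <= X](_ : _ = 0); last first.
  rewrite big_nat_cond big1 // => u /andP[hu _].
  under eq_bigr do rewrite mulrAC mulrC.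
  by rewrite -mulr_sumr hx // mulr0.
rewrite pmulr_rle0 // => hs.
have ts : t \in index_iota 1 n.+1 by rewrite mem_index_iota ltnS.
move: hs; rewrite (bigD1_seq t) //=; last exact: iota_uniq.
have S0 : 0 <= \sum_(i <- index_iota 1 n.+1 | i != t) x i ^+ 2.
  by apply: sumr_ge0 => i _; exact: sqr_ge0.
have := sqr_ge0 (x t) => x0 hs; have /eqP : x t ^+ 2 = 0 by lra.
by rewrite sqrf_eq0 subr_eq0 => /eqP.
Qed.

(** Coercivity gives [delta |a|^2 <= |a| Q] for the Euclidean norm, with [Q] the sum on the right.
    [Q] is summable over the targets [tau], which yields [sum_predictor_le]. *)
Lemma normal_eqs_bound n tau a t : normal_eqs n tau a -> (0 < t <= n)%N ->
  `|a t| <= delta^-1 * \sum_(1 <= u < n.+1) `|c (tau - u%:Z)|.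
Proof.
move=> h ht; have := quadratic_ge n a; rewrite (normal_eqs_quadratic h).
set B := \sum_(1 <= t < n.+1) a t ^+ 2; set Q := \sum_(1 <= u < n.+1) `|_| => hB.
have Q0 : 0 <= Q by exact: sumr_ge0.
have B0 : 0 <= B by apply: sumr_ge0 => i _; exact: sqr_ge0.
have aB u : (0 < u <= n)%N -> a u ^+ 2 <= B.
  move=> hu; have us : u \in index_iota 1 n.+1 by rewrite mem_index_iota ltnS.
  rewrite /B (bigD1_seq u) //=; last exact: iota_uniq.
  by rewrite lerDl sumr_ge0 // => i _; exact: sqr_ge0.
have aB' u : (0 < u <= n)%N -> `|a u| <= Num.sqrt B.
  by move=> /aB /ler_wsqrtr; rewrite sqrtr_sqr.
have hB' : delta * B <= Num.sqrt B * Q.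
  apply: le_trans hB _; rewrite /Q mulr_sumr big_nat_cond [leRHS]big_nat_cond.
  apply: ler_sum => u /andP[hu _]; rewrite (le_trans (ler_norm _)) // normrM.
  by rewrite ler_wpM2r // aB'.
apply: le_trans (aB' t ht) _.
have [->|sB] := eqVneq (Num.sqrt B) 0; first by rewrite mulr_ge0 // invr_ge0 ltW.
have sB0 : 0 < Num.sqrt B by rewrite lt_def sB sqrtr_ge0.
rewrite ler_pdivlMl // -(ler_pM2l sB0); move: hB'.
rewrite -{1}(sqr_sqrtr B0) expr2 => hB'.
by apply: le_trans hB'; rewrite mulrCA.
Qed.

Lemma normal_eqs_rev n tau a : normal_eqs n tau a ->
  normal_eqs n (n.+1%:Z - tau) (fun t => a (n.+1 - t)%N).
Proof.
move=> h u hu; have hu' : (0 < n.+1 - u <= n)%N by lia.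
rewrite big_nat_rev /= add1n.
have -> : c (n.+1%:Z - tau - u%:Z) = c (tau - (n.+1 - u)%N%:Z).
  by rewrite -ceven; congr c; lia.
rewrite -h // big_nat_cond [RHS]big_nat_cond; apply: eq_bigr => t /andP[ht _].
have -> : (n.+1 - (n.+2 - t.+1) = t)%N by lia.
by rewrite -ceven; congr (_ * c _); lia.
Qed.

(** * Recursion in the prediction target *)

Section BackwardRecursion.
Variables (n : nat) (b : int -> nat -> R).
Hypothesis bNE : forall tau : int, (tau <= 0) || (n%:Z < tau) -> normal_eqs n tau (b tau).

(** The autocovariance is even, so reversing time preserves the normal equations; uniqueness then
    identifies coefficients and reduces future targets to past ones. *)
Lemma predictor_reversal (j : nat) t : (0 < t <= n)%N ->
  b (n.+1 + j)%N%:Z t = b (- j%:Z) (n.+1 - t)%N.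
Proof.
move=> ht.
have h1 : normal_eqs n (n.+1 + j)%N%:Z (b (n.+1 + j)%N%:Z).
  by apply: bNE; apply/orP; right; lia.
have h2 : normal_eqs n (n.+1 + j)%N%:Z (fun t => b (- j%:Z) (n.+1 - t)%N).
  rewrite (_ : (n.+1 + j)%N%:Z = n.+1%:Z - (- j%:Z)); last by rewrite opprK PoszD.
  by apply: normal_eqs_rev; apply: bNE; apply/orP; left; lia.
exact: normal_eqs_uniq h1 h2 _ ht.
Qed.

Lemma sum_predictor_le t N : (0 < t <= n)%N ->
  \sum_(0 <= j < N) `|b (- j%:Z) t| <= delta^-1 * (n%:R * C0).
Proof.
move=> ht.
apply: (@le_trans _ _ (\sum_(0 <= j < N) delta^-1 * \sum_(1 <= u < n.+1) `|c (- j%:Z - u%:Z)|)).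
  apply: ler_sum => j _; apply: normal_eqs_bound => //.
  by apply: bNE; apply/orP; left; lia.
rewrite -mulr_sumr ler_wpM2l ?invr_ge0 ?(ltW delta0) // exchange_big /=.
apply: (@le_trans _ _ (\sum_(1 <= u < n.+1) C0)).
  apply: ler_sum => u _; apply: le_trans (cC0 (u + N)).
  rewrite (big_cat_nat (leq0n u) (leq_addr N u)) /= (big_shift_nat _ u N) -[leLHS]add0r.
  rewrite lerD ?sumr_ge0 //; apply: ler_sum => j _.
  by rewrite -ceven opprB opprK PoszD.
by rewrite sumr_const_nat subSS subn0 mulr_natl.
Qed.

Lemma cvg_predictor t : (0 < t <= n)%N -> cvgn (series (fun j : nat => `|b (- j%:Z) t|)).
Proof. by move=> ht; apply: (cvg_series_bound _ (fun N => sum_predictor_le N ht)). Qed.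

Definition predictor_series (t : nat) : R -> R[i] := hser (fun j : nat => b (- j%:Z) t).

Lemma CA_predictor_series t : (0 < t <= n)%N -> CA (predictor_series t).
Proof. by move=> ht; apply: CA_hser; exact: cvg_predictor. Qed.

Let bB t (u : nat) : (0 < t <= n)%N -> `|b (- u%:Z) t| <= delta^-1 * (n%:R * C0).
Proof.
move=> ht; apply: le_trans (sum_predictor_le u.+1 ht).
by rewrite big_nat_recr //= lerDr sumr_ge0.
Qed.

Let CB := delta^-1 * (n%:R * C0).

(* The contribution of the observations after time [n] to the predictor of [X_(-j)]. *)
Definition far (j t : nat) : R :=
  complex.Re (csum (fun u => (phi (n.+1 + j + u)%N * b (- u%:Z) (n.+1 - t)%N)%:C)).

Lemma yule_walker_phi (k : nat) : (0 < k)%N ->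
  (c k%:Z)%:C = csum (fun i : nat => (phi i.+1)%:C * (c (k%:Z - i.+1%:Z))%:C).
Proof.
move=> k0; have := yule_walker fE cfac ceven cc k0.
have cB (m : int) : Nc (c m)%:C <= C0.
  rewrite Nc_real; have -> : `|c m| = `|c `|m|%N%:Z| by case: m => m //; rewrite NegzE ceven.
  by apply: le_trans (cC0 `|m|%N.+1); rewrite big_nat_recr //= lerDr sumr_ge0.
rewrite (csum_split 1); last by apply: (asumM (asum_real (cvg_acoef cphi))).
rewrite big_nat1 subr0 mul1r => /eqP; rewrite addr_eq0 => /eqP ->.
rewrite -csumN; last first.
  apply: (@asumM _ (fun i => (acoef phi (1 + i))%:C) _ C0) => //.
  exact: asum_shift (asum_real (cvg_acoef cphi)).
by congr csum; apply: funext => i; rewrite add1n /= rmorphN mulNr opprK.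
Qed.

Let phi_tail (j : nat) : asum (fun u => (phi (n.+1 + j + u)%N)%:C).
Proof. by apply: asum_real; exact: cvg_tail. Qed.

Let asum_far j t : (0 < t <= n)%N ->
  asum (fun u => (phi (n.+1 + j + u)%N * b (- u%:Z) (n.+1 - t)%N)%:C).
Proof.
move=> ht; under eq_fun do rewrite rcM.
apply: (asumM (B := CB) (@phi_tail j)) => u.
by rewrite Nc_real; apply: bB; lia.
Qed.

Let farE j t : (0 < t <= n)%N -> (far j t)%:C =
  csum (fun u => (phi (n.+1 + j + u)%N * b (- u%:Z) (n.+1 - t)%N)%:C).
Proof.
move=> ht; have := csum_conj (@asum_far j t ht).
under [X in _ = csum X -> _]eq_fun do rewrite conjc_real.
rewrite /far; case: (csum _) => x y [/eqP]; rewrite eq_sym -addr_eq0 -mulr2n mulrn_eq0 /=.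
by move/eqP => ->.
Qed.

(** The recursion at target [- j], split by the position of [- j + i]: still in the past, among the
    observations (where the Kronecker symbol leaves [phi (j + t)]), or after time [n]. *)
Definition backward_rhs (j t : nat) : R :=
  \sum_(0 <= i < j) phi i.+1 * b (- (j - i.+1)%N%:Z) t + phi (j + t)%N + far j t.

(** Yule-Walker expands [c (j + u)] into terms [phi_i c (j + u - i)], each the right side of the
    normal equations for target [- j + i]. [T1], [T2] and [T3] treat past, observed and future
    targets, the last through time reversal. *)
Lemma backward_rhs_normal_eqs j : normal_eqs n (- j%:Z) (backward_rhs j).
Proof.
move=> u hu; apply: (@complexI R).
have cB (m : int) : Nc (c m)%:C <= C0.
  rewrite Nc_real; have -> : `|c m| = `|c `|m|%N%:Z| by case: m => m //; rewrite NegzE ceven.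
  by apply: le_trans (cC0 `|m|%N.+1); rewrite big_nat_recr //= lerDr sumr_ge0.
have -> : c (- j%:Z - u%:Z) = c (j + u)%N%:Z by rewrite -ceven opprB opprK addrC PoszD.
rewrite yule_walker_phi; last by lia.
rewrite (csum_split (j + n)); last first.
  apply: (@asumM _ (fun i => (phi i.+1)%:C) _ C0) => //.
  exact: (@asum_real _ (fun i => phi i.+1)).
have T1 : \sum_(1 <= t < n.+1) (\sum_(0 <= i < j) phi i.+1 * b (- (j - i.+1)%N%:Z) t) * c (t%:Z - u%:Z) =
    \sum_(0 <= i < j) phi i.+1 * c ((j + u)%N%:Z - i.+1%:Z).
  under eq_bigr do rewrite mulr_suml; rewrite exchange_big /=.
  rewrite big_nat_cond [RHS]big_nat_cond; apply: eq_bigr => i /andP[/andP[_ ij] _].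
  under eq_bigr do rewrite -mulrA; rewrite -mulr_sumr.
  rewrite (@bNE (- (j - i.+1)%N%:Z)) //; last by apply/orP; left; lia.
  by rewrite -ceven; congr (_ * c _); lia.
have T2 : \sum_(1 <= t < n.+1) phi (j + t)%N * c (t%:Z - u%:Z) =
    \sum_(j <= i < j + n) phi i.+1 * c ((j + u)%N%:Z - i.+1%:Z).
  rewrite (big_shift_nat _ j n) big_add1 /=; apply: eq_bigr => i _.
  by rewrite addnS -ceven; congr (_ * c _); lia.
have T3 : (\sum_(1 <= t < n.+1) far j t * c (t%:Z - u%:Z))%:C =
    csum (fun k => (phi (j + n + k).+1)%:C * (c ((j + u)%N%:Z - (j + n + k).+1%:Z))%:C).
  have E t : t \in index_iota 1 n.+1 -> (far j t * c (t%:Z - u%:Z))%:C =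
      csum (fun k => (c (t%:Z - u%:Z))%:C * (phi (n.+1 + j + k)%N * b (- k%:Z) (n.+1 - t)%N)%:C).
    rewrite mem_index_iota ltnS => ht.
    by rewrite csumZ ?rcM ?farE // 1?mulrC //; exact: asum_far.
  rewrite rc_sum big_seq (eq_bigr _ E) -big_seq -csum_sum_in; last first.
    by move=> t; rewrite mem_index_iota ltnS => ht; apply: asumZ; exact: asum_far.
  congr csum; apply: funext => k.
  have hk : normal_eqs n (n.+1%:Z - - k%:Z) (fun t => b (- k%:Z) (n.+1 - t)%N).
    by apply: normal_eqs_rev; apply: bNE; apply/orP; left; lia.
  transitivity ((phi (n.+1 + j + k)%N * \sum_(1 <= t < n.+1) b (- k%:Z) (n.+1 - t)%N * c (t%:Z - u%:Z))%:C).
    rewrite mulr_sumr rc_sum; apply: eq_bigr => t _.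
    by rewrite -rcM; congr (_%:C); ring.
  rewrite (hk u hu) rcM; congr (_%:C * _%:C); first by congr phi; lia.
  by rewrite -ceven; congr c; lia.
rewrite /backward_rhs; under eq_bigr do rewrite 2!mulrDl.
rewrite 2!big_split /= T1 T2 -(big_cat_nat (leq0n j) (leq_addr n j)) /= rcD T3.
by congr (_ + _); rewrite rc_sum; apply: eq_bigr => i _; rewrite rcM.
Qed.

Lemma predictor_recursion j t : (0 < t <= n)%N -> b (- j%:Z) t = backward_rhs j t.
Proof.
move=> ht; apply: (normal_eqs_uniq _ (@backward_rhs_normal_eqs j) ht).
by apply: bNE; apply/orP; left; lia.
Qed.

Variable (D : nat -> R).
Hypothesis hD : forall n N, \sum_(0 <= u < N) u.+1%:R * `|phi (n.+1 + u)%N| <= D n.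

Let CBge0 : 0 <= CB.
Proof. by rewrite !mulr_ge0 ?invr_ge0 ?(ltW delta0) //; have := cC0 0; rewrite big_geq. Qed.

Let CAphiL t : (0 < t <= n)%N -> CA (fun w => phiw phi w * predictor_series t w).
Proof. by move=> ht; apply: CAM; [exact: CA_phiw|exact: CA_predictor_series]. Qed.

Lemma TT_predictor_series t w : (0 < t <= n)%N ->
  TT phi n (fun w => phiw phi w * predictor_series t w) w =
  csum (fun u => phi_inf phi (n.+1 + u) w * (b (- u%:Z) t)%:C).
Proof.
move=> ht; rewrite (TT_series cphi nz hD n (CAphiL ht)); congr csum; apply: funext => u.
congr (_ * _); rewrite -(@hser_coef _ (fun j : nat => b (- j%:Z) t)); last exact: cvg_predictor.
by congr mean; apply: funext => l; rewrite [_^-1 * _]mulrA mulVf ?mul1r.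
Qed.

(** The index [n+1+j+u] is symmetric in [j] and [u]; summing over [j] first produces
    [phi_inf (n+1+u)]. *)
Lemma far_series t w : (0 < t <= n)%N ->
  csum (fun j => (far j t)%:C * expi (- (j%:R * w))) =
  csum (fun u => phi_inf phi (n.+1 + u) w * (b (- u%:Z) (n.+1 - t)%N)%:C).
Proof.
move=> ht; have ht' : (0 < n.+1 - t <= n)%N by lia.
pose x (j u : nat) := (phi (n.+1 + j + u)%N * b (- u%:Z) (n.+1 - t)%N)%:C * expi (- (j%:R * w)).
transitivity (csum (fun j => csum (x j))).
  congr csum; apply: funext => j; rewrite farE // mulrC -csumZ; last exact: asum_far.
  by congr csum; apply: funext => u; rewrite mulrC.
rewrite (@csum_swap _ x (fun j => CB * tau phi (n.+1 + j))); first last.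
- by apply: is_cvg_seriesZ; exact: (cvg_tau cphi hD).
- move=> j N; apply: (@le_trans _ _ (\sum_(0 <= u < N) CB * `|phi (n.+1 + j + u)%N|)).
    apply: ler_sum => u _; rewrite NcM Nc_expi mulr1 Nc_real normrM mulrC ler_wpM2r //.
    exact: bB.
  rewrite -mulr_sumr ler_wpM2l //; apply: le_psum_rsum => //.
  exact: cvg_tail.
congr csum; apply: funext => u; rewrite mulrC /phi_inf -csumZ; last first.
  by apply: (asum_hser (x := fun s => phi (n.+1 + u + s)%N)); exact: cvg_tail.
by congr csum; apply: funext => j; rewrite /x rcM addnAC; ring.
Qed.

Lemma convolution_series t w : (0 < t <= n)%N ->
  csum (fun j => (\sum_(0 <= i < j) phi i.+1 * b (- (j - i.+1)%N%:Z) t)%:C * expi (- (j%:R * w))) =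
  (1 - phiw phi w) * predictor_series t w.
Proof.
move=> ht.
(* The triangular array of the Cauchy product, padded with zeros so that [csum_swap] applies; row
   [i] is then the predictor series shifted by [i + 1]. *)
pose x (i j : nat) : R[i] :=
  if (i < j)%N then (phi i.+1 * b (- (j - i.+1)%N%:Z) t)%:C * expi (- (j%:R * w)) else 0.
have aL := @asum_hser _ _ w (cvg_predictor ht).
have xS i k : x i (i.+1 + k)%N =
    (phi i.+1)%:C * expi (- (i.+1%:R * w)) * ((b (- k%:Z) t)%:C * expi (- (k%:R * w))).
  rewrite /x leq_addr addKn natrD mulrDl opprD expiD rcM; ring.
have x0 i j : (j < i.+1)%N -> x i j = 0 by rewrite /x ltnS leqNgt => /negbTE ->.
have xM i N : \sum_(0 <= j < N) Nc (x i j) <= CB * `|phi i.+1|.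
  apply: (@le_trans _ _ (\sum_(0 <= j < i.+1 + N) Nc (x i j))).
    rewrite [leRHS](big_cat_nat (leq0n N) (leq_addl i.+1 N)) /= lerDl.
    by apply: sumr_ge0 => j _; exact: Nc_ge0.
  rewrite (big_cat_nat (leq0n i.+1) (leq_addr N i.+1)) /= (big_shift_nat _ i.+1 N).
  rewrite big_nat_cond big1 ?add0r => [|j /andP[/andP[_ ji] _]]; last by rewrite x0 ?Nc0.
  under eq_bigr do rewrite xS !NcM !Nc_expi !mulr1 !Nc_real.
  rewrite -mulr_sumr mulrC ler_wpM2r //; exact: sum_predictor_le.
transitivity (csum (fun j => csum (fun i => x i j))).
  congr csum; apply: funext => j; rewrite (@csum_finite _ _ j); last first.
    by move=> i ji; rewrite x0.
  rewrite rc_sum mulr_suml big_nat_cond [RHS]big_nat_cond.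
  by apply: eq_bigr => i /andP[/andP[_ ij] _]; rewrite /x ij.
rewrite -(csum_swap xM); last exact: is_cvg_seriesZ.
have row i : csum (x i) = predictor_series t w * ((phi i.+1)%:C * expi (- (i.+1%:R * w))).
  have ax : asum (x i) by exact: asum_bound (xM i).
  rewrite (csum_split i.+1 ax) big_nat_cond big1 ?add0r => [|j /andP[/andP[_ ji] _]]; last exact: x0.
  by rewrite mulrC /predictor_series /hser -csumZ //; congr csum; apply: funext => k; rewrite xS.
under eq_fun do rewrite row.
rewrite csumZ; last first.
  apply: (asumM (B := 1) (asum_real (x := fun i => phi i.+1) cphi)) => i.
  by rewrite Nc_expi.
by rewrite mulrC /phiw opprB addrCA subrr addr0.
Qed.

Lemma predictor_series_fixed_point t w : (0 < t <= n)%N ->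
  phiw phi w * predictor_series t w =
  phi_inf phi t w + TT phi n (fun w => phiw phi w * predictor_series (n.+1 - t)%N w) w.
Proof.
move=> ht; have ht' : (0 < n.+1 - t <= n)%N by lia.
rewrite TT_predictor_series // -far_series //.
have aL := @asum_hser _ _ w (cvg_predictor ht).
have aphi : asum (fun j => (phi (t + j)%N)%:C * expi (- (j%:R * w))).
  by apply: (asum_hser (x := fun j => phi (t + j)%N)); apply: cvg_tail => //; case/andP: ht.
have afar : asum (fun j => (far j t)%:C * expi (- (j%:R * w))).
  have ct : cvgn (series (fun j => CB * tau phi (n.+1 + j))).
    by apply: is_cvg_seriesZ; exact: (cvg_tau cphi hD).
  apply: (asumP _ ct) => j; rewrite NcM Nc_expi mulr1 farE //.
  apply: csum_le => [|N]; first exact: asum_far.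
  apply: (@le_trans _ _ (\sum_(0 <= u < N) CB * `|phi (n.+1 + j + u)%N|)).
    by apply: ler_sum => u _; rewrite Nc_real normrM mulrC ler_wpM2r // bB.
  rewrite -mulr_sumr ler_wpM2l //; apply: le_psum_rsum => //.
  exact: cvg_tail.
have := convolution_series w ht.
have -> : (fun j => (\sum_(0 <= i < j) phi i.+1 * b (- (j - i.+1)%N%:Z) t)%:C * expi (- (j%:R * w))) =
   (fun j => (b (- j%:Z) t)%:C * expi (- (j%:R * w)) +
     (-1 * ((phi (t + j)%N)%:C * expi (- (j%:R * w))) + -1 * ((far j t)%:C * expi (- (j%:R * w))))).
  apply: funext => j; rewrite (predictor_recursion j ht) /backward_rhs 2!rcD (addnC t) !mulN1r !mulrDl.
  by ring.
rewrite csumD //; last by apply: asumD; exact: asumZ.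
rewrite csumD; [|exact: asumZ|exact: asumZ].
rewrite !csumZ // -/(predictor_series t w) -/(phi_inf phi t w) => h.
have -> : phiw phi w * predictor_series t w = predictor_series t w - (1 - phiw phi w) * predictor_series t w by ring.
by rewrite -h; rewrite /predictor_series /hser; ring.
Qed.

End BackwardRecursion.

End NormalEquations.

(** * Remainders *)

Section Assembly.
Variables (R : realType) (f : R -> R) (c : int -> R) (phi : nat -> R) (sigma : R).
Hypothesis fE : fourier_expansion f c.
Hypothesis cfac : canonical_factorisation phi f sigma.
Hypothesis ceven : forall r, c (- r) = c r.
Variable C0 : R.
Hypothesis cC0 : forall N, \sum_(0 <= k < N) `|c k%:Z| <= C0.
Variable delta : R.
Hypothesis delta0 : 0 < delta.
Hypothesis f_ge : forall w, delta <= f w.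
Variable (D : nat -> R).
Hypothesis hD : forall n N, \sum_(0 <= u < N) u.+1%:R * `|phi (n.+1 + u)%N| <= D n.
Variables (n : nat) (b : nat -> int -> nat -> R).
Hypothesis bNE : forall tau : int, (tau <= 0) || (n%:Z < tau) -> normal_eqs c n tau (b n tau).

Let cphi : cvgn (series (fun j => `|phi j.+1|)). Proof. by case: cfac. Qed.
Let nz : forall z : R[i], `|z| <= 1 -> ar_series phi z != 0. Proof. by case: cfac. Qed.
Let phi0 w : phiw phi w != 0. Proof. exact: phiw_neq0. Qed.

Let L := predictor_series (b n).
Let PL t w := phiw phi w * L t w.
Let cvgb t : (0 < t <= n)%N -> cvgn (series (fun j : nat => `|b n (- j%:Z) t|)).
Proof. exact: (cvg_predictor fE ceven cC0 delta0 f_ge bNE). Qed.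
Let cPL t : (0 < t <= n)%N -> CA (PL t).
Proof. by move=> ht; apply: CAM; [exact: CA_phiw|apply: CA_hser; exact: cvgb]. Qed.
Let PLE t w : (0 < t <= n)%N -> PL t w = phi_inf phi t w + TT phi n (PL (n.+1 - t)%N) w.
Proof. exact: (predictor_series_fixed_point fE cfac ceven cC0 delta0 f_ge bNE hD). Qed.

(** The error at [t] after [m] orders, divided by [phi]. The errors of both [D_n] and [J_n] are
    linear in these quantities and their conjugates. *)
Definition kappa (m t : nat) (w : R) : R[i] :=
  (phiw phi w * predictor_series (b n) t w - \sum_(1 <= s < m.+1) zeta phi t n s w) / phiw phi w.

Let kappaE m t w : kappa m t w =
  L t w - (\sum_(1 <= s < m.+1) zeta phi t n s w) / phiw phi w.
Proof. by rewrite /kappa mulrBl mulrAC divff ?mul1r. Qed.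

Lemma kappa_cvg0 w (e : R) : 0 < e -> exists m0, forall m, (m0 <= m)%N ->
  forall t, (0 < t <= n)%N -> Nc (kappa m t w) <= e.
Proof.
move=> e0; have [mu mu0 hmu] := phiw_lower cphi nz.
have em : 0 < e * mu by rewrite mulr_gt0.
have /boolp.choice[g hg] : forall t, exists g, forall m, (g <= m)%N -> (0 < t <= n)%N ->
    Nc (PL t w - \sum_(1 <= s < m.+1) zeta phi t n s w) <= e * mu.
  move=> t; have [ht|ht] := boolP (0 < t <= n)%N; last by exists 0%N.
  have [m0 h] := zeta_series cphi nz hD cPL PLE w ht em.
  by exists m0 => m /h.
(* Only finitely many [t] occur, so one order serves them all. *)
exists (\max_(t < n.+1) g t)%N => m hm t ht.
rewrite NcM NcV ler_pdivrMr ?Nc_gt0 //.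
apply: le_trans (hg t m _ ht) _; last by rewrite ler_pM2l.
apply: leq_trans hm; have tn : (t < n.+1)%N by case/andP: ht.
exact: (leq_bigmax (Ordinal tn)).
Qed.

Lemma kappa_le mu m t w : 0 < mu -> (forall w, mu <= Nc (phiw phi w)) ->
  2 / mu * D n <= 2^-1 -> (0 < t <= n)%N ->
  Nc (kappa m t w) <= 2 / mu * (2 / mu * D n) ^+ m * (tau phi t + tau phi (n.+1 - t)).
Proof.
move=> mu0 hmu hq ht; rewrite NcM NcV.
have h := zeta_remainder cphi nz hD cPL PLE w m ht mu0 hmu hq.
have -> : 2 / mu * (2 / mu * D n) ^+ m * (tau phi t + tau phi (n.+1 - t)) =
   2 * (2 / mu * D n) ^+ m * (tau phi t + tau phi (n.+1 - t)) * mu^-1 by ring.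
by rewrite ler_pM ?Nc_ge0 ?invr_ge0 ?Nc_ge0 // lef_pV2 ?posrE ?Nc_gt0.
Qed.

Let asumL t w : (0 < t <= n)%N ->
  asum (fun j => (b n (- j%:Z) t)%:C * expi (- (j%:R * w))).
Proof. by move=> ht; apply: (asum_hser (x := fun j : nat => b n (- j%:Z) t)); exact: cvgb. Qed.

Let LconjE t w : (0 < t <= n)%N ->
  (L t w)^* = csum (fun j => (b n (- j%:Z) t)%:C * expi (j%:R * w)).
Proof.
move=> ht; rewrite /L /predictor_series /hser csum_conj; last exact: asumL.
by congr csum; apply: funext => j; rewrite conjM conjc_real -expiN opprK.
Qed.

Let asumLc t w : (0 < t <= n)%N ->
  asum (fun j => (b n (- j%:Z) t)%:C * expi (j%:R * w)).
Proof.
move=> ht; apply: (asumM (B := 1) (asum_real (cvgb ht))) => j.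
by rewrite Nc_expi.
Qed.

Lemma D_diff m (k t : 'I_n) :
  \sum_(1 <= s < m.+1) Ds_n phi n s k t - D_n b n k t =
  - (rsqrtn R n * (kappa m t.+1 (2 * pi * k.+1%:R / n%:R) + expi (2 * pi * k.+1%:R / n%:R) *
     (kappa m (n - t) (2 * pi * k.+1%:R / n%:R))^*)).
Proof.
have ht : (0 < t.+1 <= n)%N by rewrite ltn_ord.
have ht' : (0 < n - t <= n)%N by rewrite subn_gt0 ltn_ord leq_subr.
set w := 2 * pi * k.+1%:R / n%:R.
have -> : D_n b n k t = rsqrtn R n * csum (fun j =>
    (b n (- j%:Z) t.+1)%:C * expi ((- j%:Z)%:~R * w) +
    (b n (- j%:Z) (n + 1 - t.+1)%N)%:C * expi (- ((- j%:Z - 1)%:~R * w))) by rewrite mxE.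
have Ds s : Ds_n phi n s k t = rsqrtn R n * (zeta phi t.+1 n s w / phiw phi w) +
    rsqrtn R n * expi w * ((zeta phi (n + 1 - t.+1) n s w)^* / (phiw phi w)^*).
  by rewrite mxE.
under eq_bigr do rewrite Ds.
have E : (n + 1 - t.+1 = n - t)%N by rewrite addn1 subSS.
have -> : csum (fun j => (b n (- j%:Z) t.+1)%:C * expi ((- j%:Z)%:~R * w) +
    (b n (- j%:Z) (n + 1 - t.+1)%N)%:C * expi (- ((- j%:Z - 1)%:~R * w))) =
    L t.+1 w + expi w * (L (n - t) w)^*.
  rewrite E LconjE // -csumZ; last exact: asumLc.
  rewrite /L /predictor_series /hser -csumD; [|exact: asumL|by apply: asumZ; exact: asumLc].
  congr csum; apply: funext => j; congr (_ + _).
    by rewrite mulrNz mulNr.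
  rewrite [RHS]mulrCA -expiD; congr (_ * expi _).
  by rewrite -mulNr -mulrNz opprB opprK intrD mulrDl mul1r.
rewrite !kappaE [(L (n - t) w - _)^*]conjB conjM conj_sum E.
under eq_bigr do rewrite -mulrA -mulrDr.
rewrite -mulr_sumr big_split /= -mulr_suml -mulr_sumr -mulr_suml fmorphV.
by rewrite -/(L _ _); ring.
Qed.

Variables (T : Type) (X : int -> T -> R).

Lemma J_diff m w x :
  J_n b X n w x - \sum_(1 <= s < m.+1) Js_n phi X n s w x =
  rsqrtn R n * \sum_(1 <= t < n.+1) (X t%:Z x)%:C *
    (kappa m t w + expi (n.+1%:R * w) * (kappa m (n.+1 - t) w)^*).
Proof.
have range t : t \in index_iota 1 n.+1 -> (0 < t <= n)%N by rewrite mem_index_iota ltnS.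
have J1 : csum (fun j => (Xhat b X n (- j%:Z) x)%:C * expi ((- j%:Z)%:~R * w)) =
    \sum_(1 <= t < n.+1) (X t%:Z x)%:C * L t w.
  transitivity (csum (fun j => \sum_(1 <= t < n.+1)
     (X t%:Z x)%:C * ((b n (- j%:Z) t)%:C * expi (- (j%:R * w))))).
    congr csum; apply: funext => j; rewrite /Xhat rc_sum mulr_suml.
    by apply: eq_bigr => t _; rewrite rcM mulrNz mulNr; ring.
  rewrite csum_sum_in; last by move=> t /range ht; apply: asumZ; exact: asumL.
  by rewrite big_seq [RHS]big_seq; apply: eq_bigr => t /range ht; rewrite csumZ //; exact: asumL.
(* Target [n+1+j] is traded for [- j] by time reversal, turning the second half of the transform
   into conjugates of the series for the first. *)
have J2 : csum (fun j => (Xhat b X n (n + 1 + j)%N%:Z x)%:C * expi ((n + 1 + j)%N%:Z%:~R * w)) =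
    \sum_(1 <= t < n.+1) (X t%:Z x)%:C * (expi (n.+1%:R * w) * (L (n.+1 - t) w)^*).
  transitivity (csum (fun j => \sum_(1 <= t < n.+1)
     ((X t%:Z x)%:C * expi (n.+1%:R * w)) * ((b n (- j%:Z) (n.+1 - t)%N)%:C * expi (j%:R * w)))).
    congr csum; apply: funext => j; rewrite /Xhat rc_sum mulr_suml big_seq [RHS]big_seq.
    apply: eq_bigr => t /range ht; rewrite addn1.
    rewrite (predictor_reversal fE ceven cC0 delta0 f_ge bNE j ht) rcM.
    by rewrite -[(n.+1 + j)%N%:Z%:~R]/((n.+1 + j)%N%:R) natrD mulrDl expiD; ring.
  rewrite csum_sum_in; last first.
    by move=> t /range /rev_range ht; apply: asumZ; exact: asumLc.
  rewrite big_seq [RHS]big_seq; apply: eq_bigr => t /range /rev_range ht.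
  by rewrite csumZ ?LconjE ?mulrA //; exact: asumLc.
rewrite /J_n /Js_n J1 J2.
under [X in _ - X]eq_bigr => s _.
  rewrite (_ : \sum_(1 <= t < n.+1) (X (n + 1 - t)%N%:Z x)%:C * Num.conj (zeta phi t n s w) =
     \sum_(1 <= t < n.+1) (X t%:Z x)%:C * (zeta phi (n.+1 - t) n s w)^*); last first.
    rewrite big_nat_rev /= add1n big_seq [RHS]big_seq; apply: eq_bigr => t /range ht.
    by rewrite subSS; congr ((X _%:Z x)%:C * (zeta phi _ n s w)^*); lia.
  over.
rewrite big_split /= -!mulr_sumr.
rewrite -mulrDr -big_split /=.
rewrite (exchange_big _ _ _ _ _ (fun s t => (X t%:Z x)%:C * zeta phi t n s w)) /=.
rewrite (exchange_big _ _ _ _ _ (fun s t => (X t%:Z x)%:C * (zeta phi (n.+1 - t) n s w)^*)) /=.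
under [X in _ / _ * X]eq_bigr do rewrite -mulr_sumr.
rewrite [in X in _ - X]mulr_sumr [in X in _ - (_ + X)]mulr_sumr -[in X in _ - X]big_split /=.
rewrite !mulr_sumr -sumrB; apply: eq_bigr => t _.
rewrite !kappaE conjB conjM conj_sum fmorphV -mulr_sumr.
by rewrite Num_conjE /L; ring.
Qed.

End Assembly.

(** * Order in probability *)

Section Bounds.
Variable R : realType.

Lemma summable_weight (K : R) (c : int -> R) :
  summable [set: int] (fun r : int => ((`|r|%:~R `^ K) * c r)%:E) ->
  exists B, forall N, \sum_(0 <= k < N) (k%:R `^ K) * `|c k%:Z| <= B.
Proof.
move=> h.
exists (fine (\esum_(r in [set: int]) `|((`|r|%:~R `^ K) * c r)%:E|)%E) => N.
rewrite -lee_fin fineK; last by rewrite -summableE.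
apply: esum_ge; exists [set` [seq k%:Z | k <- index_iota 0 N]].
  by split => //; exact: finite_seq.
rewrite -fsbig_seq; last first.
  by rewrite map_inj_uniq ?iota_uniq // => i j [].
rewrite big_map sumEFin lee_fin; apply: ler_sum => k _.
by rewrite normrM (ger0_norm (powR_ge0 _ _)).
Qed.

(** The weight is at least 1 from [k = 1] on but is 0 at [k = 0], so [c 0] is added separately. *)
Lemma weight_bound (K : R) (c : int -> R) B : 1 < K ->
  (forall N, \sum_(0 <= k < N) (k%:R `^ K) * `|c k%:Z| <= B) ->
  forall N, \sum_(0 <= k < N) `|c k%:Z| <= `|c 0| + B.
Proof.
move=> K1 h [|N].
  by rewrite big_geq // addr_ge0 //; have := h 0; rewrite big_geq.
rewrite big_nat_recl // lerD2l; apply: le_trans (h N.+1).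
rewrite big_nat_recl // -[leLHS]add0r lerD ?mulr_ge0 ?powR_ge0 //.
apply: ler_sum => k _; rewrite ler_peMl //.
have one : 1 `^ K = 1 :> R by rewrite powR1.
rewrite -{1}one; apply: (ge0_ler_powR (ltW (lt_trans ltr01 K1))); by rewrite ?nnegrE ?ler1n.
Qed.

(** With [j = n+1+u], the weight satisfies [u + 1 <= j = j^(1-K) j^K], and [j >= max(n, 1)] bounds
    the first factor. The maximum matters at [n = 0], where the negative power of 0 would be 0 by
    convention and the bound could fail. *)
Lemma tail_weight (K BW : R) (phi : nat -> R) : 1 < K ->
  (forall N, \sum_(0 <= j < N) j%:R `^ K * `|acoef phi j| <= BW) ->
  forall n N, \sum_(0 <= u < N) u.+1%:R * `|phi (n.+1 + u)%N| <=
    (maxn n 1)%:R `^ (- (K - 1)) * BW.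
Proof.
move=> K1 h n N; set m := maxn n 1.
have m0 : (0 < m)%N by rewrite /m leq_max orbT.
apply: (@le_trans _ _ (\sum_(0 <= u < N)
   m%:R `^ (- (K - 1)) * ((n.+1 + u)%N%:R `^ K * `|acoef phi (n.+1 + u)|))).
  apply: ler_sum => u _; rewrite mulrA /= normrN ler_wpM2r //.
  set j := (n + u).+1.
  have j0 : 0 < (j%:R : R) by rewrite ltr0n.
  have mj : (m <= j)%N by rewrite /m /j geq_max; lia.
  apply: (@le_trans _ _ (j%:R `^ (- (K - 1)) * j%:R `^ K)).
    rewrite -powRD; last by apply/implyP => _; rewrite gt_eqF.
    by rewrite (_ : - (K - 1) + K = 1) ?powRr1 ?ler0n // ?ler_nat /j; [lia|ring].
  rewrite ler_wpM2r ?powR_ge0 // !powRN lef_pV2 ?posrE ?powR_gt0 ?ltr0n //.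
  by rewrite ge0_ler_powR ?nnegrE ?ler_nat // subr_ge0 ltW.
rewrite -mulr_sumr ler_wpM2l ?powR_ge0 //; apply: le_trans (h (n.+1 + N)%N).
rewrite (big_cat_nat (leq0n n.+1) (leq_addr N n.+1)) /= (big_shift_nat _ n.+1 N).
by rewrite lerDr sumr_ge0 // => j _; rewrite mulr_ge0 ?powR_ge0.
Qed.

End Bounds.

(** * Tail probabilities of linear combinations of the observations *)

Section Markov.
Context d (T : measurableType d) (R : realType) (P : probability T R).
Variables (X : int -> {RV P >-> R}) (c : int -> R).
Hypothesis st : zero_mean_stationary X c.

Lemma measurable_Nc_comb (s : seq nat) (A : nat -> R[i]) :
  measurable_fun setT (fun x => Nc (\sum_(t <- s) (X t%:Z x)%:C * A t)).
Proof.
have E (x : T) : Nc (\sum_(t <- s) (X t%:Z x)%:C * A t) =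
    Num.sqrt ((\sum_(t <- s) X t%:Z x * complex.Re (A t)) ^+ 2 +
              (\sum_(t <- s) X t%:Z x * complex.Im (A t)) ^+ 2).
  have -> : \sum_(t <- s) (X t%:Z x)%:C * A t =
     (\sum_(t <- s) X t%:Z x * complex.Re (A t)) +i* (\sum_(t <- s) X t%:Z x * complex.Im (A t)).
    elim: s => [|t s IH]; first by rewrite !big_nil.
    by rewrite !big_cons IH; case: (A t) => u v; simpc.
  by rewrite -[X in _ = Num.sqrt X](Nc_sqr (_ +i* _)) sqrtr_sqr ger0_norm ?Nc_ge0.
under eq_fun do rewrite E.
have mlin (B : nat -> R) : measurable_fun setT (fun x => \sum_(t <- s) X t%:Z x * B t).
  apply: measurable_sum => t.
  by apply: measurable_funM; [exact: measurable_funP|exact: measurable_cst].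
apply: measurableT_comp.
  by apply: continuous_measurable_fun; exact: sqrt_continuous.
by apply: measurable_funD; apply: measurable_funX.
Qed.

Lemma mean_comb_le (s : seq nat) (B : nat -> R) : (forall t, 0 <= B t) ->
  (fun x => \sum_(t <- s) `|X t%:Z x| * B t) \in Lfun P 1 /\
  ('E_P[fun x => (\sum_(t <- s) `|X t%:Z x| * B t)%R] <=
    ((\sum_(t <- s) B t) * ((1 + c 0) / 2))%:E)%E.
Proof.
move=> B0.
have XL t : (fun x => `|X t x|) \in Lfun P 1.
  by apply: (@Lfun_norm _ _ _ _ (X t)); apply: L2_L1; case: st.
have XB t : (fun x => `|X t%:Z x| * B t) \in Lfun P 1.
  by apply: (@Lfun_scale _ _ _ _ (fun x => `|X t%:Z x|) (B t) 1).
elim: s => [|t s [IH1 IH2]].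
  under eq_fun do rewrite big_nil; rewrite big_nil mul0r; split; first exact: Lfun_cst.
  by rewrite (expectation_cst P 0).
under eq_fun do rewrite big_cons; split.
  by rewrite -[X in X \in _]/((fun x => `|X t%:Z x| * B t) +
     (fun x => \sum_(t <- s) `|X t%:Z x| * B t)) rpredD.
rewrite -[X in (expectation _ X <= _)%E]/((fun x => `|X t%:Z x| * B t) \+
     (fun x => \sum_(t <- s) `|X t%:Z x| * B t)).
rewrite expectationD // big_cons mulrDl EFinD leeD //.
rewrite -[X in (expectation _ X <= _)%E]/(B t \o* (fun x => `|X t%:Z x|)).
rewrite expectationZl // EFinM lee_wpmul2l ?lee_fin //.
exact: mean_abs_le st t.
Qed.

Lemma prob_comb_le (s : seq nat) (A : nat -> R[i]) (r : R) : 0 < r ->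
  (P [set x | (r%:C < `|\sum_(t <- s) (X t%:Z x)%:C * A t|)%R] <=
    ((\sum_(t <- s) Nc (A t)) * ((1 + c 0) / 2) / r)%:E)%E.
Proof.
move=> r0; set Z := fun x => \sum_(t <- s) (X t%:Z x)%:C * A t.
have mZ : measurable_fun setT (fun x => Nc (Z x)) by exact: measurable_Nc_comb.
pose Y : {RV P >-> R} := mfun_Sub (mem_set mZ).
have YE x : Y x = Nc (Z x) by [].
have [hL hE] := mean_comb_le s (fun t => Nc_ge0 (A t)).
have := @markov _ _ _ P Y id r r0 (@measurable_id _ _ _) (fun _ h => h) (fun _ _ _ _ h => h).
rewrite (_ : id \o _ \o Y = (fun x => Nc (Z x))); last first.
  by apply: funext => x; exact: ger0_norm (Nc_ge0 (Z x)).
move=> hM.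
have hY : ('E_P[fun x => Nc (Z x)] <= ((\sum_(t <- s) Nc (A t)) * ((1 + c 0) / 2))%:E)%E.
  apply: le_trans hE; apply: expectation_le => //.
  - by case/andP: hL => /[!inE].
  - by move=> x; exact: Nc_ge0.
  - by move=> x; apply: sumr_ge0 => t _; rewrite mulr_ge0 ?Nc_ge0.
  - apply: aeW => x; rewrite (le_trans (Nc_sum _ _ _)) //.
    by apply: ler_sum => t _; rewrite NcM Nc_real.
have := le_trans hM hY => {}hM.
rewrite [X in (_ <= X)%E](_ : _ = (r^-1)%:E * ((\sum_(t <- s) Nc (A t)) * ((1 + c 0) / 2))%:E)%E; last first.
  by rewrite -EFinM mulrC.
rewrite lee_pdivlMl //; apply: le_trans hM.
rewrite lee_wpmul2l ?lee_fin ?(ltW r0) //.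
apply: le_measure; rewrite ?inE.
- rewrite (_ : [set x | _] = (fun x => Nc (Z x)) @^-1` `]r, +oo[%classic); last first.
    by apply/seteqP; split => x /=; rewrite -NcE ltcR in_itv /= andbT.
  by rewrite -[X in measurable X]setTI; exact: (measurable_Nc_comb s A measurableT (measurable_itv _)).
- rewrite (_ : [set x | _] = (fun x => Nc (Z x)) @^-1` `[r, +oo[%classic); last first.
    by apply/seteqP; split => x /=; rewrite ?YE lee_fin (ger0_norm (Nc_ge0 (Z x))) in_itv /= andbT.
  by rewrite -[X in measurable X]setTI; exact: (measurable_Nc_comb s A measurableT (measurable_itv _)).
- move=> x /=; rewrite -NcE ltcR => h.
  by rewrite ?YE lee_fin (ger0_norm (Nc_ge0 (Z x))) ltW.
Qed.

End Markov.

Theorem theorem3p3 (R : realType) (K : R) (f : R -> R) (c : int -> R)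
    (sigma : R) (phi : nat -> R)
    (d : measure_display) (T : measurableType d) (P : probability T R)
    (X : int -> {RV P >-> R}) (b : nat -> int -> nat -> R) :
  1 < K ->
  (forall w, f (2 * pi - w) = f w) ->
  fourier_expansion f c ->
  (exists2 delta : R, 0 < delta & forall w, delta <= f w) ->
  summable [set: int] (fun r : int => ((`|r|%:~R `^ K) * c r)%:E) ->
  canonical_factorisation phi f sigma ->
  zero_mean_stationary X c ->
  (forall (n : nat) (tau : int), (0 < n)%N -> (tau <= 0) || (n%:Z < tau) ->
     best_linear_predictor X n tau (b n tau)) ->
  [/\ forall (n : nat) (w : R) (x : T), (0 < n)%N ->
        csum_to (fun s => Js_n phi X n s w x) (J_n b X n w x),
      forall (n : nat) (k t : 'I_n), (0 < n)%N ->
        csum_to (fun s => Ds_n phi n s k t) (D_n b n k t)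
    & forall (w : R) (m : nat), (1 <= m)%N ->
        is_Op P
          (fun n x => J_n b X n w x - \sum_(1 <= s < m.+1) Js_n phi X n s w x)
          (fun n => n%:R `^ (- (m%:R * (K - 1) + 1 / 2)))].
Proof.
move=> K1 _ fE [delta delta0 f_ge] sK cfac st best.
have ceven := stationary_even st.
have [CK cCK] := summable_weight sK.
have cC0 := weight_bound K1 cCK.
have [BW hBW] := weighted_acoef fE cfac ceven K1 cC0 cCK.
pose D n := (maxn n 1)%:R `^ (- (K - 1)) * BW.
have hD n N : \sum_(0 <= u < N) u.+1%:R * `|phi (n.+1 + u)%N| <= D n.
  exact: tail_weight K1 hBW n N.
have cphi : cvgn (series (fun j => `|phi j.+1|)) by case: cfac.
have nz : forall z : R[i], `|z| <= 1 -> ar_series phi z != 0 by case: cfac.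
have bNE n : (0 < n)%N -> forall tau : int, (tau <= 0) || (n%:Z < tau) ->
    normal_eqs c n tau (b n tau).
  move=> n0 tau ht u hu; have h := normal_equations st (best n tau n0 ht) hu.
  exact: h.
have kcvg n w (n0 : (0 < n)%N) := kappa_cvg0 fE cfac ceven cC0 delta0 f_ge hD (bNE n n0) w.
have Jd n w x (n0 : (0 < n)%N) m := J_diff fE cfac ceven cC0 delta0 f_ge (bNE n n0) X m w x.
split.
- move=> n w x n0; apply/cvgC_epsP => e e0.
  (* Convergence is pointwise in [x]; the 2 counts the two [kappa] terms attached to each
     observation. *)
  pose B := Nc (rsqrtn R n) * (\sum_(1 <= t < n.+1) 2 * `|X t%:Z x|) + 1.
  have B0 : 0 < B.
    by rewrite ltr_wpDl // mulr_ge0 ?Nc_ge0 // sumr_ge0 // => t _; rewrite mulr_ge0.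
  have [m0 hm] := kcvg n w n0 _ (divr_gt0 e0 B0).
  exists m0 => m /hm {}hm; rewrite NcB Jd // NcM.
  apply: (@le_trans _ _ (Nc (rsqrtn R n) * \sum_(1 <= t < n.+1) (2 * `|X t%:Z x| * (e / B)))).
    rewrite ler_wpM2l ?Nc_ge0 // (le_trans (Nc_sum _ _ _)) // big_nat_cond [leRHS]big_nat_cond.
    apply: ler_sum => t /andP[ht _]; rewrite ltnS in ht.
    rewrite NcM Nc_real -mulrA mulrCA ler_wpM2l // (le_trans (NcD _ _)) //.
    rewrite [Nc (expi _ * _)]NcM Nc_expi mul1r Nc_conj mulr2n mulrDl mul1r.
    by rewrite lerD // hm // rev_range.
  rewrite -mulr_suml mulrA mulrCA ger_pMr // ler_pdivrMr // mul1r.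
  by rewrite lerDl.
- move=> n k t n0; apply/cvgC_epsP => e e0.
  pose B := Nc (rsqrtn R n) * 2 + 1.
  have B0 : 0 < B by rewrite ltr_wpDl // mulr_ge0 ?Nc_ge0.
  have [m0 hm] := kcvg n (2 * pi * k.+1%:R / n%:R) n0 _ (divr_gt0 e0 B0).
  exists m0 => m /hm {}hm.
  rewrite (D_diff fE cfac ceven cC0 delta0 f_ge (bNE n n0)) NcN NcM.
  set w := 2 * pi * _ / _ in hm *.
  apply: (@le_trans _ _ (Nc (rsqrtn R n) * (2 * (e / B)))).
    rewrite ler_wpM2l ?Nc_ge0 // (le_trans (NcD _ _)) //.
    rewrite [Nc (expi _ * _)]NcM Nc_expi mul1r Nc_conj mulr2n mulrDl mul1r.
    apply: lerD; apply: hm; first by rewrite ltn_ord.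
    by rewrite subn_gt0 ltn_ord leq_subr.
  rewrite mulrA mulrCA ger_pMr // ler_pdivrMr // mul1r.
  by rewrite lerDl.
move=> w m m1 e e0.
have [mu mu0 hmu] := phiw_lower cphi nz.
have BW0 : 0 <= BW by have := hBW 0; rewrite big_geq.
have c00 : 0 <= c 0 by have := ip_ge0 P (X 0); rewrite (ip_stationary st) subrr.
(* In order: two [kappa] terms per observation, their bound from [kappa_le] with the powers of [n]
   removed, the two sums of [tau] over [t], and the first moment bound. *)
pose C1 := 2 * (2 / mu * (2 / mu * BW) ^+ m) * (2 * D 0) * ((1 + c 0) / 2).
have D00 : 0 <= D 0 by rewrite mulr_ge0 ?powR_ge0.
have C10 : 0 <= C1.
  by rewrite !mulr_ge0 ?exprn_ge0 ?invr_ge0 ?(ltW mu0) ?addr_ge0 ?mulr_ge0 ?invr_ge0 ?(ltW mu0).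
(* Markov bounds the probability by [C1 * an / (M * an)]; the added 1 keeps [M] positive when
   [C1 = 0]. *)
exists ((C1 + 1) / e); split; first by rewrite divr_gt0 // ltr_wpDl.
have Dn n : (0 < n)%N -> D n = n%:R `^ (- (K - 1)) * BW.
  by move=> n0; rewrite /D (maxn_idPl n0).
(* This is where [n] must be large: beyond [n1] the sup-norm ratio is at most 1/2 and the geometric
   remainder bound is available. *)
have [n1 hn1] : exists n1, forall n, (n1 <= n)%N -> 2 / mu * D n <= 2^-1.
  have K10 : 0 < K - 1 by rewrite subr_gt0.
  pose y := 4 * BW / mu + 1.
  have y0 : 0 <= y by rewrite addr_ge0 // divr_ge0 ?mulr_ge0 // ltW.
  exists (Num.truncn (y `^ (K - 1)^-1)).+1 => n hn.
  have n0 : (0 < n)%N by exact: leq_trans hn.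
  have hy : y <= n%:R `^ (K - 1).
    have yE : y = (y `^ (K - 1)^-1) `^ (K - 1) by rewrite -powRrM mulVf ?powRr1 ?gt_eqF.
    rewrite {1}yE.
    apply: (ge0_ler_powR (ltW K10)); rewrite ?nnegrE ?powR_ge0 ?ler0n //.
    by apply: le_trans (ltW (truncnS_gt _)) _; rewrite ler_nat.
  have np : 0 < n%:R `^ (K - 1) by rewrite powR_gt0 // ltr0n.
  rewrite Dn // powRN mulrCA mulrC ler_pdivrMr //.
  have : 4 * BW / mu <= n%:R `^ (K - 1) by apply: le_trans hy; rewrite /y lerDl.
  have -> : 2 / mu * BW = 2^-1 * (4 * BW / mu) by field; rewrite gt_eqF.
  by rewrite ler_pM2l ?invr_gt0.
exists n1.+1 => // n /= hn.
have n0 : (0 < n)%N by exact: leq_trans hn.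
have hq := hn1 n (ltnW hn).
set an := n%:R `^ _.
have an0 : 0 < an by rewrite powR_gt0 // ltr0n.
rewrite (_ : [set x | _] = [set x | ((((C1 + 1) / e * an)%:C <
   `|\sum_(1 <= t < n.+1) (X t%:Z x)%:C * (rsqrtn R n *
    (kappa phi n b m t w + expi (n.+1%:R * w) * (kappa phi n b m (n.+1 - t) w)^*))|)%R)]); last first.
  apply/seteqP; split => x /=; rewrite Jd // mulr_sumr.
    by under eq_bigr do rewrite mulrCA.
  by under [X in _ -> (_ < `|X|)%R]eq_bigr do rewrite mulrCA.
have r0 : 0 < (C1 + 1) / e * an by rewrite mulr_gt0 // divr_gt0 // ltr_wpDl.
apply: le_trans (prob_comb_le st _ _ r0) _; rewrite lee_fin.
have nR : 0 < n%:R :> R by rewrite ltr0n.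
have key : \sum_(1 <= t < n.+1) Nc (rsqrtn R n * (kappa phi n b m t w +
    expi (n.+1%:R * w) * (kappa phi n b m (n.+1 - t) w)^*)) <=
    2 * (2 / mu * (2 / mu * BW) ^+ m) * (2 * D 0) * an.
  set Q := 2 / mu * (2 / mu * D n) ^+ m.
  apply: (@le_trans _ _ (\sum_(1 <= t < n.+1) (Num.sqrt n%:R)^-1 *
     (2 * Q) * (tau phi t + tau phi (n.+1 - t)))).
    rewrite big_nat_cond [leRHS]big_nat_cond; apply: ler_sum => t /andP[ht _].
    rewrite ltnS in ht; have hr := rev_range ht.
    rewrite NcM /rsqrtn Nc_real ger0_norm ?invr_ge0 ?sqrtr_ge0 // -mulrA.
    rewrite ler_wpM2l ?invr_ge0 ?sqrtr_ge0 // (le_trans (NcD _ _)) //.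
    rewrite [Nc (expi _ * _)]NcM Nc_expi mul1r Nc_conj.
    have k1 := kappa_le fE cfac ceven cC0 delta0 f_ge hD (bNE n n0) m w mu0 hmu hq ht.
    have := kappa_le fE cfac ceven cC0 delta0 f_ge hD (bNE n n0) m w mu0 hmu hq hr.
    have -> : (n.+1 - (n.+1 - t) = t)%N by rewrite subKn //; case/andP: ht => _ /leqW.
    move: k1; rewrite -/Q (addrC (tau phi (n.+1 - t))); set z := tau phi t + _.
    by move=> k1 k2; rewrite -mulrA mulr2n mulrDl mul1r lerD.
  (* The bound is uniform in [n], so summing the errors over all observations costs no power of
     [n]. *)
  have tauD : \sum_(1 <= t < n.+1) tau phi t <= D 0.
    have := sum_tau_le cphi hD 0 n.
    by rewrite [in X in _ -> X <= _]big_add1.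
  rewrite -mulr_sumr big_split /= [X in _ + X]big_nat_rev /= add1n.
  have -> : \sum_(1 <= i < n.+1) tau phi (n.+1 - (n.+2 - i.+1)) = \sum_(1 <= i < n.+1) tau phi i.
    rewrite big_nat_cond [RHS]big_nat_cond; apply: eq_bigr => i /andP[hi _].
    by rewrite subSS subKn //; case/andP: hi => _ /ltnW.
  (* The rate factors into the normalisation [n^(-1/2)] and one power [n^(-(K-1))] for each of the
     [m] orders removed. *)
  have -> : an = (Num.sqrt n%:R)^-1 * (n%:R `^ (- (K - 1))) ^+ m.
    rewrite -powR_mulrn ?powR_ge0 // -powRrM -powR12_sqrt ?ler0n // -powRN -powRD.
      by rewrite /an; congr (_ `^ _); field.
    by apply/implyP => _; rewrite gt_eqF.
  rewrite /Q Dn //; set s := (Num.sqrt _)^-1; set q := n%:R `^ _.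
  set Sg := \sum_(1 <= i < n.+1) _ in tauD *.
  have -> : (2 / mu * (q * BW)) ^+ m = (2 / mu * BW) ^+ m * q ^+ m.
    by rewrite -exprMn; congr (_ ^+ m); ring.
  have W0 : 0 <= s * (2 * (2 / mu * ((2 / mu * BW) ^+ m * q ^+ m))).
    rewrite mulr_ge0 ?invr_ge0 ?sqrtr_ge0 // mulr_ge0 // mulr_ge0 ?divr_ge0 ?(ltW mu0) //.
    by rewrite mulr_ge0 ?exprn_ge0 ?powR_ge0 // mulr_ge0 ?divr_ge0 ?(ltW mu0).
  apply: le_trans (ler_wpM2l W0 (lerD tauD tauD)) _.
  by rewrite le_eqVlt; apply/orP; left; apply/eqP; ring.
rewrite ler_pdivrMr //.
have -> : e * ((C1 + 1) / e * an) = (C1 + 1) * an by field; rewrite gt_eqF.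
have c02 : 0 <= (1 + c 0) / 2 by rewrite divr_ge0 // addr_ge0.
apply: le_trans (ler_wpM2r c02 key) _.
have -> : 2 * (2 / mu * (2 / mu * BW) ^+ m) * (2 * D 0) * an * ((1 + c 0) / 2) = C1 * an.
  by rewrite /C1; ring.
by rewrite ler_wpM2r ?(ltW an0) // lerDl.
Qed.
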